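(* Let $\phi:E_2\to E_2$ be a non-zero isogeny of degree $d$ of the elliptic curve $E_2: y^2=x^3-1$ over $\mathbb{C}$. Then $\phi$ transforms the $x$-coordinate as $x\mapsto x\,\mu(x^3)$, where $\mu(s)$ is a rational function over $\mathbb{C}$ with a finite non-zero limit $\mu_0=\lim_{s\to\infty}\mu(s)$. Moreover, the identity $$ {}_2F_1\!\left(\tfrac12,\tfrac16;\tfrac76;\,z\right)=\left(\frac{\mu(1/z)}{\mu_0}\right)^{-1/2}{}_2F_1\!\left(\tfrac12,\tfrac16;\tfrac76;\,\frac{z}{\mu(1/z)^3}\right) $$ holds, and the degree of the rational function $z/\mu(1/z)^3$ (in $z$) is equal to $d$.
   Context: $E_2$ is the elliptic curve over $\mathbb{C}$ given by $y^2=x^3-1$, with the point at infinity as the neutral element. An isogeny here is an isogeny endomorphism: an algebraic map $E_2\to E_2$ respecting the addition law (equivalently, fixing the point at infinity). ''Transforms the $x$-coordinate as $x\mapsto x\,\mu(x^3)$'' means that the $x$-component of $\phi(x,y)$ is the function $x\,\mu(x^3)$. ${}_2F_1(A,B;C;z)$ is the Gauss hypergeometric function. The identity is one of analytic functions in a neighbourhood of $z=0$, where the power factor $(\mu(1/z)/\mu_0)^{-1/2}$ is the branch with value $1$ at $z=0$. The degree of a rational function is its degree as a map $\mathbb{P}^1\to\mathbb{P}^1$. *)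

(* Defs.v *)
From mathcomp Require Import all_boot all_order all_algebra.
From mathcomp Require Import complex ring.
From mathcomp Require Import all_classical all_reals all_analysis.
(* The notations of [mpoly] clash with those of [all_analysis]. *)
From mathcomp Require mpoly.
Import (canonicals, coercions) mpoly.

Set Implicit Arguments.
Unset Strict Implicit.
Unset Printing Implicit Defensive.

Import Order.TTheory GRing.Theory Num.Theory.
Import numFieldNormedType.Exports.

Local Open Scope classical_set_scope.
Local Open Scope complex_scope.
Local Open Scope ring_scope.

(* R[i], seen as a [numClosedFieldType] so that the topology given by the
   modulus is inferred. *)
Definition CC (R : realType) : numClosedFieldType := R[i].

Section Curves.
Variable K : numClosedFieldType.

(* The points of an irreducible curve in a projective space over K, each with
   a choice of homogeneous coordinates.  The notions below do not depend on
   that choice, since they only involve homogeneous polynomials. *)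
Record curve := Curve {
  point :> Type;
  ambient_dim : nat;
  hcoord : point -> 'I_ambient_dim.+1 -> K
}.

Definition form (V : curve) (k : nat) (F : mpoly.mpoly (ambient_dim V).+1 K) :
  Prop := F \is mpoly.ishomog1 k (@mpoly.mdeg (ambient_dim V).+1).

Definition feval (V : curve) (F : mpoly.mpoly (ambient_dim V).+1 K) (P : V) : K :=
  mpoly.meval (hcoord P) F.

(* Near every point P, phi is given by forms of a common degree that do not all
   vanish at P. *)
Definition morphism (V W : curve) (phi : V -> W) : Prop :=
  forall P : V, exists (k : nat)
      (F : 'I_(ambient_dim W).+1 -> mpoly.mpoly (ambient_dim V).+1 K),
    [/\ forall i, form k (F i),
        exists i, feval (F i) P != 0
      & forall Q : V, (exists i, feval (F i) Q != 0) ->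
          exists2 c : K, c != 0 &
            forall i, feval (F i) Q = c * hcoord (phi Q) i].

(* The nonempty Zariski-open subsets of an irreducible curve V are its cofinite
   subsets, so that the function field K(V) is the set of functions satisfying
   [ratfun] modulo [eqcof].  Values on a finite set are irrelevant. *)
Definition eqcof (T : Type) (f g : T -> K) : Prop :=
  cofinite_set [set P | f P = g P].

Definition ratfun (V : curve) (f : V -> K) : Prop :=
  exists (k : nat) (A B : mpoly.mpoly (ambient_dim V).+1 K),
    [/\ form k A, form k B,
        cofinite_set [set P : V | feval B P != 0]
      & eqcof f (fun P => feval A P / feval B P)].

(* d = [K(V) : phi^* K(W)], where phi^* h = h \o phi: the family e is a basis
   of K(V) over the subfield phi^* K(W).  A constant phi has no degree. *)
Definition has_degree (V W : curve) (phi : V -> W) (d : nat) : Prop :=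
  exists e : 'I_d -> V -> K,
    (forall i, ratfun (e i)) /\
    forall f : V -> K, ratfun f ->
      exists h : 'I_d -> W -> K,
        [/\ forall i, ratfun (h i),
            eqcof f (fun P => \sum_(i < d) h i (phi P) * e i P)
          & forall h' : 'I_d -> W -> K, (forall i, ratfun (h' i)) ->
              eqcof f (fun P => \sum_(i < d) h' i (phi P) * e i P) ->
              forall i, eqcof (h' i) (h i)].

(* [Some z] is (z : 1) and [None] is (1 : 0). *)
Definition P1 : curve :=
  @Curve (option K) 1 (fun P => if P is Some z then tnth [tuple z; 1]
                                else tnth [tuple 1; 0]).

(* g is a rational function whose extension f to P^1 has degree d as a map from
   P^1 to P^1; the values of g at its finitely many poles are irrelevant. *)
Definition ratfun_degree (g : K -> K) (d : nat) : Prop :=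
  exists f : P1 -> P1,
    [/\ morphism f, cofinite_set [set z : K | f (Some z) = Some (g z)]
      & has_degree f d].

End Curves.

Section E2.
Variable K : numClosedFieldType.

(* [None] is the point at infinity. *)
Definition on_E2 (P : option (K * K)) : bool :=
  if P is Some (x, y) then y ^+ 2 == x ^+ 3 - 1 else true.

Definition E2_point : Type := {P : option (K * K) | on_E2 P}.

Definition E2 : curve K :=
  @Curve K E2_point 2 (fun P => if val P is Some (x, y) then tnth [tuple x; y; 1]
                                else tnth [tuple 0; 1; 0]).

Definition E2_zero : E2 := exist (fun P => on_E2 P) None isT.

(* The chord-tangent addition law on y^2 = x^3 - 1. *)
Definition E2_slope (x1 y1 x2 y2 : K) : K :=
  if x1 == x2 then (3 * x1 ^+ 2) / (2 * y1) else (y2 - y1) / (x2 - x1).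

Definition E2_add_coord (P Q : option (K * K)) : option (K * K) :=
  match P, Q with
  | None, _ => Q
  | _, None => P
  | Some (x1, y1), Some (x2, y2) =>
      if (x1 == x2) && (y1 == - y2) then None else
      let l := E2_slope x1 y1 x2 y2 in
      let x3 := l ^+ 2 - x1 - x2 in
      Some (x3, l * (x1 - x3) - y1)
  end.

Lemma on_E2_add (P Q : E2_point) : on_E2 (E2_add_coord (val P) (val Q)).
Proof.
case: P Q => [[[x1 y1]|] /= hP] [[[x2 y2]|] /= hQ] //.
have [eP eQ] := (eqP hP, eqP hQ).
case: ifP => //= hn; apply/eqP; rewrite /E2_slope.
have [ex|nx] := eqVneq x1 x2; last first.
  have nd : x2 - x1 != 0 by rewrite subr_eq0 eq_sym.
  set l := (y2 - y1) / (x2 - x1).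
  have el : l * (x2 - x1) = y2 - y1 by rewrite divfK.
  apply/eqP; rewrite -subr_eq0 -(mulIr_eq0 _ (mulIf nd)); apply/eqP.
  have ey : y2 = y1 + l * (x2 - x1) by rewrite el; ring.
  have e1 : (2 * y1 * l + l ^+ 2 * (x2 - x1)) = x2 ^+ 2 + x1 * x2 + x1 ^+ 2.
    apply: (mulIf nd); transitivity (y2 ^+ 2 - y1 ^+ 2); first by rewrite ey; ring.
    by rewrite eP eQ; ring.
  have e2 : 2 * y1 * l = x2 ^+ 2 + x1 * x2 + x1 ^+ 2 - l ^+ 2 * (x2 - x1).
    by rewrite -e1; ring.
  set x3 := l ^+ 2 - x1 - x2.
  transitivity ((l ^+ 2 * (x1 - x3) ^+ 2 - (2 * y1 * l) * (x1 - x3) + y1 ^+ 2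
                 - (x3 ^+ 3 - 1)) * (x2 - x1)); first by ring.
  by rewrite e2 eP /x3; ring.
subst x2; have ny : y1 != - y2 by move: hn; rewrite eqxx /= => /negbT.
have ey : y1 = y2.
  have: (y1 - y2) * (y1 + y2) = 0 by rewrite -subr_sqr eP eQ subrr.
  move/eqP; rewrite mulf_eq0 subr_eq0 => /orP[/eqP //|].
  by rewrite addr_eq0 (negbTE ny).
have y0 : 2 * y1 != 0.
  by rewrite mulf_neq0 ?pnatr_eq0//; apply: contra ny; rewrite -ey => /eqP->; rewrite oppr0.
set l := _ / _.
have el : 2 * y1 * l = 3 * x1 ^+ 2 by rewrite mulrC divfK.
set x3 := l ^+ 2 - x1 - x1.
transitivity (l ^+ 2 * (x1 - x3) ^+ 2 - (2 * y1 * l) * (x1 - x3) + y1 ^+ 2); first by ring.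
by rewrite el eP /x3; ring.
Qed.

Definition E2_add (P Q : E2) : E2 := exist (fun P => on_E2 P) _ (on_E2_add P Q).

Definition isogeny (phi : E2 -> E2) : Prop :=
  morphism phi /\ forall P Q : E2, phi (E2_add P Q) = E2_add (phi P) (phi Q).

Definition fracval (p q : {poly K}) (s : K) : K := p.[s] / q.[s].

(* The x-component of phi(x, y) is x * mu(x^3), where mu = p / q in lowest
   terms.  The vanishing of q at x^3 is equivalent to x * mu(x^3) having a pole
   (also for x = 0), that is to phi(x, y) being the point at infinity. *)
Definition transforms_x (phi : E2 -> E2) (p q : {poly K}) : Prop :=
  forall P : E2,
    match val P, val (phi P) with
    | Some (x, _), Some (x', _) =>
        q.[x ^+ 3] != 0 /\ x' = x * fracval p q (x ^+ 3)
    | Some (x, _), None => q.[x ^+ 3] = 0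
    | None, _ => True
    end.

End E2.

Section Analysis.
Variable K : numClosedFieldType.

Definition rising (a : K) (n : nat) : K := \prod_(i < n) (a + i%:R).

(* The Gauss hypergeometric series. *)
Definition hyp2F1 (A B C z : K) : K :=
  limn (series (fun n => rising A n * rising B n / (rising C n * n`!%:R) * z ^+ n)).

(* The filter of the neighbourhoods of the point at infinity, for limits as
   s tends to infinity in K (here, unlike in [+oo], in all directions). *)
Definition infty_nbhs : set_system K :=
  [set A | exists2 M : K, M \is Num.real & forall s, M < `|s| -> A s].

Lemma infty_nbhs_proper : ProperFilter infty_nbhs.
Proof.
apply: Build_ProperFilter_ex.
  move=> A [M Mr hM]; exists (`|M| + 1); apply: hM.
  rewrite ger0_norm ?addr_ge0//.
  by apply: le_lt_trans (real_ler_norm Mr) _; rewrite ltrDl.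
split.
- by exists 0.
- move=> A B [M Mr hM] [N Nr hN]; exists (`|M| + `|N|); first exact: realD.
  move=> s hs; split; [apply: hM | apply: hN]; apply: le_lt_trans hs.
    by apply: le_trans (real_ler_norm Mr) _; rewrite lerDl.
  by apply: le_trans (real_ler_norm Nr) _; rewrite lerDr.
- by move=> A B AB [M Mr hM]; exists M => // s /hM /AB.
Qed.

(* g is the branch of h^(-1/2) with value 1 at 0.  The value h 0 is not used:
   below, h z is given by a formula involving 1/z. *)
Definition inv_sqrt_branch (h g : K -> K) : Prop :=
  [/\ \forall z \near (0 : K), derivable g z 1,
      g 0 = 1
    & \forall z \near (0 : K)^', g z ^+ 2 = (h z)^-1].

End Analysis.

Arguments infty_nbhs K _ : clear implicits.

(* Main.v *)
Require Import Defs.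
From mathcomp Require Import all_boot all_order all_algebra.
From mathcomp Require Import separable complex ring lra zify.
From mathcomp Require Import all_classical all_reals all_analysis.
From mathcomp Require mpoly.
Import (canonicals, coercions) mpoly.

(**
Write f for the x-coordinate of phi(x, y).  Since phi is a homomorphism, phi
commutes with (x, y) |-> (x, -y), so that f is a rational function of x alone
and the y-coordinate of phi is y g(x) with g rational
([isogeny_structure]); the equation of the curve gives
(x^3 - 1) g^2 = f^3 - 1.  Comparing multiplicities of zeros and poles in this
identity shows that f'/g has neither, hence is a constant c; this is the
statement that phi multiplies the invariant differential dx/y by c
([invdiff_of_curve]).  Thus

   (x^3 - 1) f'^2 = c^2 (f^3 - 1),    f ~ x / c^2 at infinity,

the last point because phi fixes the point at infinity.  A solution of this
equation is determined by its leading term: for the difference of two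
solutions, of order x^m at infinity, the leading terms in the equation give
2 m = 3 ([invdiff_uniq]).  With w a primitive cube root of 1, f(w x) / w is a
solution with the same leading term, so f(w x) = w f(x), which means
f = x mu(x^3) ([invdiff_cubic]), and mu tends to mu0 = 1 / c^2 at infinity.
The local expressions of phi at every point, together with the irreducibility
of the curve, extend the formula to all points ([isogeny_exact]).

The hypergeometric identity.  Let F be the series 2F1(1/2, 1/6; 7/6) and
S = (1 - z)^(-1/2); comparing coefficients, 6 z F' + F = S, which says that
z^(1/6) F is a primitive of z^(-5/6) S / 6, that is, of the differential
dx/y in the coordinate z = x^(-3), up to a constant factor.  With
M(z) = mu(1/z), g = (M / mu0)^(-1/2) and G = g F(z / M^3), the differential
equation of f becomes 6 z G' + G = S, so H = G - F satisfies 6 z H' + H = 0.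
Then (z H^6)' = 0, so z H^6 is constant, H = 0 and the identity follows
([hypergeometric_transformation]).

The degree.  Put s = x^3 and let A / B be the reduced form of s mu(s)^3, with
deg A = m > deg B.  Then A(s) = t B(s) with t = s o phi on the curve, and the
same relation holds on the projective line for s = 1/z and the map
z / mu(1/z)^3.  In both cases the powers 1, s, ..., s^(m-1) form a basis of the
function field over the pulled back function field
([degree_of_coordinate]): the polynomial relation makes their span stable under
multiplication by s and by 1 / (s - r), and they are independent because a
generic fibre has m points with distinct values of s.  So both maps have
degree m, and d = m because a basis has only one possible cardinality
([has_degree_le]).
*)

Set Implicit Arguments.
Unset Strict Implicit.
Unset Printing Implicit Defensive.

Import Order.TTheory GRing.Theory Num.Theory.
Import numFieldNormedType.Exports.

Local Open Scope classical_set_scope.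
Local Open Scope ring_scope.

(** * Polynomial solutions of the equation of the invariant differential *)

Section PolynomialAlgebra.
Variable K : numClosedFieldType.
Implicit Types (p q P Q T D V W : {poly K}).

(** Both polynomials split into linear factors, so divisibility can be tested on
    multiplicities of roots. *)
Lemma dvdp_mup p q : p != 0 -> q != 0 ->
  (forall a, (mup a p <= mup a q)%N) -> p %| q.
Proof.
move=> p0 q0 h; have [r pE] := closed_field_poly_normal p.
have lp0 : lead_coef p != 0 by rewrite lead_coef_eq0.
have {}h a : (count_mem a r <= mup a q)%N.
  apply: leq_trans (h a); rewrite -mu_prod_XsubC mup_geq// pE dvdpZr//.
  by rewrite -mup_geq// monic_neq0// monic_prod_XsubC.
rewrite pE dvdpZl//; elim: r q q0 h {pE} => [|z r IH] q q0 h.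
  by rewrite big_nil dvd1p.
have /dvdpP[q1 qE] : 'X - z%:P %| q.
  by rewrite XsubC_dvd// (leq_trans _ (h z))//= eqxx.
have q10 : q1 != 0 by apply: contraNneq q0 => q10; rewrite qE q10 mul0r.
have X0 : 'X - z%:P != 0 by rewrite polyXsubC_eq0.
rewrite big_cons qE mulrC dvdp_mul2r//; apply: IH => // a.
have := h a; rewrite qE mupM//= (@mup_XsubCX _ 1 a z).
by case: (z == a); rewrite ?addn1 ?addn0// add1n ltnS.
Qed.

Lemma dvdp_XsubC_deriv (a : K) n D :
  ('X - a%:P) ^+ n.+1 %| D -> ('X - a%:P) ^+ n %| D^`().
Proof.
case/dvdpP => u ->; rewrite derivM deriv_exp derivXsubC mul1r /=.
apply: dvdp_add; first by rewrite exprS mulrCA dvdp_mull// dvdp_mulIr.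
by rewrite -mulr_natl !dvdp_mull.
Qed.

Definition wronskian P Q := P^`() * Q - P * Q^`().

Lemma wronskian_root_dvd (a : K) n P Q : ('X - a%:P) ^+ n.+1 %| Q ->
  ('X - a%:P) ^+ n %| wronskian P Q.
Proof.
move=> h; rewrite dvdp_sub// dvdp_mull//; last exact: dvdp_XsubC_deriv.
by apply: dvdp_trans h; rewrite exprS dvdp_mull.
Qed.

(** The derivative of f^3 - 1 is 3 f^2 f', here with f = P / Q and the denominators
    cleared.  It relates the order of vanishing of the Wronskian to that of
    P^3 - Q^3, as [wronskian_root_dvd] does for Q. *)
Lemma wronskian_cubes P Q :
  3 * (P ^+ 2 * wronskian P Q) =
  (P ^+ 3 - Q ^+ 3)^`() * Q - 3 * (P ^+ 3 - Q ^+ 3) * Q^`().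
Proof. by rewrite /wronskian derivB !deriv_exp /=; ring. Qed.

Lemma coprimep_no_common_root P Q (a : K) :
  coprimep P Q -> P.[a] = 0 -> Q.[a] = 0 -> False.
Proof. by move=> c /rootP /(coprimep_root c) /eqP. Qed.

Lemma wronskian_root_dvd_cubes (a : K) n P Q : coprimep P Q ->
  ('X - a%:P) ^+ n.+1 %| P ^+ 3 - Q ^+ 3 -> ('X - a%:P) ^+ n %| wronskian P Q.
Proof.
move=> cPQ h.
have Pa : coprimep (('X - a%:P) ^+ n) (P ^+ 2).
  apply/coprimep_expl/coprimep_expr; rewrite coprimep_sym coprimep_XsubC.
  apply/negP => /rootP Pa.
  have /rootP : root (P ^+ 3 - Q ^+ 3) a.
    by rewrite -dvdp_XsubCl; apply: dvdp_trans h; rewrite exprS dvdp_mulIl.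
  rewrite !hornerE Pa expr0n /= sub0r => /eqP; rewrite oppr_eq0 expf_eq0/= => Qa.
  exact: coprimep_no_common_root cPQ Pa (eqP Qa).
rewrite -(Gauss_dvdpr _ Pa) -(dvdpZr _ _ (_ : 3%:R != 0 :> K)) ?pnatr_eq0//.
rewrite scaler_nat -mulr_natl wronskian_cubes dvdp_sub//.
  by rewrite dvdp_mulr// dvdp_XsubC_deriv.
rewrite dvdp_mulr// dvdp_mull//.
by apply: dvdp_trans h; rewrite exprS dvdp_mull.
Qed.

Definition cubX1 : {poly K} := 'X^3 - 1.

Lemma cubX1_neq0 : cubX1 != 0.
Proof. by rewrite -size_poly_eq0 size_XnsubC. Qed.

Lemma mup_cubX1 (a : K) : (mup a cubX1 <= 1)%N.
Proof.
rewrite mup_leq ?cubX1_neq0//; apply/negP => h.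
have /dvdp_XsubC_deriv : ('X - a%:P) ^+ 1.+1 %| cubX1 by [].
rewrite expr1 /cubX1 derivB derivXn derivC subr0 /= dvdp_XsubCl => /rootP.
rewrite hornerMn hornerXn => /eqP; rewrite mulrn_eq0 /= expf_eq0 /= => /eqP a0.
have /rootP : root cubX1 a.
  by rewrite -dvdp_XsubCl; apply: dvdp_trans h; rewrite exprS dvdp_mulIl.
by rewrite !hornerE a0 expr0n /= sub0r => /eqP; rewrite oppr_eq0 oner_eq0.
Qed.

(** p = a X^n + lower order terms.  The case a = 0 is allowed, so that leading
    terms can be added and multiplied before knowing whether they cancel. *)
Definition leading_term p n (a : K) := (size p <= n.+1)%N /\ p`_n = a.

Lemma coprime_reduction p1 q1 : q1 != 0 ->
  exists p q g : {poly K}, [/\ g != 0, coprimep p q, p1 = p * g & q1 = q * g].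
Proof.
move=> q10; have pq : (p1 != 0) || (q1 != 0) by rewrite q10 orbT.
exists (p1 %/ gcdp p1 q1), (q1 %/ gcdp p1 q1), (gcdp p1 q1); split.
- by rewrite gcdp_eq0 negb_and.
- exact: coprimep_div_gcd.
- by rewrite divpK// dvdp_gcdl.
- by rewrite divpK// dvdp_gcdr.
Qed.

Lemma leading_term_lead_coef p : leading_term p (size p).-1 (lead_coef p).
Proof. by split; rewrite ?lead_coefE// leqSpred. Qed.

Lemma leading_term_size p n a : leading_term p n a -> a != 0 -> size p = n.+1.
Proof.
move=> [sp pn] a0; apply/eqP; rewrite eqn_leq sp ltnNge.
by apply: contra a0 => /leq_sizeP/(_ n (leqnn _)); rewrite pn => ->.
Qed.

Lemma leading_term_lt p n : (size p <= n)%N -> leading_term p n 0.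
Proof. by move=> h; split; [exact: leqW | rewrite nth_default]. Qed.

Lemma leading_term_uniq p n m a b : leading_term p n a -> leading_term p m b -> a != 0 -> b != 0 ->
  n = m /\ a = b.
Proof.
move=> h1 h2 a0 b0; have := leading_term_size h1 a0; rewrite (leading_term_size h2 b0) => -[mn].
by subst m; split=> //; case: h1 h2 => _ <- [_ <-].
Qed.

Lemma leading_termM p q m n a b : leading_term p m a -> leading_term q n b ->
  leading_term (p * q) (m + n) (a * b).
Proof.
move=> [sp pm] [sq qn]; split.
  apply: leq_trans (size_polyMleq _ _) _.
  by move: sp sq; lia.
rewrite coefM (bigD1 (inord m)) //= inordK ?ltnS ?leq_addr// addKn pm qn.
rewrite big1 ?addr0// => i; rewrite -val_eqE /= inordK ?ltnS ?leq_addr// => im.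
have [lim|lmi] := ltnP m i; first by rewrite nth_default ?mul0r// (leq_trans sp).
rewrite [q`_ _]nth_default ?mulr0// (leq_trans sq)//.
by move: (val i) im lmi => j /eqP; lia.
Qed.

Lemma leading_termX p n a k : leading_term p n a -> leading_term (p ^+ k) (n * k) (a ^+ k).
Proof.
move=> h; elim: k => [|k IH]; last by rewrite !exprS mulnS; apply: leading_termM.
by rewrite !expr0 muln0; split; rewrite ?size_poly1// coef1.
Qed.

Lemma leading_termD p q n a b : leading_term p n a -> leading_term q n b ->
  leading_term (p + q) n (a + b).
Proof.
move=> [sp pn] [sq qn]; split; last by rewrite coefD pn qn.
by rewrite (leq_trans (size_polyD _ _))// geq_max sp.
Qed.

Lemma leading_termZ p n a c : leading_term p n a -> leading_term (c *: p) n (c * a).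
Proof.
move=> [sp pn]; split; last by rewrite coefZ pn.
by rewrite (leq_trans (size_scale_leq _ _)).
Qed.

Lemma leading_termN p n a : leading_term p n a -> leading_term (- p) n (- a).
Proof. by move=> [sp pn]; split; rewrite ?size_polyN// coefN pn. Qed.

Lemma leading_termB p q n a b : leading_term p n a -> leading_term q n b ->
  leading_term (p - q) n (a - b).
Proof. by move=> hp /leading_termN; apply: leading_termD. Qed.

Lemma leading_termXn n : leading_term 'X^n n 1.
Proof. by split; rewrite ?size_polyXn// coefXn eqxx. Qed.

(** The Euler operator X p' is used instead of p' because it keeps the degree,
    also for constants. *)
Lemma leading_term_euler p n a : leading_term p n a -> leading_term ('X * p^`()) n (n%:R * a).
Proof.
move=> [sp pn]; split; last first.
  rewrite coefXM; case: n pn {sp} => [|n] pn; first by rewrite mul0r.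
  by rewrite /= coef_deriv pn mulr_natl.
apply/leq_sizeP => j nj; rewrite coefXM; case: j nj => // j nj.
by rewrite coef_deriv nth_default ?mul0rn// (leq_trans sp).
Qed.

Lemma leading_term_wronskian P Q m n a b : leading_term P m a -> leading_term Q n b ->
  leading_term ('X * wronskian P Q) (m + n) ((m%:R - n%:R) * (a * b)).
Proof.
move=> hP hQ; have -> : 'X * wronskian P Q = 'X * P^`() * Q - P * ('X * Q^`()).
  by rewrite /wronskian; ring.
have -> : (m%:R - n%:R) * (a * b) = m%:R * a * b - a * (n%:R * b) by ring.
by apply: leading_termB; apply: leading_termM => //; apply: leading_term_euler.
Qed.

Lemma leading_term_cubX1 : leading_term cubX1 3 1.
Proof. by rewrite -[1 in X in leading_term _ _ X]subr0; apply: leading_termB;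
  [exact: leading_termXn | apply: leading_term_lt; rewrite size_poly1]. Qed.

Lemma leading_term_neq0 p n a : leading_term p n a -> a != 0 -> p != 0.
Proof. by move=> hp /(leading_term_size hp) e; rewrite -size_poly_eq0 e. Qed.

(** With f = P / Q this is (X^3 - 1) f'^2 = (b / a) (f^3 - 1): phi multiplies the
    invariant differential dx/y by a square root of b / a. *)
Definition invdiff P Q (a b : K) :=
  a *: (wronskian P Q ^+ 2 * cubX1) = b *: (Q * (P ^+ 3 - Q ^+ 3)).

(** The hypothesis is (X^3 - 1) g^2 = f^3 - 1 for f = P / Q and g = T / n, and
    size Q < size P says that f has a pole at infinity.  A zero of order k of f^3 - 1 or a
    pole of order k of f is a zero of order at least k - 1 of the Wronskian; as the order of
    Q (P^3 - Q^3) (X^3 - 1) is even at every point, this is enough for f' / g to have no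
    finite pole, hence to be a polynomial.  Comparing degrees makes it a constant. *)
Lemma invdiff_of_curve P Q T (n : {poly K}) : coprimep P Q -> n != 0 -> Q != 0 ->
  (size Q < size P)%N ->
  cubX1 * T ^+ 2 * Q ^+ 3 = n ^+ 2 * (P ^+ 3 - Q ^+ 3) ->
  size P = (size Q).+1 /\ invdiff P Q (lead_coef P) (lead_coef Q).
Proof.
move=> cPQ n0 Q0 szQP eqT.
have P0 : P != 0 by rewrite -size_poly_gt0 (leq_trans _ szQP).
set D1 := Q; set D2 := P ^+ 3 - Q ^+ 3; set D3 := cubX1.
have D30 : D3 != 0 := cubX1_neq0.
set a := lead_coef P; set b := lead_coef Q.
have a0 : a != 0 by rewrite lead_coef_eq0.
have b0 : b != 0 by rewrite lead_coef_eq0.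
have tP := leading_term_lead_coef P; have tQ := leading_term_lead_coef Q; rewrite -/a -/b in tP tQ.
set p' := (size P).-1 in tP; set q' := (size Q).-1 in tQ.
have q'p' : (q' < p')%N.
  by rewrite /q' /p' -ltnS !prednK// size_poly_gt0.
have tD2 : leading_term D2 (p' * 3) (a ^+ 3).
  rewrite -[a ^+ 3]subr0; apply: leading_termB; first exact: leading_termX.
  apply: leading_term_lt; rewrite (leq_trans (size_poly_exp_leq _ _))//.
  by rewrite ltn_mul2r.
have D20 : D2 != 0 by apply: leading_term_neq0 tD2 _; rewrite expf_neq0.
(* Th is (Q^2 (X^3 - 1) T / n)^2, hence the square of a polynomial V. *)
set Th := D1 * D2 * D3.
have Th0 : Th != 0 by rewrite !mulf_neq0.
have /dvdpP[V VE] : n %| Q ^+ 2 * D3 * T.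
  rewrite -(@dvdp_pexp2r _ _ _ 2)// (_ : (Q ^+ 2 * D3 * T) ^+ 2 = n ^+ 2 * Th) ?dvdp_mulIl//.
  transitivity (Q * D3 * (D3 * T ^+ 2 * Q ^+ 3)); first by ring.
  by rewrite eqT /Th /D1 /D2; ring.
have VTh : V ^+ 2 = Th.
  apply: (@mulIf _ (n ^+ 2)); rewrite ?expf_neq0// -exprMn -VE.
  transitivity (Q * D3 * (D3 * T ^+ 2 * Q ^+ 3)); first by ring.
  by rewrite eqT /Th /D1 /D2; ring.
have V0 : V != 0 by apply: contraNneq Th0 => V0; rewrite -VTh V0 expr0n.
have tW := leading_term_wronskian tP tQ.
have pq0 : (p'%:R - q'%:R) * (a * b) != 0.
  by rewrite !mulf_neq0// subr_eq0 eqr_nat gtn_eqF.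
set W := wronskian P Q.
have W0 : W != 0.
  by have := leading_term_neq0 tW pq0; rewrite mulf_eq0 polyX_eq0.
(* h is c = f' / g, up to a constant. *)
have /dvdpP[h hE] : V %| W * D3.
  apply: dvdp_mup => // [|x]; first by rewrite mulf_neq0.
  rewrite mupM//.
  have : (mup x V + mup x V = mup x D1 + mup x D2 + mup x D3)%N.
    by rewrite -mupM// -expr2 VTh /Th !mupM// mulf_neq0.
  have := mup_cubX1 x; rewrite -/D3.
  have i1 : (mup x D1 <= (mup x W).+1)%N.
    case E: (mup x D1) => [//|i]; rewrite ltnS mup_geq//.
    by apply: wronskian_root_dvd; rewrite -mup_geq// E.
  have i2 : (mup x D2 <= (mup x W).+1)%N.
    case E: (mup x D2) => [//|i]; rewrite ltnS mup_geq//.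
    by apply: wronskian_root_dvd_cubes => //; rewrite -mup_geq// E.
  have i3 : mup x D1 = 0%N \/ mup x D2 = 0%N.
    have [r1|/mupNroot] := boolP (root D1 x); [right|by left].
    apply: mupNroot; apply/negP => /rootP; rewrite !hornerE (rootP r1) expr0n /= subr0.
    move=> /eqP; rewrite expf_eq0 /= => Px.
    exact: coprimep_no_common_root cPQ (eqP Px) (rootP r1).
  move: i1 i2 i3; lia.
have h0 : h != 0 by apply: contraTneq (mulf_neq0 W0 D30) => h0; rewrite hE h0 mul0r eqxx.
have eqW : W ^+ 2 * D3 = h ^+ 2 * (D1 * D2).
  by apply: (mulIf D30); rewrite -mulrA -expr2 -exprMn hE exprMn VTh /Th; ring.
have th := leading_term_lead_coef h; have lh0 : lead_coef h != 0 by rewrite lead_coef_eq0.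
have tL := leading_termM (leading_termX 2 tW) leading_term_cubX1.
have tR := leading_termM (leading_termM (leading_termXn 2) (leading_termX 2 th)) (leading_termM
  tQ tD2).
have eLR : ('X * W) ^+ 2 * D3 = 'X^2 * h ^+ 2 * (D1 * D2).
  by rewrite -[RHS]mulrA -eqW; ring.
rewrite -/W -/D3 eLR in tL.
have [||en ec] := leading_term_uniq tL tR.
- by rewrite mulr1 expf_neq0.
- by rewrite mul1r !mulf_neq0 ?expf_neq0.
have [eh ep] : (size h).-1 = 0%N /\ p' = q'.+1.
  have aux (x y z : nat) : (y < x)%N ->
    ((x + y) * 2 + 3 = 2 + z * 2 + (y + x * 3))%N -> z = 0%N /\ x = y.+1.
    by clear; lia.
  exact: aux q'p' en.
have sP : (size P).-1.+1 = size P by rewrite prednK// size_poly_gt0.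
have sQ : (size Q).-1.+1 = size Q by rewrite prednK// size_poly_gt0.
split; first by rewrite -sP -sQ; congr _.+1; exact: ep.
have hC : h = (lead_coef h)%:P.
  by rewrite lead_coefE eh; apply: size1_polyC; move: eh; case: (size h) => [|[]].
rewrite /invdiff -/W -/D2 -/D1 -/D3 eqW {1}hC -polyC_exp mul_polyC scalerA; congr (_ *: _).
move: ec; rewrite ep -natr1 addrAC subrr add0r !mul1r mulr1 => ec.
have /mulIf : a ^+ 2 * b != 0 by rewrite mulf_neq0 ?expf_neq0.
apply; transitivity (lead_coef h ^+ 2 * (b * a ^+ 3)); first by ring.
by rewrite -ec; ring.
Qed.

(** Let D be the difference of two solutions with the same leading term.
    Subtracting the equations, (X^3 - 1) (f' - f1') (f' + f1') is proportional to
    (f - f1) (f^2 + f f1 + f1^2).  If f - f1 has order x^m at infinity, the leading terms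
    give 2 m = 3, which is impossible for an integer m. *)
Lemma invdiff_uniq P Q P1 Q1 n a b a1 b1 :
  leading_term P n.+1 a -> leading_term Q n b -> leading_term P1 n.+1 a1 -> leading_term Q1 n b1 ->
  a != 0 -> b != 0 -> b1 != 0 -> a * b1 = a1 * b ->
  invdiff P Q a b -> invdiff P1 Q1 a1 b1 -> P * Q1 = P1 * Q.
Proof.
move=> tP tQ tP1 tQ1 a0 b0 b10 eab o o1; apply/eqP; rewrite -subr_eq0; apply/negPn/negP.
set D := _ - _ => D0; set N := Q * Q1.
have tD := leading_term_lead_coef D; set e := lead_coef D in tD; set dl := (size D).-1 in tD.
have e0 : e != 0 by rewrite lead_coef_eq0.
have tN : leading_term N (n + n) (b * b1) := leading_termM tQ tQ1.
set W := wronskian P Q in o; set W1 := wronskian P1 Q1 in o1.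
have eD : W * Q1 ^+ 2 - W1 * Q ^+ 2 = wronskian D N.
  by rewrite /W /W1 /D /N /wronskian !poly.derivE; ring.
have eq1 : (a * b1) *: (cubX1 * (wronskian D N * (W * Q1 ^+ 2 + W1 * Q ^+ 2))) =
   (b * b1) *: (N * D * ((P * Q1) ^+ 2 + (P * Q1) * (P1 * Q) + (P1 * Q) ^+ 2)).
  have /(congr1 (fun X => b1 *: X * Q1 ^+ 4)) := o.
  have /(congr1 (fun X => b *: X * Q ^+ 4)) := o1.
  rewrite !scalerA -eD => h1 h2.
  transitivity ((b1 * a) *: (W ^+ 2 * cubX1) * Q1 ^+ 4 -
     (b * a1) *: (W1 ^+ 2 * cubX1) * Q ^+ 4).
    by rewrite [b * a1]mulrC -eab [b1 * a]mulrC -!mul_polyC; ring.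
  by rewrite h1 h2 [b1 * b]mulrC -!mul_polyC /N /D; ring.
have tW := leading_term_wronskian tP tQ; have tW1 := leading_term_wronskian tP1 tQ1.
have tS : leading_term ('X * (W * Q1 ^+ 2 + W1 * Q ^+ 2)) (n.+1 + n + n * 2)
    (2 * (a * b) * b1 ^+ 2).
  have -> : 'X * (W * Q1 ^+ 2 + W1 * Q ^+ 2) =
     'X * W * Q1 ^+ 2 + 'X * W1 * Q ^+ 2 by ring.
  have -> : 2 * (a * b) * b1 ^+ 2 =
    (n.+1%:R - n%:R) * (a * b) * b1 ^+ 2 + (n.+1%:R - n%:R) * (a1 * b1) * b ^+ 2.
    by rewrite -natr1; transitivity (a * b1 * (b * b1) + a * b1 * (b * b1)); [|rewrite {2}eab];
      ring.
  by apply: leading_termD; apply: leading_termM => //; apply: leading_termX.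
have tDN := leading_term_wronskian tD tN.
have tL := leading_termZ (a * b1) (leading_termM leading_term_cubX1 (leading_termM tDN tS)).
have tPQ1 : leading_term (P * Q1) (n.+1 + n) (a * b1) := leading_termM tP tQ1.
have tP1Q : leading_term (P1 * Q) (n.+1 + n) (a * b1).
  by rewrite eab; exact: leading_termM.
have tc : leading_term ((P * Q1) ^+ 2 + (P * Q1) * (P1 * Q) + (P1 * Q) ^+ 2)
    ((n.+1 + n) * 2) (3 * (a * b1) ^+ 2).
  have -> : 3 * (a * b1) ^+ 2 = (a * b1) ^+ 2 + (a * b1) * (a * b1) + (a * b1) ^+ 2 by ring.
  apply: leading_termD; [apply: leading_termD|]; [exact: leading_termX| |exact: leading_termX].
  by rewrite muln2 -addnn; apply: leading_termM.
have tR := leading_termZ (b * b1) (leading_termM (leading_termM (leading_termXn 2) (leading_termM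
  tN tD)) tc).
have eLR : (a * b1) *: (cubX1 * ('X * wronskian D N * ('X * (W * Q1 ^+ 2 + W1 * Q ^+ 2)))) =
  (b * b1) *: ('X^2 * (N * D) * ((P * Q1) ^+ 2 + (P * Q1) * (P1 * Q) + (P1 * Q) ^+ 2)).
  move/(congr1 (fun X => 'X^2 * X)) : eq1; rewrite -!scalerAr => eq1.
  transitivity ((a * b1) *: ('X^2 * (cubX1 * (wronskian D N * (W * Q1 ^+ 2 + W1 * Q ^+ 2))))).
    by congr (_ *: _); ring.
  by rewrite eq1; congr (_ *: _); ring.
(* The products are multiplied by X^2, one X for each derivative. *)
rewrite eLR in tL.
have eidx : (3 + (dl + (n + n) + (n.+1 + n + n * 2)) =
    2 + (n + n + dl) + (n.+1 + n) * 2)%N by move: dl n {tD tDN tL tR tS tc tPQ1 tP1Q tN tW tW1 tP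
      tQ tP1 tQ1}; clear; lia.
rewrite eidx in tL; have := tL.2; rewrite tR.2 => ec.
(* D / N has order m = dl - 2 n at infinity, so this is 2 m = 3. *)
have /eqP : (2 * dl%:R - (4 * n + 3)%:R) * (a ^+ 2 * b ^+ 2 * b1 ^+ 4 * e) = 0 :> K.
  move: ec => /esym/eqP; rewrite -subr_eq0 => /eqP ec.
  by rewrite -[RHS]ec; ring.
have /negPf c0 : a ^+ 2 * b ^+ 2 * b1 ^+ 4 * e != 0 by rewrite !mulf_neq0 ?expf_neq0.
rewrite mulf_eq0 c0 orbF subr_eq0 -natrM eqr_nat => /eqP.
by clear; lia.
Qed.

Lemma coef_comp_scaleX p c i : (p \Po (c *: 'X))`_i = c ^+ i * p`_i.
Proof.
rewrite coef_comp_poly; under eq_bigr => j _ do rewrite exprZn coefZ coefXn.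
have [ip|pi] := ltnP i (size p); last first.
  rewrite nth_default ?mulr0// big1// => j _.
  by rewrite gtn_eqF ?mulr0// (leq_trans _ pi).
rewrite (bigD1 (Ordinal ip))//= eqxx mulr1 big1 ?addr0 1?mulrC// => j.
by rewrite -val_eqE /= eq_sym => /negPf ->; rewrite !mulr0.
Qed.

Lemma leading_term_comp_scaleX p n a c : leading_term p n a ->
  leading_term (p \Po (c *: 'X)) n (c ^+ n * a).
Proof.
move=> [sp pn]; split; last by rewrite coef_comp_scaleX pn.
by apply/leq_sizeP => j nj; rewrite coef_comp_scaleX nth_default ?mulr0// (leq_trans sp).
Qed.

Lemma root3_exists : exists w : K, w ^+ 2 + w + 1 = 0.
Proof.
have /closed_rootP[w] : size ('X^2 + 'X + 1 : {poly K}) != 1%N.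
  by rewrite -addrA size_polyDl size_polyXn// size_XaddC.
by move=> /rootP; rewrite !hornerE; exists w.
Qed.

Section CubeRootOfUnity.
Variable w : K.
Hypothesis hw : w ^+ 2 + w + 1 = 0.

Lemma root3_cube : w ^+ 3 = 1.
Proof.
by apply/eqP; rewrite -subr_eq0; apply/eqP; transitivity ((w - 1) * (w ^+ 2 + w + 1));
  [ring|rewrite hw mulr0].
Qed.

Lemma root3_neq1 : w != 1.
Proof.
apply/eqP => w1; move: hw; rewrite w1 expr1n => /eqP.
by rewrite (_ : 1 + 1 + 1 = 3%:R) ?pnatr_eq0//; ring.
Qed.

Lemma root3_neq0 : w != 0.
Proof. by apply/eqP => w0; move: root3_cube; rewrite w0 expr0n /= => /esym/eqP;
  rewrite oner_eq0. Qed.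

Lemma root3_eq1 i : (w ^+ i == 1) = (3 %| i)%N.
Proof.
rewrite {1}(divn_eq i 3) exprD mulnC exprM root3_cube expr1n mul1r /dvdn.
have : (i %% 3 < 3)%N by rewrite ltn_mod.
case: (i %% 3)%N => [|[|[|//]]] _; rewrite ?expr0 ?expr1 ?eqxx ?(negPf root3_neq1)//.
apply/negP => /eqP w2; move: root3_neq1; move/eqP: root3_cube.
by rewrite exprS w2 mulr1 => ->.
Qed.

(** Only the coefficients of index divisible by 3 survive. *)
Lemma comp_poly_scaleX_invariant N :
  N \Po (w *: 'X) = N -> exists q, N = q \Po 'X^3.
Proof.
move=> NE; exists (\poly_(i < size N) N`_(i * 3)); apply/polyP => i.
rewrite coef_comp_poly_Xn// coef_poly.
have := congr1 (fun p : {poly K} => p`_i) NE; rewrite coef_comp_scaleX => e.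
have [d3|d3] := boolP (3 %| i)%N.
  rewrite divnK//; case: ltnP => // h; rewrite nth_default//.
  by apply: leq_trans h _; apply: leq_div.
move/eqP: e; rewrite -subr_eq0 -{2}[N`_i]mul1r -mulrBl mulf_eq0 subr_eq0 root3_eq1 (negPf d3).
by move=> /eqP.
Qed.

(** If f is a solution then so is f(w x) / w, because w^3 = 1. *)
Lemma invdiff_comp_scaleX P Q a b : invdiff P Q a b ->
  invdiff (P \Po (w *: 'X)) (w *: (Q \Po (w *: 'X))) a b.
Proof.
move=> /(congr1 (fun p => p \Po (w *: 'X))).
have dE (p : {poly K}) : (p \Po (w *: 'X))^`() = w *: (p^`() \Po (w *: 'X)).
  by rewrite deriv_comp derivZ derivX mulrC -mul_polyC mulr1 mul_polyC.
have w3P : (w%:P) ^+ 3 = 1 :> {poly K} by rewrite -polyC_exp root3_cube.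
have cE : cubX1 \Po (w *: 'X) = cubX1.
  rewrite /cubX1 comp_polyB rmorphXn/= comp_polyX exprZn root3_cube scale1r.
  by rewrite comp_polyC.
have eX (p : {poly K}) n : (p ^+ n) \Po (w *: 'X) = (p \Po (w *: 'X)) ^+ n.
  exact: rmorphXn.
rewrite /invdiff /wronskian !comp_polyZ !(eX, cE, comp_polyB, comp_polyM) => e.
rewrite !derivZ !dE; set P1 := P \Po _ in e *; set Q1 := Q \Po _ in e *.
set P1' := P^`() \Po _ in e *; set Q1' := Q^`() \Po _ in e *.
transitivity ((w%:P) ^+ 3 * w%:P * (a *: ((P1' * Q1 - P1 * Q1') ^+ 2 * cubX1))).
  by rewrite -!mul_polyC; ring.
rewrite e w3P mul1r -!mul_polyC.
have -> : (w%:P * Q1) ^+ 3 = Q1 ^+ 3 by rewrite exprMn w3P mul1r.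
by ring.
Qed.

End CubeRootOfUnity.

(** By uniqueness f(w x) = w f(x).  Multiplying numerator and denominator of f by
    Q(w x) Q(w^2 x) makes the denominator invariant under x |-> w x, hence a
    polynomial in x^3, and the numerator x times such a polynomial. *)
Lemma invdiff_cubic P Q : Q != 0 -> size P = (size Q).+1 ->
  invdiff P Q (lead_coef P) (lead_coef Q) ->
  exists p q : {poly K}, [/\ q != 0, coprimep p q &
    P * (q \Po 'X^3) = Q * ('X * (p \Po 'X^3))].
Proof.
move=> Q0 sP o; have [w hw] := root3_exists.
have P0 : P != 0 by rewrite -size_poly_eq0 sP.
set a := lead_coef P in o; set b := lead_coef Q in o.
have a0 : a != 0 by rewrite lead_coef_eq0.
have b0 : b != 0 by rewrite lead_coef_eq0.
have tP := leading_term_lead_coef P; have tQ := leading_term_lead_coef Q; rewrite -/a -/b in tP tQ.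
have nE : (size P).-1 = (size Q).-1.+1 by rewrite sP prednK// size_poly_gt0.
rewrite nE in tP; set n := (size Q).-1 in tP tQ.
set P1 := P \Po (w *: 'X); set Q1 := w *: (Q \Po (w *: 'X)).
have w0 := root3_neq0 hw.
have tP1 : leading_term P1 n.+1 (w ^+ n.+1 * a) := leading_term_comp_scaleX w tP.
have tQ1 : leading_term Q1 n (w ^+ n.+1 * b) by rewrite exprS -mulrA;
  apply/leading_termZ/leading_term_comp_scaleX.
have o1 : invdiff P1 Q1 (w ^+ n.+1 * a) (w ^+ n.+1 * b).
  by rewrite /invdiff -!scalerA; congr (_ *: _); exact: invdiff_comp_scaleX.
have e : P * Q1 = P1 * Q.
  apply: (invdiff_uniq tP tQ tP1 tQ1 a0 b0 _ _ o o1); last by ring.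
  exact: mulf_neq0 (expf_neq0 _ w0) b0.
have sXX (c : K) (p : {poly K}) : (p \Po (c *: 'X)) \Po (w *: 'X) = p \Po (c * w *: 'X).
  by apply/polyP => i; rewrite !coef_comp_scaleX exprMn; ring.
have w3 := root3_cube hw.
pose Qi i := Q \Po (w ^+ i *: 'X); pose Pi i := P \Po (w ^+ i *: 'X).
have Qi0 : Qi 0%N = Q by rewrite /Qi expr0 scale1r comp_polyXr.
have QiS i : Qi i \Po (w *: 'X) = Qi i.+1 by rewrite /Qi sXX -exprSr.
have Qi3 : Qi 3%N = Q by rewrite /Qi w3 scale1r comp_polyXr.
pose N := Q * Qi 1%N * Qi 2%N; pose M := P * Qi 1%N * Qi 2%N.
have NE : N \Po (w *: 'X) = N.
  by rewrite /N !comp_polyM !QiS Qi3 -{1}Qi0 QiS; ring.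
have [q1 q1E] := comp_poly_scaleX_invariant hw NE.
have ME : M \Po (w *: 'X) = w *: M.
  rewrite /M !comp_polyM !QiS Qi3 -/P1.
  transitivity (P1 * Q * Qi 2%N); first by ring.
  by rewrite -e /Q1 (_ : Q \Po _ = Qi 1%N)// -!mul_polyC; ring.
have M0 : M`_0 = 0.
  have := congr1 (fun p : {poly K} => p`_0) ME; rewrite coef_comp_scaleX coefZ mul1r => /eqP.
  rewrite -subr_eq0 -{1}[M`_0]mul1r -mulrBl mulf_eq0 subr_eq0 eq_sym (negPf (root3_neq1 hw)).
  by move/eqP.
have [M1 M1E] : exists M1, M = M1 * 'X.
  have /dvdpP[M1 ->] : 'X - 0%:P %| M by rewrite dvdp_XsubCl /root horner_coef0 M0.
  by exists M1; rewrite subr0.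
have M1i : M1 \Po (w *: 'X) = M1.
  have : (M1 \Po (w *: 'X)) * (w *: 'X) = M1 * (w *: 'X).
    by rewrite -{2}[w *: 'X]comp_polyX -comp_polyM -M1E ME M1E scalerAr.
  by apply: mulIf; rewrite scaler_eq0 negb_or w0 polyX_eq0.
have [p1 p1E] := comp_poly_scaleX_invariant hw M1i.
have Qi_neq0 i : Qi i != 0.
  apply: contraNneq Q0 => Qi_eq0; apply/eqP/polyP => j.
  have := congr1 (fun p : {poly K} => p`_j) Qi_eq0; rewrite coef_comp_scaleX coef0.
  by move/eqP; rewrite mulf_eq0 -exprM expf_eq0 (negPf w0) andbF => /eqP.
have N0 : N != 0 by rewrite !mulf_neq0.
have q10 : q1 != 0 by apply: contraNneq N0 => q10; rewrite q1E q10 comp_poly0.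
have eMN : P * N = Q * M by rewrite /N /M; ring.
have [p [q [g [g0 cpq pE qE]]]] := coprime_reduction p1 q10.
exists p, q; split => //.
- by apply: contraNneq q10 => q0; rewrite qE q0 mul0r.
- have gX0 : g \Po 'X^3 != 0.
    by rewrite comp_poly_eq0// size_polyXn.
  apply: (mulIf gX0); rewrite -mulrA -comp_polyM -qE -q1E eMN M1E p1E pE comp_polyM; ring.
Qed.

(** The equation depends only on the fraction P / Q. *)
Lemma invdiff_fraction_eq P Q P2 Q2 a b : Q != 0 -> P * Q2 = Q * P2 ->
  invdiff P Q a b -> invdiff P2 Q2 a b.
Proof.
move=> Q0 e o.
have de : P^`() * Q2 + P * Q2^`() = Q^`() * P2 + Q * P2^`().
  by rewrite -!derivM e.
have eW : wronskian P2 Q2 * Q ^+ 2 = wronskian P Q * Q2 ^+ 2.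
  rewrite /wronskian.
  transitivity (Q * Q2 * (Q * P2^`()) - Q * Q2^`() * (Q * P2)); first by ring.
  have -> : Q * P2^`() = P^`() * Q2 + P * Q2^`() - Q^`() * P2 by rewrite de; ring.
  transitivity (Q * Q2 * (P^`() * Q2 + P * Q2^`()) - Q2 * Q^`() * (Q * P2) - Q * Q2^`() * (Q *
    P2)); first by ring.
  by rewrite -e; ring.
have Q40 : Q ^+ 4 != 0 by rewrite expf_neq0.
apply: (mulIf Q40); rewrite -!scalerAl.
have -> : wronskian P2 Q2 ^+ 2 * cubX1 * Q ^+ 4 = wronskian P Q ^+ 2 * cubX1 * Q2 ^+ 4.
  transitivity ((wronskian P2 Q2 * Q ^+ 2) ^+ 2 * cubX1); first by ring.
  by rewrite eW; ring.
transitivity (a *: (wronskian P Q ^+ 2 * cubX1) * Q2 ^+ 4); first exact: scalerAl.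
move: o; rewrite /invdiff => ->; rewrite -scalerAl; congr (_ *: _).
transitivity (Q * Q2 * ((P * Q2) ^+ 3 - (Q * Q2) ^+ 3)); first by ring.
by rewrite e; ring.
Qed.

Lemma leading_term_comp_Xn p n a k : (0 < k)%N -> leading_term p n a ->
  leading_term (p \Po 'X^k) (n * k) a.
Proof.
move=> k0 [sp pn]; split; last by rewrite coef_comp_poly_Xn// dvdn_mull// mulnK.
apply/leq_sizeP => j nj; rewrite coef_comp_poly_Xn//; case: ifP => // kj.
by rewrite nth_default// (leq_trans sp)// ltn_divRL.
Qed.

(** q^2 f' for f = x mu(x^3) and mu = p / q, as a polynomial in s = x^3:
    f' = mu + 3 s mu'. *)
Definition mu_diff p q := p * q + 'X * wronskian p q *+ 3.

Lemma horner_mu_diff p q x : (mu_diff p q).[x] =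
  p.[x] * q.[x] + 3 * x * (p^`().[x] * q.[x] - p.[x] * q^`().[x]).
Proof. by rewrite /mu_diff /wronskian hornerD hornerMn !hornerM hornerX hornerD hornerN !hornerM;
  ring. Qed.

(** The differential equation of f = x mu(x^3) with mu = p / q, in the variable
    s = x^3. *)
Definition mu_equation p q := lead_coef p *: (('X - 1) * mu_diff p q ^+ 2) =
  lead_coef q *: (q * ('X * p ^+ 3 - q ^+ 3)).

Lemma mu_equation_of_invdiff P Q p q : P != 0 -> Q != 0 -> q != 0 ->
  size P = (size Q).+1 ->
  invdiff P Q (lead_coef P) (lead_coef Q) ->
  P * (q \Po 'X^3) = Q * ('X * (p \Po 'X^3)) ->
  size p = size q /\ mu_equation p q.
Proof.
move=> P0 Q0 q0 sP o e.
have a0 : lead_coef P != 0 by rewrite lead_coef_eq0.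
have b0 : lead_coef Q != 0 by rewrite lead_coef_eq0.
have lq0 : lead_coef q != 0 by rewrite lead_coef_eq0.
have p0 : p != 0.
  apply: contraNneq (mulf_neq0 P0 (_ : q \Po 'X^3 != 0)) => [p0|].
    by rewrite e p0 comp_poly0 !mulr0.
  by rewrite comp_poly_eq0// size_polyXn.
have lp0 : lead_coef p != 0 by rewrite lead_coef_eq0.
have tl := leading_termM (leading_term_lead_coef P) (leading_term_comp_Xn (isT : (0 < 3)%N)
  (leading_term_lead_coef q)).
have tr := leading_termM (leading_term_lead_coef Q) (leading_termM (leading_termXn 1)
  (leading_term_comp_Xn (isT : (0 < 3)%N) (leading_term_lead_coef p))).
rewrite expr1 mul1r -e in tr.
have [en el] := leading_term_uniq tl tr (mulf_neq0 a0 lq0) (mulf_neq0 b0 lp0).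
have spq : size p = size q.
  have : (0 < size p)%N by rewrite size_poly_gt0.
  have : (0 < size q)%N by rewrite size_poly_gt0.
  have : (0 < size Q)%N by rewrite size_poly_gt0.
  move: en; rewrite sP; move: (size p) (size q) (size Q) => x y z; clear; lia.
split=> //.
have o2 := invdiff_fraction_eq Q0 e o.
have cdE (r : {poly K}) : (r \Po 'X^3)^`() = (r^`() \Po 'X^3) * (3 * 'X^2).
  by rewrite deriv_comp derivXn -mulr_natl.
have WE : wronskian ('X * (p \Po 'X^3)) (q \Po 'X^3) = mu_diff p q \Po 'X^3.
  rewrite /wronskian derivM derivX !cdE /mu_diff /wronskian.
  have eMn (r : {poly K}) : (r *+ 3) \Po 'X^3 = (r \Po 'X^3) *+ 3 by exact: rmorphMn.
  rewrite comp_polyD eMn !comp_polyM comp_polyB !comp_polyM comp_polyX.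
  by ring.
have eX (r : {poly K}) n : (r ^+ n) \Po 'X^3 = (r \Po 'X^3) ^+ n by exact: rmorphXn.
have cE : cubX1 = ('X - 1) \Po 'X^3.
  by rewrite comp_polyB comp_polyX comp_polyC.
have : (lead_coef P *: (('X - 1) * mu_diff p q ^+ 2) -
        lead_coef Q *: (q * ('X * p ^+ 3 - q ^+ 3))) \Po 'X^3 = 0.
  move: o2; rewrite /invdiff WE cE -eX => o2.
  rewrite comp_polyB !comp_polyZ !(eX, comp_polyM, comp_polyB, comp_polyX).
  apply/eqP; rewrite subr_eq0; apply/eqP.
  move: o2; rewrite !(eX, comp_polyM, comp_polyB, comp_polyX) mulrC => ->.
  by congr (_ *: _); ring.
move/eqP; rewrite comp_poly_eq0 ?size_polyXn// subr_eq0 => /eqP e2.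
have : lead_coef p *: (lead_coef P *: (('X - 1) * mu_diff p q ^+ 2)) =
  lead_coef P *: (lead_coef q *: (q * ('X * p ^+ 3 - q ^+ 3))).
  by rewrite e2 !scalerA el [lead_coef p * _]mulrC.
rewrite scalerA [lead_coef p * _]mulrC -scalerA; exact: scalerI.
Qed.

(** Both P / Q and p / q are in lowest terms, but x p(x^3) / q(x^3) may not be:
    x and q(x^3) have a common factor when q(0) = 0.  The pole at 0 is then still
    there, since q(x^3) vanishes to order at least 3. *)
Lemma cubic_fraction_poles P Q p q (x : K) : coprimep P Q -> coprimep p q ->
  P * (q \Po 'X^3) = Q * ('X * (p \Po 'X^3)) -> (Q.[x] == 0) = (q.[x ^+ 3] == 0).
Proof.
move=> cPQ cpq e; have ex (y : K) := congr1 (fun r : {poly K} => r.[y]) e.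
have {}ex y : P.[y] * q.[y ^+ 3] = Q.[y] * (y * p.[y ^+ 3]).
  by have := ex y; rewrite !hornerE !horner_comp !hornerE.
apply/eqP/eqP => [Qx|qx].
  have := ex x; rewrite Qx mul0r => /eqP; rewrite mulf_eq0 => /orP[/eqP Px|/eqP//].
  by case: (coprimep_no_common_root cPQ Px Qx).
have px : p.[x ^+ 3] != 0.
  by apply/eqP => px; case: (coprimep_no_common_root cpq px qx).
have [x0|x0] := eqVneq x 0; last first.
  have := ex x; rewrite qx mulr0 => /esym/eqP; rewrite !mulf_eq0 (negPf x0) (negPf px) !orbF.
  by move/eqP.
subst x; rewrite expr0n /= in qx px.
have /factor_theorem[q1 q1E] : root q 0 by apply/rootP.
have : P * 'X^2 * (q1 \Po 'X^3) = Q * (p \Po 'X^3).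
  have X0 : 'X != 0 :> {poly K} by rewrite polyX_eq0.
  apply: (mulfI X0).
  transitivity (Q * ('X * (p \Po 'X^3))); last by ring.
  by rewrite -e q1E subr0 comp_polyM comp_polyX; ring.
move/(congr1 (fun r : {poly K} => r.[0])).
rewrite !hornerE !horner_comp !hornerE !expr0n /= !(mulr0, mul0r).
by move/esym/eqP; rewrite mulf_eq0 (negPf px) orbF => /eqP.
Qed.

(** z^n p(1/z), the numerator or denominator of mu(1/z) without its pole at 0. *)
Definition revp n p : {poly K} := \sum_(i < n.+1) p`_i *: 'X^(n - i).

Lemma horner_revp n p (z : K) : (size p <= n.+1)%N -> z != 0 ->
  (revp n p).[z] = z ^+ n * p.[z^-1].
Proof.
move=> sp z0; rewrite (horner_coef_wide _ sp) horner_sum mulr_sumr.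
apply: eq_bigr => i _.
rewrite hornerZ hornerXn.
rewrite mulrCA; congr (_ * _).
by rewrite expfB_cond ?exprVn// (negPf z0) add0n -ltnS.
Qed.

Lemma horner_revp0 n p : (revp n p).[0] = p`_n.
Proof.
rewrite horner_sum (bigD1 ord_max)//= subnn !hornerE big1 ?addr0// => i.
rewrite -val_eqE /= => ni; rewrite !hornerE expr0n subn_eq0.
suff /negPf -> : ~~ (n <= i)%N by rewrite mulr0.
by rewrite -ltnNge ltn_neqAle ni -ltnS /=.
Qed.

Lemma horner_deriv_revp n p (z : K) : (size p <= n.+1)%N -> z != 0 ->
  z * (revp n p)^`().[z] = n%:R * (revp n p).[z] - z ^+ n * (z^-1 * p^`().[z^-1]).
Proof.
move=> sp z0.
have pE : p = \sum_(i < n.+1) p`_i *: 'X^i.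
  rewrite -[LHS]coefK poly_def (big_ord_widen _ (fun i => p`_i *: 'X^i) sp).
  rewrite big_mkcond; apply: eq_bigr => i _; case: ltnP => // h.
  by rewrite nth_default// scale0r.
have -> : p^`() = \sum_(i < n.+1) p`_i *: ('X^(i.-1) *+ i).
  by rewrite {1}pE raddf_sum /=; apply: eq_bigr => i _; rewrite derivZ derivXn.
rewrite /revp raddf_sum /= !horner_sum !mulr_sumr -sumrB; apply: eq_bigr => -[i ilt] _ /=.
rewrite derivZ derivXn !hornerZ !hornerMn !hornerXn.
have /subnKC e : (i <= n)%N by [].
have -> : z * (p`_i * (z ^+ (n - i).-1 *+ (n - i))) = (n - i)%:R * (p`_i * z ^+ (n - i)).
  by case: (n - i)%N => [|k]; rewrite ?mul0r ?mulr0n ?mulr0// exprS -mulr_natl; ring.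
have -> : z^-1 * (p`_i * (z^-1 ^+ i.-1 *+ i)) = i%:R * (p`_i * z ^- i).
  by case: i {ilt e} => [|k]; rewrite ?mul0r ?mulr0n ?mulr0// -exprVn exprS -mulr_natl; ring.
have -> : z ^+ (n - i) = z ^+ n / z ^+ i by rewrite expfB_cond// (negPf z0) -{1}e leq_addr.
have -> : n%:R = i%:R + (n - i)%:R :> K by rewrite -natrD e.
by ring.
Qed.

(** The differential equation in the variable z = 1/s.  It holds at z = 0 too, where
    it is used to differentiate up to the centre of the power series. *)
Lemma mu_equation_revp p q n (z : K) : p != 0 -> size p = n.+1 -> size q = n.+1 ->
  mu_equation p q ->
  let p1 := revp n p in let q1 := revp n q in
  lead_coef p * ((1 - z) * (p1.[z] * q1.[z] - 3 * z * (p1^`().[z] * q1.[z] - p1.[z] *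
    q1^`().[z])) ^+ 2) =
  lead_coef q * (q1.[z] * (p1.[z] ^+ 3 - z * q1.[z] ^+ 3)).
Proof.
move=> p0 sp sq e p1 q1.
have lp : lead_coef p = p`_n by rewrite lead_coefE sp.
have lq : lead_coef q = q`_n by rewrite lead_coefE sq.
have [->|z0] := eqVneq z 0.
  by rewrite /p1 /q1 !horner_revp0 -lp -lq; ring.
have zp : z * p1^`().[z] = n%:R * p1.[z] - z ^+ n * (z^-1 * p^`().[z^-1]).
  by apply: horner_deriv_revp; rewrite ?sp.
have zq : z * q1^`().[z] = n%:R * q1.[z] - z ^+ n * (z^-1 * q^`().[z^-1]).
  by apply: horner_deriv_revp; rewrite ?sq.
have p1E : p1.[z] = z ^+ n * p.[z^-1] by rewrite horner_revp ?sp.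
have q1E : q1.[z] = z ^+ n * q.[z^-1] by rewrite horner_revp ?sq.
have LE : p1.[z] * q1.[z] - 3 * z * (p1^`().[z] * q1.[z] - p1.[z] * q1^`().[z]) = z ^+ n * z ^+ n
  * (mu_diff p q).[z^-1].
  rewrite horner_mu_diff.
  transitivity (p1.[z] * q1.[z] - 3 * (z * p1^`().[z] * q1.[z] - p1.[z] * (z * q1^`().[z]))).
    by ring.
  by rewrite zp zq p1E q1E; ring.
move: e; rewrite /mu_equation; move: (mu_diff p q) LE => L LE e.
have := congr1 (fun r : {poly K} => z * (z ^+ n) ^+ 4 * r.[z^-1]) e.
rewrite /= !(hornerZ, horner_exp, hornerM, hornerD, hornerN, hornerX, hornerC) => e1.
rewrite LE p1E q1E.
have -> : 1 - z = z * (z^-1 - 1) by rewrite mulrBr mulfV// mulr1.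
have e2 : z * z^-1 = 1 by rewrite mulfV.
transitivity (z * (z ^+ n) ^+ 4 * (lead_coef p * ((z^-1 - 1) * L.[z^-1] ^+ 2))).
  by ring.
rewrite e1.
transitivity (lead_coef q * ((z ^+ n) ^+ 4 * q.[z^-1] * ((z * z^-1) * p.[z^-1] ^+ 3 - z *
  q.[z^-1] ^+ 3))).
  by ring.
by rewrite e2; ring.
Qed.

End PolynomialAlgebra.

(** * Rational functions and degrees *)

Section Cofinite.
Variable T : Type.

(** The filter of nonempty Zariski-open sets of an irreducible curve. *)
Definition cof : set_system T := [set A | cofinite_set A].

Global Instance cof_filter : Filter cof.
Proof.
split.
- by rewrite /cof /= setCT; exact: finite_set0.
- by move=> A B hA hB; rewrite /cof /= cofinite_setI.
- by move=> A B; exact: sub_cofinite_set.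
Qed.

Lemma cofI (A B : set T) : cof A -> cof B -> cof (A `&` B).
Proof. exact: filterI. Qed.

Lemma cof_forall (I : finType) (A : I -> set T) :
  (forall i, cof (A i)) -> cof [set x | forall i, A i x].
Proof. by move=> h; apply: (@filter_forall _ _ A _ _ h). Qed.

Lemma cof_nonempty A : infinite_set [set: T] -> cof A -> exists x, A x.
Proof.
move=> infT cA; have /infinite_setN0 : infinite_set A by exact: cofinite_set_infinite.
by [].
Qed.

End Cofinite.

Section RationalFunctions.
Variables (K : numClosedFieldType) (V : curve K).
Implicit Types (f g h : V -> K).

Lemma fevalD F G (P : V) : feval (F + G) P = feval F P + feval G P.
Proof. exact: mpoly.mevalD. Qed.

Lemma fevalM F G (P : V) : feval (F * G) P = feval F P * feval G P.
Proof. exact: mpoly.mevalM. Qed.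

Lemma fevalXU i (P : V) : feval (mpoly.mpolyX K (mpoly.mnm1 i)) P = hcoord P i.
Proof. exact: mpoly.mevalXU. Qed.

Lemma ratfun_ext f g : ratfun f -> cof [set P | f P = g P] -> ratfun g.
Proof.
move=> [k [A [B [hA hB nB e]]]] fg; exists k, A, B; split=> //.
have : cof [set P | f P = feval A P / feval B P] by [].
by apply: filterS2 fg => P /= -> ->.
Qed.

Lemma form1 : Defs.form (V := V) 0 1.
Proof. exact: mpoly.dhomog1. Qed.

Lemma formZ (c : K) k F : Defs.form (V := V) k F -> Defs.form (V := V) k (c *: F).
Proof. by rewrite /Defs.form; exact: rpredZ. Qed.

Lemma feval1 (P : V) : feval 1 P = 1.
Proof. exact: mpoly.meval1. Qed.

Lemma fevalZ (c : K) F (P : V) : feval (c *: F) P = c * feval F P.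
Proof. exact: mpoly.mevalZ. Qed.

Lemma ratfun_cst (c : K) : ratfun (fun _ : V => c).
Proof.
exists 0%N, (c *: 1), 1; split; [exact/formZ/form1|exact: form1|..].
- by apply: (@filterE _ (@cof V)) => P /=; rewrite feval1 oner_eq0.
- by apply: (@filterE _ (@cof V)) => P /=; rewrite fevalZ feval1 mulr1 divr1.
Qed.

Lemma ratfunM f g : ratfun f -> ratfun g -> ratfun (fun P => f P * g P).
Proof.
move=> [k [A [B [hA hB nB e]]]] [l [C [D [hC hD nD e']]]].
exists (k + l)%N, (A * C), (B * D); split.
- exact: mpoly.dhomogM.
- exact: mpoly.dhomogM.
- apply: (@filterS2 _ (@cof V) _ _ _ _ _ nB nD) => P /= b d.
  by rewrite fevalM mulf_neq0.
- apply: (@filterS2 _ (@cof V) _ _ _ _ _ e e') => P /= -> ->.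
  by rewrite !fevalM mulf_div.
Qed.

Lemma ratfunD f g : ratfun f -> ratfun g -> ratfun (fun P => f P + g P).
Proof.
move=> [k [A [B [hA hB nB e]]]] [l [C [D [hC hD nD e']]]].
exists (k + l)%N, (A * D + C * B), (B * D); split.
- by apply: mpoly.dhomogD; [|rewrite addnC]; exact: mpoly.dhomogM.
- exact: mpoly.dhomogM.
- apply: (@filterS2 _ (@cof V) _ _ _ _ _ nB nD) => P /= b d.
  by rewrite fevalM mulf_neq0.
- have nBD := cofI nB nD.
  apply: (@filterS3 _ (@cof V) _ _ _ _ _ _ nBD e e') => P /= [b d] -> ->.
  by rewrite fevalD !fevalM addf_div.
Qed.

Lemma ratfunV f : cof [set P | f P != 0] -> ratfun f -> ratfun (fun P => (f P)^-1).
Proof.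
move=> nf [k [A [B [hA hB nB e]]]]; exists k, B, A; split=> //.
- apply: (@filterS2 _ (@cof V) _ _ _ _ _ nf e) => P /= + fE.
  by rewrite fE mulf_eq0 negb_or => /andP[].
- by apply: (@filterS _ (@cof V) _ _ _ _ e) => P /= ->; rewrite invf_div.
Qed.

Lemma ratfun_sum (I : Type) (r : seq I) (f : I -> V -> K) :
  (forall i, ratfun (f i)) -> ratfun (fun P => \sum_(i <- r) f i P).
Proof.
move=> hf; elim: r => [|i r IH].
  by under eq_fun do rewrite big_nil; exact: ratfun_cst.
by under eq_fun do rewrite big_cons; exact: ratfunD.
Qed.

Lemma ratfunX f n : ratfun f -> ratfun (fun P => f P ^+ n).
Proof.
move=> hf; elim: n => [|n IH].
  by under eq_fun do rewrite expr0; exact: ratfun_cst.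
by under eq_fun do rewrite exprS; exact: ratfunM.
Qed.

Lemma ratfun_coord i j : cof [set P : V | hcoord P j != 0] ->
  ratfun (fun P : V => hcoord P i / hcoord P j).
Proof.
move=> nj; have hX l : Defs.form (V := V) 1 (mpoly.mpolyX K (mpoly.mnm1 l)).
  by rewrite /Defs.form mpoly.dhomogX /= mpoly.mdeg1.
exists 1%N, (mpoly.mpolyX K (mpoly.mnm1 i)), (mpoly.mpolyX K (mpoly.mnm1 j)); split=> //.
- by apply: (@filterS _ (@cof V) _ _ _ _ nj) => P /=; rewrite fevalXU.
- by apply: (@filterE _ (@cof V)) => P /=; rewrite !fevalXU.
Qed.

End RationalFunctions.

Section Degree.
Variables (K : numClosedFieldType) (V W : curve K) (phi : V -> W).
(** Two bases are related by matrices of rational functions on W with product 1;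
    evaluating them at one good point of W leaves matrices over K, to which
    the rank inequality applies. *)
Lemma has_degree_le d d' : infinite_set [set: W] ->
  has_degree phi d -> has_degree phi d' -> (d <= d')%N.
Proof.
move=> infW [e [re He]] [e' [re' He']].
have /choice[a ha] (i : 'I_d) := He' _ (re i).
have /choice[b hb] (j : 'I_d') := He _ (re' j).
have AB i k : cof [set Q | \sum_(j < d') a i j Q * b j k Q = (i == k)%:R].
  have [h [_ _ hu]] := He _ (re i).
  pose h1 k (Q : W) := \sum_(j < d') a i j Q * b j k Q.
  pose h2 (k : 'I_d) (Q : W) : K := (i == k)%:R.
  have e1 : eqcof (h1 k) (h k).
    apply: hu => [l|]; first by apply: ratfun_sum => j; apply: ratfunM; [case: (ha i)|case: (hb j)].
    have eb : cof [set P | forall j, e' j P = \sum_(k < d) b j k (phi P) * e k P].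
      by apply: cof_forall => j; case: (hb j).
    have [_ ea _] := ha i.
    apply: (@filterS2 _ (@cof V) _ _ _ _ _ ea eb) => P /= -> ebP.
    under eq_bigr do rewrite ebP mulr_sumr.
    rewrite exchange_big; apply: eq_bigr => l _ /=; rewrite mulr_suml.
    by apply: eq_bigr => j _; rewrite mulrA.
  have e2 : eqcof (h2 k) (h k).
    apply: hu => [l|]; first exact: ratfun_cst.
    apply: (@filterE _ (@cof V)) => P /=; rewrite /h2 (bigD1 i)//= eqxx mul1r.
    by rewrite big1 ?addr0// => l; rewrite eq_sym => /negPf ->; rewrite mul0r.
  by apply: (@filterS2 _ (@cof W) _ _ _ _ _ e1 e2) => Q /= <-.
have [Q hQ] : exists Q, forall i k, \sum_(j < d') a i j Q * b j k Q = (i == k)%:R.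
  apply: cof_nonempty => //; apply: cof_forall => i; apply: cof_forall => k.
  exact: AB.
apply: (@mulmx1_min _ _ _ (\matrix_(i, j) a i j Q) (\matrix_(j, k) b j k Q)).
apply/matrixP => i k; rewrite !mxE -hQ; apply: eq_bigr => j _; by rewrite !mxE.
Qed.

Variables (s : V -> K) (t : W -> K) (A B : {poly K}) (m : nat).
Hypothesis sA : size A = m.+1.
Hypothesis monA : A \is monic.
Hypothesis sB : (size B <= m)%N.
Hypothesis m0 : (0 < m)%N.
Hypothesis cAB : coprimep A B.
Hypothesis rs : ratfun s.
Hypothesis rt : ratfun t.
Hypothesis rel : cof [set P | A.[s P] = t (phi P) * B.[s P]].
Hypothesis sfib : forall c, finite_set [set P | s P = c].
Hypothesis tfib : forall c, finite_set [set Q | t Q = c].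

Let AtB_root_finite (c : K) : finite_set [set P | A.[s P] = c * B.[s P]].
Proof.
have p0 : A - c *: B != 0.
  rewrite -size_poly_eq0 size_polyDl ?sA// size_polyN ltnS.
  exact: leq_trans (size_scale_leq _ _) sB.
have [r rE] := closed_field_poly_normal (A - c *: B).
have h : finite_set (\bigcup_(x in [set` r]) [set P | s P = x]).
  by apply: bigcup_finite => [|x _]; [exact: finite_seq|exact: sfib].
apply: sub_finite_set h => P /= e; exists (s P) => //=.
by rewrite -root_prod_XsubC -(rootZ _ _ (_ : lead_coef (A - c *: B) != 0)) ?lead_coef_eq0// -rE
  rootE !hornerE subr_eq0 e.
Qed.

(** The fibres of phi are finite, since s takes finitely many values on them. *)
Lemma phi_cof C : cof C -> cof [set P | C (phi P)].
Proof.
move=> cC; have h : finite_set (\bigcup_(Q in ~` C) ([set P | A.[s P] = t Q * B.[s P]])).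
  by apply: bigcup_finite => [//|Q _]; exact: AtB_root_finite.
have h2 : cof (~` (\bigcup_(Q in ~` C) ([set P | A.[s P] = t Q * B.[s P]]))).
  by rewrite /cof /= setCK.
apply: filterS2 rel h2 => P /= e nb; apply: contrapT => nC; apply: nb.
by exists (phi P).
Qed.

(** A generic point of W has only generic points of V above it. *)
Lemma cof_above C : cof C -> cof [set Q | forall P, A.[s P] = t Q * B.[s P] -> C P].
Proof.
move=> cC; have h : finite_set (\bigcup_(P in ~` C) ([set Q | A.[s P] = t Q * B.[s P]])).
  apply: bigcup_finite => [//|P _].
  have [Bs|Bs] := eqVneq B.[s P] 0.
    apply: sub_finite_set (finite_set0 W) => Q /=; rewrite Bs mulr0 => As.
    exact: (coprimep_no_common_root cAB As Bs).
  by apply: sub_finite_set (tfib (A.[s P] / B.[s P])) => Q /= ->; rewrite mulfK.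
rewrite /cof /=; apply: sub_finite_set h => Q /= /existsNP[P /not_implyP[e nC]].
by exists P.
Qed.

Definition spanned (F : V -> K) := exists h : 'I_m -> W -> K,
  (forall i, ratfun (h i)) /\
  cof [set P | F P = \sum_(i < m) h i (phi P) * s P ^+ i].

(** To prove that the span is everything, it is shown that it contains 1 and that
    enough functions multiply it into itself. *)
Definition multiplier (u : V -> K) :=
  forall F, spanned F -> spanned (fun P => u P * F P).

Lemma spanned_ext F G : spanned F -> cof [set P | F P = G P] -> spanned G.
Proof.
move=> [h [rh e]] FG; exists h; split=> //.
by apply: filterS2 e FG => P /= -> ->.
Qed.

Lemma multiplier_ext u v : multiplier u -> cof [set P | u P = v P] -> multiplier v.
Proof.
move=> hu uv F /hu h; apply: spanned_ext h _.
by apply: filterS uv => P /= ->.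
Qed.

Lemma spannedD F G : spanned F -> spanned G -> spanned (fun P => F P + G P).
Proof.
move=> [h [rh e]] [h' [rh' e']]; exists (fun i Q => h i Q + h' i Q); split.
  by move=> i; exact: ratfunD.
apply: filterS2 e e' => P /= -> ->; rewrite -big_split; apply: eq_bigr => i _ /=.
by rewrite mulrDl.
Qed.

Lemma multiplier_pullback h : ratfun h -> multiplier (fun P => h (phi P)).
Proof.
move=> rh F [h' [rh' e]]; exists (fun i Q => h Q * h' i Q); split.
  by move=> i; exact: ratfunM.
apply: filterS e => P /= ->; rewrite mulr_sumr; apply: eq_bigr => i _.
by rewrite mulrA.
Qed.

Lemma multiplier_cst c : multiplier (fun=> c).
Proof. exact: (multiplier_pullback (ratfun_cst W c)). Qed.

Lemma multiplierM u v : multiplier u -> multiplier v -> multiplier (fun P => u P * v P).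
Proof.
move=> hu hv F /hv /hu h; apply: spanned_ext h _.
by apply: filterE => P /=; rewrite mulrA.
Qed.

Lemma multiplierD u v : multiplier u -> multiplier v -> multiplier (fun P => u P + v P).
Proof.
move=> hu hv F hF; apply: spanned_ext (spannedD (hu _ hF) (hv _ hF)) _.
by apply: filterE => P /=; rewrite mulrDl.
Qed.

Lemma multiplierX u n : multiplier u -> multiplier (fun P => u P ^+ n).
Proof.
move=> hu; elim: n => [|n IH].
  by under eq_fun do rewrite expr0; exact: multiplier_cst.
by under eq_fun do rewrite exprS; exact: multiplierM.
Qed.

Lemma multiplier_sum (I : Type) (r : seq I) (u : I -> V -> K) :
  (forall i, multiplier (u i)) -> multiplier (fun P => \sum_(i <- r) u i P).
Proof.
move=> hu; elim: r => [|i r IH].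
  by under eq_fun do rewrite big_nil; exact: multiplier_cst.
by under eq_fun do rewrite big_cons; exact: multiplierD.
Qed.

Lemma multiplier_horner (p : {poly K}) u : multiplier u -> multiplier (fun P => p.[u P]).
Proof.
move=> hu; under eq_fun do rewrite horner_coef.
by apply: multiplier_sum => i; apply: multiplierM; [exact: multiplier_cst|exact: multiplierX].
Qed.

Lemma spanned_pow i : (i < m)%N -> spanned (fun P => s P ^+ i).
Proof.
move=> im; exists (fun j Q => (j == Ordinal im)%:R); split=> [j|]; first exact: ratfun_cst.
apply: filterE => P /=; rewrite (bigD1 (Ordinal im))//= eqxx mul1r.
by rewrite big1 ?addr0// => j /negPf ->; rewrite mul0r.
Qed.

Lemma spanned1 : spanned (fun=> 1).
Proof.
apply: spanned_ext (spanned_pow m0) _.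
by apply: filterE => P /=; rewrite expr0.
Qed.

Lemma spanned_sum (I : Type) (r : seq I) (F : I -> V -> K) :
  (forall i, spanned (F i)) -> spanned (fun P => \sum_(i <- r) F i P).
Proof.
move=> hF; elim: r => [|i r IH].
  have := multiplier_cst 0 spanned1.
  by move/spanned_ext; apply; apply: filterE => P /=; rewrite big_nil mul0r.
by under eq_fun do rewrite big_cons; exact: spannedD.
Qed.

(** A is monic of degree m and B has smaller degree, so A(s) = t B(s) expresses s^m
    through lower powers of s, with coefficients polynomial in t. *)
Lemma spanned_top : spanned (fun P => s P ^+ m).
Proof.
have : spanned (fun P => \sum_(i < m) (t (phi P) * B`_i - A`_i) * s P ^+ i).
  exists (fun i Q => t Q * B`_i - A`_i); split; last exact: filterE.
  move=> i; apply: ratfunD; last exact: ratfun_cst.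
  by apply: ratfunM => //; exact: ratfun_cst.
move/spanned_ext; apply; apply: filterS rel => P /=.
rewrite (horner_coef_wide _ sB) horner_coef sA big_ord_recr /=.
have -> : A`_m = 1 by move: monA; rewrite monicE lead_coefE sA => /eqP.
rewrite mul1r => e; under eq_bigr do rewrite mulrBl -mulrA.
by rewrite sumrB -mulr_sumr -e addrAC subrr add0r.
Qed.

Lemma multiplier_s : multiplier s.
Proof.
move=> F [h [rh e]].
have : spanned (fun P => \sum_(i < m) h i (phi P) * s P ^+ i.+1).
  apply: spanned_sum => i; apply: (multiplier_pullback (rh i)).
  have [im|] := ltnP i.+1 m; first exact: spanned_pow.
  move=> mi; have -> : i.+1 = m by apply/eqP; rewrite eqn_leq mi andbT.
  exact: spanned_top.
move/spanned_ext; apply; apply: filterS e => P /= ->; rewrite mulr_sumr.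
by apply: eq_bigr => i _; rewrite exprS mulrCA.
Qed.

(** Write A(s) = A(r) + (s - r) A1(s) and B(s) = B(r) + (s - r) B1(s).  Then
    (s - r) (t B1(s) - A1(s)) = A(r) - t B(r), whose right-hand side is pulled back
    from W and not identically zero, A and B being coprime. *)
Lemma multiplier_inv r : multiplier (fun P => (s P - r)^-1).
Proof.
have fac (p : {poly K}) : exists p1 : {poly K}, forall x, p.[x] = p.[r] + p1.[x] * (x - r).
  have /factor_theorem[p1 p1E] : root (p - (p.[r])%:P) r.
    by rewrite rootE !hornerE subrr.
  exists p1 => x; have /eqP := congr1 (fun q : {poly K} => q.[x]) p1E.
  by rewrite !hornerE subr_eq addrC => /eqP.
have [A1 hA1] := fac A; have [B1 hB1] := fac B.
have nz : cof [set Q | A.[r] - t Q * B.[r] != 0].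
  have [Br0|Br0] := eqVneq B.[r] 0.
    apply: filterE => Q /=; rewrite Br0 mulr0 subr0; apply/eqP => Ar0.
    exact: (coprimep_no_common_root cAB Ar0 Br0).
  have := tfib (A.[r] / B.[r]); rewrite /cof /=; apply: sub_finite_set => Q /= /negP.
  rewrite negbK subr_eq0 => /eqP ->; by rewrite mulfK.
have h1 : ratfun (fun Q => (A.[r] - t Q * B.[r])^-1).
  apply: ratfunV => //; apply: ratfunD; first exact: ratfun_cst.
  have -> : (fun Q => - (t Q * B.[r])) = (fun Q => t Q * - B.[r]).
    by apply/funext => Q; rewrite mulrN.
  by apply: ratfunM => //; exact: ratfun_cst.
have h2 := multiplier_pullback h1.
have h3 : multiplier (fun P => t (phi P) * B1.[s P] + - 1 * A1.[s P]).
  apply: multiplierD; apply: multiplierM.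
  - exact: multiplier_pullback.
  - exact/multiplier_horner/multiplier_s.
  - exact: multiplier_cst.
  - exact/multiplier_horner/multiplier_s.
have := multiplierM h2 h3; move/multiplier_ext; apply.
have ns : cof [set P | s P - r != 0].
  have := sfib r; rewrite /cof /=; apply: sub_finite_set => P /= /negP.
  by rewrite negbK subr_eq0 => /eqP.
have := phi_cof nz; move: rel; apply: filterS3 ns => P /= sr AB nzP.
apply: (mulIf sr); rewrite mulVf//; apply: (mulfI nzP).
rewrite mulr1 mulrA mulrA mulfV// mul1r.
have : A.[r] + A1.[s P] * (s P - r) = t (phi P) * (B.[r] + B1.[s P] * (s P - r)).
  by rewrite -hA1 -hB1.
move/eqP; rewrite -subr_eq0 => /eqP e; apply/eqP; rewrite -subr_eq0; apply/eqP.
by rewrite -[RHS]oppr0 -[in RHS]e; ring.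
Qed.

Lemma multiplier_inv_horner (p : {poly K}) : p != 0 -> multiplier (fun P => p.[s P]^-1).
Proof.
move=> p0; have [r ->] := closed_field_poly_normal p.
under eq_fun do rewrite hornerZ invfM.
apply: multiplierM; first exact: multiplier_cst.
elim: r => [|c r IH].
  by under eq_fun do rewrite big_nil hornerC invr1; exact: multiplier_cst.
under eq_fun do rewrite big_cons hornerM invfM hornerXsubC.
by apply: multiplierM => //; exact: multiplier_inv.
Qed.

Hypothesis fib : cof [set Q | forall r, A.[r] = t Q * B.[r] -> exists2 P, phi P = Q & s P = r].
Hypothesis span_all : forall f, ratfun f -> spanned f.

(** A - t B has m distinct roots unless t is a critical value of A / B, that is a
    value at a root of the Wronskian. *)
Lemma generic_fibre : cof [set Q | exists2 r : seq K, uniq r /\ size r = m &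
   forall x, x \in r -> A.[x] = t Q * B.[x]].
Proof.
pose D := wronskian A B.
have D0 : D != 0.
  have tA := leading_term_lead_coef A; rewrite sA /= (monicP monA) in tA.
  have [B0|B0] := eqVneq B 0.
    have : A %= 1 by move: cAB; rewrite B0 coprimep0.
    by move/eqp_size; rewrite size_poly1 sA => -[] m00; have := m0; rewrite m00.
  have tW := leading_term_wronskian tA (leading_term_lead_coef B).
  have : 'X * D != 0.
    apply: leading_term_neq0 tW _; rewrite mul1r mulf_neq0 ?lead_coef_eq0//.
    rewrite subr_eq0 eqr_nat gtn_eqF// -ltnS prednK ?size_poly_gt0//.
  by rewrite mulf_eq0 polyX_eq0.
have [rD DE] := closed_field_poly_normal D.
have bad : finite_set [set Q | exists2 c, c \in rD & t Q = A.[c] / B.[c]].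
  have -> : [set Q | exists2 c, c \in rD & t Q = A.[c] / B.[c]] =
    \bigcup_(c in [set` rD]) [set Q | t Q = A.[c] / B.[c]].
    by apply/seteqP; split => Q /= [c cr h]; exists c.
  by apply: bigcup_finite => [|c _]; [exact: finite_seq|exact: tfib].
rewrite /cof /=; apply: sub_finite_set bad => Q /= nQ; apply: contrapT => nbad.
apply: nQ; set p := A - t Q *: B.
have sp : size p = m.+1.
  by rewrite size_polyDl ?sA// size_polyN (leq_ltn_trans (size_scale_leq _ _))// ltnS.
have lp : lead_coef p = 1.
  rewrite lead_coefDl ?(monicP monA)// size_polyN sA.
  by rewrite (leq_ltn_trans (size_scale_leq _ _))// ltnS.
have [r rE] := closed_field_poly_normal p; rewrite lp scale1r in rE.
have rp x : x \in r -> A.[x] = t Q * B.[x].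
  move=> xr; have : root p x by rewrite rE root_prod_XsubC.
  by rewrite rootE !hornerE subr_eq0 => /eqP.
exists r => //; split; last first.
  by move: sp; rewrite rE size_prod_XsubC => -[].
rewrite -separable_prod_XsubC -rE separable_poly.unlock; apply: Pdiv.ClosedField.root_coprimep => x.
rewrite rE root_prod_XsubC => xr; apply/negP => /eqP px.
apply: nbad.
have Ax := rp _ xr.
have Bx : B.[x] != 0.
  by apply/eqP => Bx; apply: (coprimep_no_common_root cAB _ Bx); rewrite Ax Bx mulr0.
exists x; last by rewrite Ax mulfK.
have : root D x.
  rewrite rootE /D /wronskian !hornerE Ax.
  have : A^`().[x] - t Q * B^`().[x] = 0.
    by rewrite -[RHS]px -rE /p derivB derivZ !hornerE.
  by move/eqP; rewrite subr_eq0 => /eqP ->; apply/eqP; ring.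
by rewrite DE rootZ ?lead_coef_eq0// root_prod_XsubC.
Qed.

(** The powers of s span by hypothesis.  They are independent because, above a
    generic point of W, a relation becomes a polynomial of degree less than m with m
    distinct roots. *)
Theorem degree_of_coordinate : has_degree phi m.
Proof.
exists (fun i P => s P ^+ i); split; first by move=> i; exact: ratfunX.
move=> f /span_all[h [rh e]]; exists h; split=> // h' rh' e' i.
have [Z finZ hZ] : exists2 Z, finite_set Z & forall P, ~ Z P ->
    \sum_(i < m) (h' i (phi P) - h i (phi P)) * s P ^+ i = 0.
  have := cofI e e'; rewrite /cof /= => finZ.
  exists (~` ([set P | f P = \sum_(i < m) h i (phi P) * s P ^+ i] `&`
              [set P | f P = \sum_(i < m) h' i (phi P) * s P ^+ i])) => //.
  move=> P /contrapT[/= e1 e2]; under eq_bigr do rewrite mulrBl.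
  by rewrite sumrB -e1 -e2 subrr.
have ZQ : cof [set Q | ~ (phi @` Z) Q].
  have := finite_image phi finZ; rewrite /cof /=.
  by apply: sub_finite_set => Q /= /contrapT.
move: fib; apply: filterS3 ZQ generic_fibre => Q /= nZ [r [ur sr] rr] hfib.
(* The difference of the two relations at Q. *)
pose p : {poly K} := \poly_(i < m) (if insub i is Some j then h' j Q - h j Q else 0).
have p0 : p = 0.
  apply/eqP; apply/negPn/negP => p0.
  have : all (root p) r.
    apply/allP => x xr; have [P PQ Px] := hfib _ (rr _ xr).
    have := hZ P; rewrite PQ Px => e0; rewrite rootE horner_poly.
    under eq_bigr do rewrite valK.
    by apply/eqP/e0 => ZP; apply: nZ; exists P.
  move/(max_poly_roots p0)/(_ ur); rewrite sr ltnNge => /negP; apply.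
  exact: size_poly.
have := congr1 (fun q : {poly K} => q`_i) p0.
by rewrite coef_poly coef0 ltn_ord valK => /eqP; rewrite subr_eq0 => /eqP.
Qed.

End Degree.

(** * The coordinate ring of the curve *)

Section CurveE2.
Variable K : numClosedFieldType.
Local Notation E := (E2 K).
Local Notation O := (E2_zero K).
Implicit Types (b : {poly K}) (P Q : E).

Definition xc P : K := if val P is Some (x, _) then x else 0.
Definition yc P : K := if val P is Some (_, y) then y else 0.

Lemma E2_affine P : P <> O -> val P = Some (xc P, yc P).
Proof. by move=> PO; rewrite /xc /yc; case: P PO => -[[x y]|] //= h []; apply: val_inj. Qed.

Lemma E2_eq_zero P : val P = None -> P = O.
Proof. by move=> h; apply: val_inj. Qed.

Lemma E2_curve P : P <> O -> yc P ^+ 2 = xc P ^+ 3 - 1.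
Proof. by move=> /E2_affine e; have := valP P; rewrite /on_E2 e => /eqP. Qed.

Lemma E2_point_exists (x y : K) : y ^+ 2 = x ^+ 3 - 1 ->
  exists P : E, [/\ P <> O, xc P = x & yc P = y].
Proof.
move=> h; have hb : on_E2 (Some (x, y)) by apply/eqP.
by exists (exist (fun z => on_E2 z) (Some (x, y)) hb).
Qed.

Lemma E2_ext P Q : P <> O -> Q <> O -> xc P = xc Q -> yc P = yc Q -> P = Q.
Proof. by move=> /E2_affine p /E2_affine q ex ey; apply: val_inj; rewrite p q ex ey. Qed.

Lemma xc_fibre (c : K) : finite_set [set P | xc P = c].
Proof.
have [y1 hy1] : exists y1 : K, y1 ^+ 2 = c ^+ 3 - 1 by exists (sqrtC (c ^+ 3 - 1)); rewrite sqrtCK.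
have [P1 [n1 x1 e1]] := E2_point_exists hy1.
have [P2 [n2 x2 e2]] := @E2_point_exists c (- y1) (etrans (sqrrN y1) hy1).
apply: sub_finite_set (finite_set3 O P1 P2) => P /= xP.
have [->|/eqP PO] := eqVneq P O; first by left; left.
have /eqP : yc P ^+ 2 = y1 ^+ 2 by rewrite E2_curve// xP hy1.
rewrite eqf_sqr => /orP[] /eqP yP; [left; right|right]; apply: E2_ext => //.
- by rewrite xP x1.
- by rewrite yP e1.
- by rewrite xP x2.
- by rewrite yP e2.
Qed.

Lemma infinite_K : infinite_set [set: K].
Proof.
move=> finK; apply: infinite_nat.
have inj : {in [set: nat] &, injective (fun n : nat => n%:R : K)}.
  by move=> m n _ _ /eqP; rewrite eqr_nat => /eqP.
by have := finite_preimage (B := [set: K]) inj finK; rewrite preimage_setT.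
Qed.

Lemma infinite_E2 : infinite_set [set: E].
Proof.
move=> /(finite_image xc) h; apply: infinite_K; apply: sub_finite_set h => x _.
have [P [_ xP _]] := @E2_point_exists x (sqrtC (x ^+ 3 - 1)) (sqrtCK _).
by exists P.
Qed.

Lemma cof_affine : cof [set P | P <> O].
Proof. by rewrite /cof /=; apply: sub_finite_set (finite_set1 O) => P /= /contrapT. Qed.

Lemma cof_root b : b != 0 -> cof [set P | b.[xc P] != 0].
Proof.
move=> b0; have [r rE] := closed_field_poly_normal b.
have h : finite_set (\bigcup_(c in [set` r]) [set P | xc P = c]).
  by apply: bigcup_finite => [|c _]; [exact: finite_seq|exact: xc_fibre].
rewrite /cof /=; apply: sub_finite_set h => P /= /negP; rewrite negbK => bP.
by exists (xc P) => //=; move: bP; rewrite -rootE rE rootZ ?lead_coef_eq0// root_prod_XsubC.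
Qed.

(** The coordinate ring of the affine curve is free over K[x] with basis 1, y. *)
Definition regval b0 b1 P := b0.[xc P] + b1.[xc P] * yc P.

(** The norm of b0 + b1 y from the coordinate ring to K[x]. *)
Definition regnorm b0 b1 := b0 ^+ 2 - b1 ^+ 2 * cubX1 K.

Lemma horner_cubX1 (x : K) : (cubX1 K).[x] = x ^+ 3 - 1.
Proof. by rewrite /cubX1 hornerD hornerN hornerXn hornerC. Qed.

Lemma regval_norm b0 b1 P : P <> O ->
  regval b0 b1 P * regval b0 (- b1) P = (regnorm b0 b1).[xc P].
Proof.
move=> PO; rewrite /regval /regnorm hornerN !(horner_cubX1, horner_exp, hornerM, hornerD, hornerN).
by rewrite -E2_curve//; ring.
Qed.

(** b0^2 has even degree and b1^2 (X^3 - 1) has odd degree. *)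
Lemma regnorm_neq0 b0 b1 : (b0 != 0) || (b1 != 0) -> regnorm b0 b1 != 0.
Proof.
have [->|b10] := eqVneq b1 0.
  by rewrite orbF /regnorm expr0n mul0r subr0 => b00; rewrite expf_neq0.
move=> _; have l1 : lead_coef b1 != 0 by rewrite lead_coef_eq0.
have t1 := leading_termM (leading_termX 2 (leading_term_lead_coef b1)) (leading_term_cubX1 K).
have [->|b00] := eqVneq b0 0.
  by rewrite /regnorm expr0n sub0r oppr_eq0 mulf_neq0 ?expf_neq0 ?cubX1_neq0.
have l0 : lead_coef b0 != 0 by rewrite lead_coef_eq0.
have t0 := leading_termX 2 (leading_term_lead_coef b0).
apply/eqP => /eqP; rewrite subr_eq0 => /eqP e.
rewrite -e in t1; have [|| en _] := leading_term_uniq t0 t1.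
- by rewrite expf_neq0.
- by rewrite mulr1 expf_neq0.
- by move: en; clear; lia.
Qed.

Lemma cof_regval b0 b1 : (b0 != 0) || (b1 != 0) -> cof [set P | regval b0 b1 P != 0].
Proof.
move=> /regnorm_neq0/cof_root; apply: filterS2 cof_affine => P /= PO.
by rewrite -regval_norm// mulf_eq0 negb_or => /andP[].
Qed.

(** The irreducibility of the curve: a regular function that vanishes generically
    vanishes identically. *)
Lemma regval_eq0 b0 b1 : cof [set P | regval b0 b1 P = 0] -> b0 = 0 /\ b1 = 0.
Proof.
move=> h; suff /norP[/negPn/eqP -> /negPn/eqP ->] : ~~ ((b0 != 0) || (b1 != 0)) by [].
apply/negP => /cof_regval h'.
by have [P /= [-> /eqP]] := cof_nonempty infinite_E2 (cofI h h').
Qed.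

Lemma lift1_ord3 : lift ord0 ord0 = inord 1 :> 'I_3.
Proof. by apply: val_inj; rewrite /= inordK. Qed.

Lemma lift2_ord3 : lift ord0 (lift ord0 ord0) = inord 2 :> 'I_3.
Proof. by apply: val_inj; rewrite /= inordK. Qed.

Lemma feval_affine (F : mpoly.mpoly 3 K) P : P <> O ->
  feval (F : mpoly.mpoly (ambient_dim E).+1 K) P =
  \sum_(m <- mpoly.msupp F) mpoly.mcoeff m F * (xc P ^+ (m : mpoly.multinom 3) ord0 * yc P ^+ m
    (inord 1)).
Proof.
move=> PO; rewrite /feval mpoly.mevalE; apply: eq_bigr => m _; congr (_ * _).
rewrite !big_ord_recl big_ord0 /= (E2_affine PO).
rewrite /tnth /= expr1n !mulr1; congr (_ * _ ^+ m _).
exact: lift1_ord3.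
Qed.

(** b0 + b1 y has a pole of order at most 3 k at infinity, where x and y have poles
    of order 2 and 3, and c is its coefficient there; the leading term is in b0 or in
    b1 according to the parity of k.  The factor 3 * k./2 is (3 k) / 2 or (3 k - 3) / 2. *)
Definition weight_le k b0 b1 (c : K) :=
  if odd k then (size b0 <= (k./2 * 3).+2)%N /\ leading_term b1 (k./2 * 3) c
  else leading_term b0 (k./2 * 3) c /\ (size b1 <= (k./2 * 3).-1)%N.

Lemma weight_leD k b0 b1 c (b0' b1' : {poly K}) c' : weight_le k b0 b1 c ->
  weight_le k b0' b1' c' ->
  weight_le k (b0 + b0') (b1 + b1') (c + c').
Proof.
rewrite /weight_le; case: (odd k) => -[h1 h2] [h3 h4]; split; try exact: leading_termD;
  by rewrite (leq_trans (size_polyD _ _))// geq_max ?h1 ?h2 ?h3 ?h4.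
Qed.

Lemma weight_leZ k b0 b1 c a : weight_le k b0 b1 c -> weight_le k (a *: b0) (a *: b1) (a * c).
Proof.
rewrite /weight_le; case: (odd k) => -[h1 h2]; split; try exact: leading_termZ;
  by rewrite (leq_trans (size_scale_leq _ _)).
Qed.

Lemma weight_le0 k : weight_le k 0 0 (0 : K).
Proof. by rewrite /weight_le; case: (odd k); rewrite size_poly0; split=> //; split;
  rewrite ?size_poly0// coef0. Qed.

Lemma leading_term_leq (p : {poly K}) n a n' : leading_term p n a -> (n <= n')%N ->
  leading_term p n' (if n == n' then a else 0).
Proof.
move=> h nn'; case: eqVneq => [<-//|ne]; apply: leading_term_lt.
by apply: leq_trans h.1 _; rewrite ltn_neqAle ne.
Qed.

Lemma weight_le_monomial k i j l : (i + j + l)%N = k ->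
  weight_le k (if odd j then 0 else 'X^i * cubX1 K ^+ j./2)
    (if odd j then 'X^i * cubX1 K ^+ j./2 else 0) ((i == 0%N) && (l == 0%N))%:R.
Proof.
move=> ijl; have T : leading_term ('X^i * cubX1 K ^+ j./2) (i + 3 * j./2) 1.
  by rewrite -[1 in X in leading_term _ _ X]mulr1 -{2}(expr1n K j./2); apply: leading_termM;
    [exact: leading_termXn|apply: leading_termX; exact: leading_term_cubX1].
have ej := odd_double_half j; have ek := odd_double_half k.
rewrite /weight_le.
have bE (b : bool) : b%:R = if b then 1 else 0 :> K by case: b.
rewrite bE.
case: (boolP (odd k)) ek => ok ek; case: (boolP (odd j)) ej => oj ej; rewrite ?size_poly0.
- split=> //.
  have le : (i + 3 * j./2 <= k./2 * 3)%N by move: ijl ej ek; clear; lia.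
  have := leading_term_leq T le.
  suff -> : (i + 3 * j./2 == k./2 * 3)%N = (i == 0%N) && (l == 0%N) by [].
  by move: ijl ej ek; clear; lia.
- split.
    by apply: leq_trans T.1 _; move: ijl ej ek; clear; lia.
  have -> : (i == 0%N) && (l == 0%N) = false by move: ijl ej ek; clear; lia.
  by apply: leading_term_lt; rewrite size_poly0.
- split.
    have -> : (i == 0%N) && (l == 0%N) = false by move: ijl ej ek; clear; lia.
    by apply: leading_term_lt; rewrite size_poly0.
  by apply: leq_trans T.1 _; move: ijl ej ek; clear; lia.
- split=> //.
  have le : (i + 3 * j./2 <= k./2 * 3)%N by move: ijl ej ek; clear; lia.
  have := leading_term_leq T le.
  suff -> : (i + 3 * j./2 == k./2 * 3)%N = (i == 0%N) && (l == 0%N) by [].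
  by move: ijl ej ek; clear; lia.
Qed.

(** A form of degree k restricts to a regular function with a pole of order at most
    3 k at infinity.  The only monomial reaching this order is y^k, and it is also
    the only one that does not vanish at the point at infinity (0 : 1 : 0). *)
Lemma form_regval k (F : mpoly.mpoly (ambient_dim E).+1 K) : Defs.form k F ->
  exists b0 b1, weight_le k b0 b1 (feval F O) /\ forall P, P <> O -> feval F P = regval b0 b1 P.
Proof.
move=> hF.
have hd (m : mpoly.multinom 3) : m \in mpoly.msupp F -> mpoly.mdeg m = k.
  by move=> mF; have /mpoly.dhomogP/(_ m mF) := hF.
have FO : feval F O = \sum_(m <- mpoly.msupp F) mpoly.mcoeff m F *
    (((m : mpoly.multinom 3) ord0 == 0%N) && (m (inord 2) == 0%N))%:R.
  rewrite /feval mpoly.mevalE; apply: eq_bigr => m _; congr (_ * _).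
  rewrite !big_ord_recl big_ord0 /= /tnth /= expr1n mul1r mulr1 !expr0n -natrM mulnb.
  by rewrite lift2_ord3.
have [b0 [b1 [hb e]]] : exists b0 b1, weight_le k b0 b1 (feval F O) /\
   forall P, P <> O -> \sum_(m <- mpoly.msupp F) mpoly.mcoeff m F *
     (xc P ^+ (m : mpoly.multinom 3) ord0 * yc P ^+ m (inord 1)) = regval b0 b1 P.
  rewrite FO; move: (mpoly.msupp F) hd => r.
  elim: r => [|m r IH] hr.
    exists 0, 0; rewrite big_nil; split; first exact: weight_le0.
    by move=> P _; rewrite big_nil /regval !horner0 mul0r addr0.
  have [|b0 [b1 [hb e]]] := IH; first by move=> m' m'r; apply: hr; rewrite inE m'r orbT.
  have dm : (m ord0 + m (inord 1) + m (inord 2))%N = k.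
    rewrite -(hr m) ?mem_head// mpoly.mdegE !big_ord_recl big_ord0 addn0 -addnA.
    by rewrite -lift1_ord3 -lift2_ord3.
  have hm := weight_le_monomial dm.
  exists (mpoly.mcoeff m F *: (if odd (m (inord 1)) then 0 else 'X^(m ord0) * cubX1 K ^+ (m
    (inord 1))./2) + b0),
   (mpoly.mcoeff m F *: (if odd (m (inord 1)) then 'X^(m ord0) * cubX1 K ^+ (m (inord 1))./2 else
     0) + b1).
  split.
    by rewrite big_cons; apply: weight_leD => //; apply: weight_leZ.
  move=> P PO; rewrite big_cons e// /regval !hornerD !hornerZ.
  have yE : yc P ^+ m (inord 1) = yc P ^+ odd (m (inord 1)) * (cubX1 K).[xc P] ^+ (m (inord 1))./2.
    by rewrite -{1}(odd_double_half (m (inord 1))) exprD -mul2n exprM E2_curve// horner_cubX1.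
  rewrite yE; move: (cubX1 K) {hm yE} => D.
  case: (odd (m (inord 1))); rewrite ?horner0 hornerM !horner_exp hornerX /= ?expr0 ?expr1; ring.
by exists b0, b1; split=> // P PO; rewrite feval_affine// e.
Qed.

Lemma weight_le_norm k b0 b1 c : weight_le k b0 b1 c ->
  leading_term (regnorm b0 b1) (k * 3) ((-1) ^+ k * c ^+ 2).
Proof.
rewrite -signr_odd /weight_le /regnorm.
have := odd_double_half k; case: (odd k) => /= ek [h1 h2].
- rewrite expr1 mulN1r -[X in leading_term _ _ X]add0r; apply: leading_termB.
    apply: leading_term_lt; rewrite (leq_trans (size_poly_exp_leq _ _))//.
    by move: ek h1; move: (size b0) (k./2) => u v; clear; lia.
  have -> : (k * 3 = k./2 * 3 * 2 + 3)%N by move: ek; move: (k./2) => v; clear; lia.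
  by rewrite -[c ^+ 2]mulr1; apply: leading_termM; [exact: leading_termX|exact: leading_term_cubX1].
- rewrite expr0 mul1r -[X in leading_term _ _ X]subr0; apply: leading_termB.
    have -> : (k * 3 = k./2 * 3 * 2)%N by move: ek; move: (k./2) => v; clear; lia.
    exact: leading_termX.
  have [->|b10] := eqVneq b1 0.
    by rewrite expr0n mul0r; apply: leading_term_lt; rewrite size_poly0.
  have := (leading_termM (leading_termX 2 (leading_term_lead_coef b1)) (leading_term_cubX1 K)).1
    => s.
  apply: leading_term_lt; apply: leq_trans s _.
  by move: ek h2 b10; rewrite -size_poly_gt0; move: (size b1) (k./2) => u v; clear; lia.
Qed.

End CurveE2.

(** * The coordinates of an isogeny *)

Section IsogenyE2.
Variable K : numClosedFieldType.
Local Notation E := (E2 K).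
Local Notation O := (E2_zero K).
Local Notation i0 := (ord0 : 'I_3).
Local Notation i1 := (lift ord0 ord0 : 'I_3).
Local Notation i2 := (lift ord0 (lift ord0 ord0) : 'I_3).

Lemma hcoord_affine (P : E) : P <> O ->
  [/\ hcoord P i0 = xc P, hcoord P i1 = yc P & hcoord P i2 = 1].
Proof. by move=> /E2_affine e; rewrite /= e /tnth. Qed.

Lemma hcoord_zero : [/\ hcoord O i0 = 0, hcoord O i1 = 1 & hcoord O i2 = 0].
Proof. by rewrite /tnth. Qed.

Lemma E2_neg_on (P : E) : on_E2 (if val P is Some (x, y) then Some (x, - y) else None).
Proof. by case: P => -[[x y]|] //=; rewrite sqrrN. Qed.

Definition E2_neg (P : E) : E := exist (fun z => on_E2 z) _ (E2_neg_on P).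

Lemma E2_negK : involutive E2_neg.
Proof. by move=> -[[[x y]|] h]; apply: val_inj; rewrite /= ?opprK. Qed.

Lemma E2_neg_affine (P : E) : P <> O ->
  [/\ E2_neg P <> O, xc (E2_neg P) = xc P & yc (E2_neg P) = - yc P].
Proof. by case: P => -[[x y]|] h PO //; case: PO; apply: val_inj. Qed.

Lemma cof_neg C : cof C -> cof [set P | C (E2_neg P)].
Proof.
rewrite /cof /= => h; have := finite_image E2_neg h.
by apply: sub_finite_set => P /= nC; exists (E2_neg P) => //; rewrite E2_negK.
Qed.

Lemma E2_add_neg (P : E) : E2_add P (E2_neg P) = O.
Proof. by case: P => -[[x y]|] h; apply: val_inj => //=; rewrite !eqxx opprK eqxx. Qed.

Lemma E2_add_eq0 (P Q : E) : E2_add P Q = O -> P <> O ->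
  [/\ Q <> O, xc Q = xc P & yc Q = - yc P].
Proof.
case: P Q => -[[x y]|] hP [[[x' y']|] hQ] /(congr1 val) //=; last first.
  by move=> _ nO; case: nO; exact: (@E2_eq_zero K (exist _ None hP)).
by case: ifP => // /andP[/eqP ex /eqP ey] _ _; split; rewrite // /yc /= ey opprK.
Qed.

Variable phi : E -> E.
Hypothesis isog : isogeny phi.

Lemma isogeny_zero : phi O = O.
Proof.
have [_ /(_ O O)] := isog; have -> : E2_add O O = O by apply: val_inj.
case: (phi O) => -[[x y]|] h; last by move=> _; apply: val_inj.
move=> /(congr1 val) /=; case: ifP => // /negbT; rewrite eqxx /= => yy [ex ey].
case/eqP: yy; apply/eqP; rewrite -addr_eq0; apply/eqP.
by move: ey; rewrite -ex subrr mulr0 sub0r => {1}->; rewrite addrC subrr.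
Qed.

(** phi(P) + phi(-P) is the value of phi at the neutral element, hence zero. *)
Lemma isogeny_neg (P : E) : phi P <> O ->
  [/\ phi (E2_neg P) <> O, xc (phi (E2_neg P)) = xc (phi P) & yc (phi (E2_neg P)) = - yc (phi P)].
Proof.
move=> PO; apply: E2_add_eq0 => //.
by have [_ <-] := isog; rewrite E2_add_neg isogeny_zero.
Qed.

Definition regular (f : E -> K) := exists b0 b1, forall P, P <> O -> f P = regval b0 b1 P.

Lemma regular_poly b : regular (fun P => b.[xc P]).
Proof. by exists b, 0 => P _; rewrite /regval horner0 mul0r addr0. Qed.

Lemma regularM f g : regular f -> regular g -> regular (fun P => f P * g P).
Proof.
move=> [a0 [a1 ha]] [b0 [b1 hb]].
exists (a0 * b0 + a1 * b1 * cubX1 K), (a0 * b1 + a1 * b0) => P PO.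
rewrite ha// hb// /regval !(horner_cubX1, hornerD, hornerM) -E2_curve//; ring.
Qed.

Lemma regularB f g : regular f -> regular g -> regular (fun P => f P - g P).
Proof.
move=> [a0 [a1 ha]] [b0 [b1 hb]]; exists (a0 - b0), (a1 - b1) => P PO.
rewrite ha// hb// /regval !(hornerD, hornerN); ring.
Qed.

Lemma regular_eq f g : regular f -> regular g -> cof [set P | f P = g P] ->
  forall P, P <> O -> f P = g P.
Proof.
move=> hf hg h P PO; have [b0 [b1 hb]] := regularB hf hg.
suff [e0 e1] : b0 = 0 /\ b1 = 0.
  by apply/eqP; rewrite -subr_eq0 hb// e0 e1 /regval !horner0 mul0r addr0.
apply: regval_eq0; apply: filterS2 h (cof_affine K) => Q /= fg QO.
by rewrite -hb// fg subrr.
Qed.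

(** The forms defining phi near P, restricted to the affine curve. *)
Lemma isogeny_local (P : E) : exists k (b0 b1 : 'I_3 -> {poly K}) (F : 'I_3 -> E -> K),
  [/\ forall i, weight_le k (b0 i) (b1 i) (F i O),
      forall i Q, Q <> O -> F i Q = regval (b0 i) (b1 i) Q,
      exists i, F i P != 0 &
      forall Q, (exists i, F i Q != 0) -> exists2 c, c != 0 &
        forall i, F i Q = c * hcoord (phi Q) i].
Proof.
have [mor _] := isog; have [k [F [hF nz h]]] := mor P.
have /choice[b0 /choice[b1 hb]] := fun i : 'I_3 => form_regval (hF i).
exists k, b0, b1, (fun i Q => feval (F i) Q); split=> //.
- by move=> i; case: (hb i).
- by move=> i; case: (hb i).
Qed.

Hypothesis nonzero : exists P, phi P <> O.

(** Near a point where phi is not zero the third coordinate form is nonzero, hence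
    it is generically nonzero; so phi is given by a single expression there. *)
Lemma cof_isogeny_affine : exists (b0 b1 : 'I_3 -> {poly K}),
  ((b0 i2 != 0) || (b1 i2 != 0)) /\
  cof [set P | [/\ P <> O, regval (b0 i2) (b1 i2) P != 0, phi P <> O,
   regval (b0 i0) (b1 i0) P = regval (b0 i2) (b1 i2) P * xc (phi P) &
   regval (b0 i1) (b1 i1) P = regval (b0 i2) (b1 i2) P * yc (phi P)]].
Proof.
have [P0 hP0] := nonzero.
have P0O : P0 <> O by move=> e; apply: hP0; rewrite e isogeny_zero.
have [k [b0 [b1 [F [_ hF nz h]]]]] := isogeny_local P0.
exists b0, b1.
have [c c0 hc] := h _ nz; have [_ _ e2] := hcoord_affine hP0.
have n2 : regval (b0 i2) (b1 i2) P0 != 0 by rewrite -hF// hc e2 mulr1.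
have b2 : (b0 i2 != 0) || (b1 i2 != 0).
  rewrite -negb_and; apply: contraNN n2 => /andP[/eqP -> /eqP ->].
  by rewrite /regval !horner0 mul0r addr0.
split=> //; have := cof_regval b2.
apply: filterS2 (cof_affine K) => Q /= QO nQ.
have [|c' c'0 hc'] := h Q; first by exists i2; rewrite hF.
have pQ : phi Q <> O.
  move=> pQ; move: nQ; rewrite -hF// hc' pQ.
  by have [_ _ ->] := hcoord_zero; rewrite mulr0 eqxx.
have [e0' e1' e2'] := hcoord_affine pQ.
by split=> //; rewrite -!hF// !hc' e2' ?e0' ?e1'; ring.
Qed.

(** The coordinates of phi are rational in x and y.  As phi commutes with negation,
    the first is even and the second is odd in y. *)
Lemma isogeny_even_odd : exists r n t : {poly K}, n != 0 /\
  cof [set P | [/\ P <> O, phi P <> O, n.[xc P] != 0, xc (phi P) * n.[xc P] = r.[xc P] &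
    yc (phi P) * n.[xc P] = t.[xc P] * yc P]].
Proof.
have [b0 [b1 [b2 hcof]]] := cof_isogeny_affine.
pose n := regnorm (b0 i2) (b1 i2).
have n0 : n != 0 by exact: regnorm_neq0.
have G i : exists r t, forall P, P <> O ->
   regval (b0 i) (b1 i) P * regval (b0 i2) (- b1 i2) P = regval r t P.
  exists (b0 i * b0 i2 - b1 i * b1 i2 * cubX1 K), (b1 i * b0 i2 - b0 i * b1 i2) => P PO.
  rewrite /regval !(horner_cubX1, hornerD, hornerN, hornerM) -E2_curve//; ring.
have [r0 [r1 hr]] := G i0; have [t0 [t1 ht]] := G i1.
have hcof2 : cof [set P | [/\ P <> O, phi P <> O, n.[xc P] != 0,
    xc (phi P) * n.[xc P] = regval r0 r1 P & yc (phi P) * n.[xc P] = regval t0 t1 P]].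
  apply: filterS2 hcof (cof_root n0) => P /= [PO _ pP e0 e1] nP.
  by split=> //; rewrite -?hr -?ht// ?e0 ?e1 mulrAC regval_norm// mulrC.
have hcof3 : cof [set P | r1.[xc P] * yc P = 0 /\ t0.[xc P] = 0].
  apply: filterS2 hcof2 (cof_neg hcof2) => P /= [PO pP nP ex ey] [_ _ _].
  have [_ nx ny] := E2_neg_affine PO.
  have [_ xN yN] := isogeny_neg pP.
  rewrite /regval xN yN nx ny mulNr ex ey /regval => ex' ey'.
  have two : (2 : K) != 0 by rewrite pnatr_eq0.
  split; apply: (mulfI two); rewrite mulr0.
    move/eqP: ex'; rewrite -subr_eq0 => /eqP <-; ring.
  by move/eqP: ey'; rewrite eq_sym -subr_eq0 => /eqP <-; ring.
have [_ r10] : (0 : {poly K}) = 0 /\ r1 = 0.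
  by apply: regval_eq0; apply: filterS hcof3 => P /= [e _]; rewrite /regval horner0 add0r.
have [t00 _] : t0 = 0 /\ (0 : {poly K}) = 0.
  by apply: regval_eq0; apply: filterS hcof3 => P /= [_ e]; rewrite /regval horner0 mul0r addr0.
exists r0, n, t1; split=> //; apply: filterS hcof2 => P /= [PO pP nP -> ->].
by split=> //; rewrite /regval ?r10 ?t00 horner0 ?mul0r ?addr0 ?add0r.
Qed.

Lemma poly_eq_cof (a b : {poly K}) : cof [set P : E | a.[xc P] = b.[xc P]] -> a = b.
Proof.
move=> h; apply/eqP; rewrite -subr_eq0; apply/eqP.
have [-> //] : a - b = 0 /\ (0 : {poly K}) = 0.
apply: regval_eq0; apply: filterS h => P /= e.
by rewrite /regval hornerD hornerN e subrr horner0 mul0r addr0.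
Qed.

(** In reduced form, the equation of the curve becomes an identity of polynomials.
    That x o phi has a pole at infinity is seen from the forms defining phi there:
    phi fixes the point at infinity, so the form of the second coordinate has a
    pole of exact order 3 k and the form of the third one has a smaller pole; hence the
    quotient of their norms, which is - (y o phi)^2 = 1 - f^3, tends to infinity. *)
Lemma isogeny_structure : exists P Q T n : {poly K},
  [/\ coprimep P Q, Q != 0, n != 0, (size Q < size P)%N &
      cubX1 K * T ^+ 2 * Q ^+ 3 = n ^+ 2 * (P ^+ 3 - Q ^+ 3)] /\
  cof [set p | [/\ p <> O, phi p <> O, xc (phi p) * Q.[xc p] = P.[xc p] &
    yc (phi p) * n.[xc p] = T.[xc p] * yc p]].
Proof.
have [r [n [t [n0 h]]]] := isogeny_even_odd.
have [P [Q [g [g0 cPQ rE nE]]]] := coprime_reduction r n0.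
have Q0 : Q != 0 by apply: contraNneq n0 => Q0; rewrite nE Q0 mul0r.
have curve : cubX1 K * t ^+ 2 * n = r ^+ 3 - n ^+ 3.
  apply: poly_eq_cof; apply: filterS h => p /= [PO pP np ex ey].
  rewrite !(horner_cubX1, horner_exp, hornerM, hornerD, hornerN) -E2_curve// -ex.
  transitivity ((t.[xc p] * yc p) ^+ 2 * n.[xc p]); first by ring.
  by rewrite -ey exprMn E2_curve//; ring.
have curve2 : cubX1 K * t ^+ 2 * Q ^+ 3 = n ^+ 2 * (P ^+ 3 - Q ^+ 3).
  apply: (mulIf g0).
  transitivity (cubX1 K * t ^+ 2 * n * Q ^+ 2); first by rewrite nE; ring.
  by rewrite curve rE nE; ring.
have h2 : cof [set p | [/\ p <> O, phi p <> O, xc (phi p) * Q.[xc p] = P.[xc p] &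
    yc (phi p) * n.[xc p] = t.[xc p] * yc p]].
  apply: filterS2 h (cof_root g0) => p /= [PO pP np ex ey] gp; split=> //.
  by apply: (mulIf gp); rewrite -mulrA -!hornerM -nE -rE.
exists P, Q, t, n; split; [split=> //|exact: h2].
(* The rest of the proof compares the poles of the forms at infinity. *)
have [k [b0 [b1 [F [hw hF nz hc]]]]] := isogeny_local O.
have [c c0 hcO] := hc _ nz; have [u0 u1 u2] := hcoord_zero; rewrite isogeny_zero in hcO.
have w1 := hw i1; rewrite hcO u1 mulr1 in w1.
have w2 := hw i2; rewrite hcO u2 mulr0 in w2.
have n1 := weight_le_norm w1; have n2 := weight_le_norm w2.
have N10 : (-1) ^+ k * c ^+ 2 != 0 by rewrite mulf_neq0 ?signr_eq0// expf_neq0.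
have N1nz := leading_term_neq0 n1 N10.
have h3 : cof [set p | [/\ p <> O, phi p <> O & F i1 p = yc (phi p) * F i2 p]].
  apply: filterS2 h2 (cof_root N1nz) => p /= [PO pP _ _] np; split=> //.
  have [|c' c'0 hc'] := hc p.
    exists i1; rewrite hF//; apply: contraNneq np => e.
    by rewrite -regval_norm// e mul0r.
  have [_ e1 e2] := hcoord_affine pP.
  by rewrite !hc' e1 e2 mulr1 mulrC.
have e : - (P ^+ 3 - Q ^+ 3) * regnorm (b0 i2) (b1 i2) = regnorm (b0 i1) (b1 i1) * Q ^+ 3.
  apply: poly_eq_cof.
  have := cofI h3 (cof_neg h3); apply: filterS2 h2 => p /= [PO pP ex _] [[_ _ e1] [_ _ e2]].
  rewrite !(hornerN, hornerM) -!regval_norm//.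
  have rN i : regval (b0 i) (- b1 i) p = F i (E2_neg p).
    have [nO nx ny] := E2_neg_affine PO.
    by rewrite hF// /regval nx ny hornerN mulNr mulrN.
  rewrite !rN -!hF// e1 e2; have [_ _ ->] := isogeny_neg pP.
  have -> : (P ^+ 3 - Q ^+ 3).[xc p] = yc (phi p) ^+ 2 * Q.[xc p] ^+ 3.
    by rewrite E2_curve// hornerD hornerN !horner_exp -ex; ring.
  by ring.
rewrite ltnNge; apply/negP => sPQ.
have lQ : lead_coef Q != 0 by rewrite lead_coef_eq0.
have tP : leading_term P (size Q).-1 P`_(size Q).-1.
  by split=> //; apply: leq_trans sPQ _; exact: leqSpred.
have tl := leading_termM (leading_termN (leading_termB (leading_termX 3 tP) (leading_termX 3
  (leading_term_lead_coef Q)))) n2.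
have tr := leading_termM n1 (leading_termX 3 (leading_term_lead_coef Q)).
have := tl.2; rewrite e addnC tr.2 expr0n !mulr0 => /eqP.
by rewrite mulf_eq0 (negPf N10) expf_eq0 (negPf lQ).
Qed.

(** At a given point the forms defining phi there satisfy, by irreducibility, the
    polynomial relations that hold generically; coprimality of P and Q tells which
    of the two cases occurs. *)
Lemma isogeny_exact (P Q T n : {poly K}) : coprimep P Q ->
  cof [set p | [/\ p <> O, phi p <> O, xc (phi p) * Q.[xc p] = P.[xc p] &
    yc (phi p) * n.[xc p] = T.[xc p] * yc p]] ->
  forall p, p <> O ->
    (phi p = O -> Q.[xc p] = 0) /\
    (phi p <> O -> Q.[xc p] != 0 /\ xc (phi p) * Q.[xc p] = P.[xc p]).
Proof.
move=> cPQ h p PO; have [k [b0 [b1 [F [_ hF nz hc]]]]] := isogeny_local p.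
have regF i : regular (F i) by exists (b0 i), (b1 i) => p' p'O; exact: hF.
have [i' hi'] := nz.
have bi : (b0 i' != 0) || (b1 i' != 0).
  rewrite -negb_and; apply: contraNN hi' => /andP[/eqP e0 /eqP e1].
  by rewrite hF// /regval e0 e1 !horner0 mul0r addr0.
have h2 : cof [set p | [/\ phi p <> O, xc (phi p) * Q.[xc p] = P.[xc p],
    F i0 p = F i2 p * xc (phi p) & F i1 p = F i2 p * yc (phi p)]].
  apply: filterS2 h (cof_regval bi) => p' /= [PO' pP' ex _] nF.
  have [|c c0 e] := hc p'; first by exists i'; rewrite hF.
  have [e0 e1 e2] := hcoord_affine pP'.
  by split=> //; rewrite !e e2 ?e0 ?e1 mulr1.
have id1 : P.[xc p] * F i2 p = Q.[xc p] * F i0 p.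
  apply: (@regular_eq (fun p => P.[xc p] * F i2 p) (fun p => Q.[xc p] * F i0 p)) => //.
  - by apply: regularM => //; exact: regular_poly.
  - by apply: regularM => //; exact: regular_poly.
  - by apply: filterS h2 => p' /= [_ <- -> _]; ring.
have id2 : F i1 p * F i1 p * (Q ^+ 3).[xc p] = F i2 p * F i2 p * (P ^+ 3 - Q ^+ 3).[xc p].
  apply: (@regular_eq (fun p => F i1 p * F i1 p * (Q ^+ 3).[xc p])
    (fun p => F i2 p * F i2 p * (P ^+ 3 - Q ^+ 3).[xc p])) => //.
  - by apply: regularM; [exact: regularM|exact: regular_poly].
  - by apply: regularM; [exact: regularM|exact: regular_poly].
  - apply: filterS h2 => p' /= [pP' ex _ ->].
    rewrite hornerD hornerN !horner_exp -ex.
    transitivity (F i2 p' ^+ 2 * (yc (phi p') ^+ 2 * Q.[xc p'] ^+ 3)); first by ring.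
    by rewrite E2_curve//; ring.
have [c c0 e] := hc _ nz.
split=> [pO|pO].
  move: id2; rewrite !e pO; have [_ -> ->] := hcoord_zero.
  rewrite mulr0 !mul0r mulr1 horner_exp => /eqP.
  by rewrite mulf_eq0 mulf_eq0 (negPf c0) expf_eq0 /= => /eqP.
have [e0 _ e2] := hcoord_affine pO.
have ex : xc (phi p) * Q.[xc p] = P.[xc p].
  by apply: (mulfI c0); move: id1; rewrite !e e0 e2 mulr1 => id1; rewrite [RHS]mulrC id1; ring.
split=> //; apply/eqP => Q0; apply: (coprimep_no_common_root cPQ _ Q0).
by rewrite -ex Q0 mulr0.
Qed.

End IsogenyE2.

(** * Degree of a map of the projective line *)

Section DegreeP1.
Variable K : numClosedFieldType.
Variables (A B : {poly K}) (m : nat).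
Hypothesis sA : size A = m.+1.
Hypothesis monA : A \is monic.
Hypothesis sB : (size B <= m)%N.
Hypothesis m0 : (0 < m)%N.
Hypothesis cAB : coprimep A B.

Local Notation P := (P1 K).
Local Notation i0 := (ord0 : 'I_2).
Local Notation i1 := (lift ord0 ord0 : 'I_2).

Lemma hcoord_P1_some (z : K) : hcoord (Some z : P) i0 = z /\ hcoord (Some z : P) i1 = 1.
Proof. by rewrite /tnth. Qed.

Lemma hcoord_P1_none : hcoord (None : P) i0 = 1 /\ hcoord (None : P) i1 = 0.
Proof. by rewrite /tnth. Qed.

(** z0^m p(z1/z0).  The coordinate s = 1/z corresponds to z1/z0. *)
Definition homog_form (p : {poly K}) : mpoly.mpoly (ambient_dim P).+1 K :=
  \sum_(i < m.+1) p`_i *: (mpoly.mpolyX K (mpoly.mnm1 i0) ^+ (m - i) *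
                           mpoly.mpolyX K (mpoly.mnm1 i1) ^+ i).

Lemma homog_form_form p : Defs.form (V := P) m (homog_form p).
Proof.
have hX (l : 'I_2) : Defs.form (V := P) 1 (mpoly.mpolyX K (mpoly.mnm1 l)).
  by rewrite /Defs.form mpoly.dhomogX /= mpoly.mdeg1.
rewrite /Defs.form; apply: rpred_sum => i _; apply: rpredZ.
have e : ((1 * (m - i)) + 1 * i)%N = m by rewrite !mul1n subnK// -ltnS.
have := mpoly.dhomogM (mpoly.dhomogMn (m - i) (hX i0)) (mpoly.dhomogMn i (hX i1)).
by rewrite e.
Qed.

Lemma feval_homog_form p (Q : P) : feval (homog_form p) Q =
  \sum_(i < m.+1) p`_i * (hcoord Q i0 ^+ (m - i) * hcoord Q i1 ^+ i).
Proof.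
have fX F k : feval (V := P) (F ^+ k) Q = feval F Q ^+ k.
  by elim: k => [|k IH]; rewrite ?expr0 ?feval1// !exprS fevalM IH.
rewrite /homog_form; elim/big_ind2: _ => [|F1 x F2 y <- <-|i _].
- by rewrite -[0](scale0r (0 : mpoly.mpoly 2 K)) fevalZ mul0r.
- exact: fevalD.
- by rewrite fevalZ fevalM !fX !fevalXU.
Qed.

Lemma feval_homog_some p (z : K) : feval (V := P) (homog_form p) (Some z) = (revp m p).[z].
Proof.
rewrite feval_homog_form /revp horner_sum; apply: eq_bigr => i _.
have [-> ->] := hcoord_P1_some z.
by rewrite expr1n mulr1 hornerZ hornerXn.
Qed.

Lemma feval_homog_none p : feval (V := P) (homog_form p) None = p`_0.
Proof.
rewrite feval_homog_form big_ord_recl big1 => [|i _].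
  by have [-> ->] := hcoord_P1_none; rewrite expr1n expr0 !mulr1 addr0.
by have [_ ->] := hcoord_P1_none; rewrite expr0n /= !mulr0.
Qed.

(** The map of the projective line that is A / B in the coordinate s = 1/z. *)
Definition ratmap (Q : P) : P :=
  if feval (homog_form A) Q == 0 then None
  else Some (feval (homog_form B) Q / feval (homog_form A) Q).

Lemma ratmap_morphism : morphism ratmap.
Proof.
move=> Q; exists m, (fun i : 'I_2 => if i == i0 then homog_form B else homog_form A).
split.
- by move=> i; case: ifP => _; exact: homog_form_form.
- have [a0|a0] := eqVneq (feval (homog_form A) Q) 0; last by exists i1.
  exists i0; rewrite eqxx; apply/eqP => b0.
  case: Q a0 b0 => [z|]; last first.
    rewrite !feval_homog_none -!horner_coef0 => a b.
    exact: (coprimep_no_common_root cAB a b).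
  rewrite !feval_homog_some; have [->|z0] := eqVneq z 0.
    rewrite horner_revp0 => /eqP; have := monA; rewrite monicE lead_coefE sA /= => /eqP ->.
    by rewrite oner_eq0.
  rewrite !horner_revp ?sA//; last exact: leqW.
  have zm : z ^+ m != 0 by rewrite expf_neq0.
  move=> /eqP; rewrite mulf_eq0 (negPf zm) => /eqP a /eqP.
  rewrite mulf_eq0 (negPf zm) => /eqP b.
  exact: (coprimep_no_common_root cAB a b).
- move=> R [i hi]; have [a0|a0] := eqVneq (feval (homog_form A) R) 0.
    have b0 : feval (homog_form B) R != 0 by move: hi; case: ifP => // _; rewrite a0 eqxx.
    exists (feval (homog_form B) R) => // j; rewrite /ratmap a0 eqxx.
    have [h0 h1] := hcoord_P1_none; case: (unliftP ord0 j) => [j' ->|->].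
      by rewrite ord1 h1 mulr0.
    by rewrite h0 eqxx mulr1.
  exists (feval (homog_form A) R) => // j; rewrite /ratmap (negPf a0).
  have [h0 h1] := hcoord_P1_some (feval (homog_form B) R / feval (homog_form A) R).
  case: (unliftP ord0 j) => [j' ->|->]; first by rewrite ord1 h1 mulr1.
  by rewrite h0 eqxx mulrC divfK.
Qed.

(** The coordinate s = 1/z, with the default value 0 at its pole z = 0; only generic
    values matter for the degree. *)
Definition inv_coord (Q : P) : K := if Q is Some z then z^-1 else 0.

Lemma inv_coord_fibre c : finite_set [set Q | inv_coord Q = c].
Proof.
apply: sub_finite_set (finite_set3 (None : P) (Some 0 : P) (Some c^-1 : P)) => -[z|] /=.
  by move=> <-; right; rewrite invrK.
by move=> _; left; left.
Qed.

Lemma cof_P1_horner (p : {poly K}) : p != 0 ->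
  cof [set Q : P | exists z, [/\ Q = Some z, z != 0, p.[z^-1] != 0 & p.[z] != 0]].
Proof.
move=> p0; have [r rE] := closed_field_poly_normal p.
have h1 : finite_set (\bigcup_(c in [set` 0 :: r]) [set (Some c : P); (Some c^-1 : P)]).
  by apply: bigcup_finite => [|c _]; [exact: finite_seq|exact: finite_set2].
have h2 : finite_set ([set (None : P)] `|` (\bigcup_(c in [set` 0 :: r]) [set (Some c : P);
  (Some c^-1 : P)])).
  by rewrite finite_setU; split=> //; exact: finite_set1.
have pr x : p.[x] = 0 -> x \in r.
  by move=> px; rewrite -root_prod_XsubC -(rootZ _ _ (_ : lead_coef p != 0)) ?lead_coef_eq0// -rE
    rootE px.
rewrite /cof /=; apply: sub_finite_set h2 => -[z|] /= nz; last by left.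
right; apply: contrapT => nb; apply: nz; exists z; split=> //.
- by apply/eqP => z0; apply: nb; exists 0; rewrite /= ?mem_head ?z0//; left.
- by apply/eqP => /pr zr; apply: nb; exists z^-1; rewrite /= ?inE ?zr ?orbT//; right; rewrite invrK.
- by apply/eqP => /pr zr; apply: nb; exists z; rewrite /= ?inE ?zr ?orbT//; left.
Qed.

Lemma ratmap_inv z : z != 0 -> A.[z^-1] != 0 ->
  ratmap (Some z) = Some (B.[z^-1] / A.[z^-1]).
Proof.
move=> z0 a0; rewrite /ratmap !feval_homog_some !horner_revp ?sA//; last exact: leqW.
have zm : z ^+ m != 0 by rewrite expf_neq0.
by rewrite mulf_eq0 (negPf zm) (negPf a0) /= -mulf_div divff// mul1r.
Qed.

Let A0 : A != 0.
Proof. by rewrite -size_poly_eq0 sA. Qed.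

Lemma ratmap_rel : cof [set Q | A.[inv_coord Q] = inv_coord (ratmap Q) * B.[inv_coord Q]].
Proof.
have [B0|B0] := eqVneq B 0.
  have : A %= 1 by move: cAB; rewrite B0 coprimep0.
  by move/eqp_size; rewrite size_poly1 sA => -[] m00; have := m0; rewrite m00.
have := cof_P1_horner (mulf_neq0 A0 B0); apply: filterS => _ /= [z [-> z0 + _]].
rewrite hornerM mulf_eq0 negb_or => /andP[a b].
by rewrite ratmap_inv//= invf_div mulfVK.
Qed.

Lemma ratfun_inv_coord : ratfun inv_coord.
Proof.
apply: (@ratfun_ext _ _ (fun Q : P => hcoord Q i1 / hcoord Q i0)).
  apply: ratfun_coord; apply: filterS (cof_P1_horner (oner_neq0 {poly K})) => _ /= [z [-> z0 _ _]].
  exact: z0.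
by apply: filterE => -[z|]; rewrite /tnth /= ?mul1r ?mul0r.
Qed.

Lemma form_P1 k (F : mpoly.mpoly (ambient_dim P).+1 K) : Defs.form k F ->
  exists b : {poly K}, forall z, feval (V := P) F (Some z) = b.[z].
Proof.
move=> _; exists (\sum_(m <- mpoly.msupp F) mpoly.mcoeff m F *: 'X^((m : mpoly.multinom 2) i0))
  => z.
rewrite horner_sum /feval mpoly.mevalE; apply: eq_bigr => l _; rewrite hornerZ hornerXn.
congr (_ * _); rewrite !big_ord_recl big_ord0.
by have [-> ->] := hcoord_P1_some z; rewrite expr1n !mulr1.
Qed.

Local Notation mult := (multiplier ratmap inv_coord m).

(** z = 1/s, and 1 / (z - c) = - (1/c) s / (s - 1/c) for c nonzero, are
    products of functions already known to preserve the span. *)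
Lemma multiplier_P1_ratfun (f : P -> K) : ratfun f -> mult f.
Proof.
move=> [k [F [G [hF hG nG e]]]].
have ms : mult inv_coord.
  exact: multiplier_s sA monA sB m0 ratfun_inv_coord ratmap_rel.
have mi r : mult (fun Q => (inv_coord Q - r)^-1).
  exact: (multiplier_inv sA monA sB m0 cAB ratfun_inv_coord ratmap_rel inv_coord_fibre
    inv_coord_fibre).
pose zc (Q : P) : K := if Q is Some z then z else 0.
have mz : mult zc.
  apply: multiplier_ext (mi 0) _.
  apply: filterS (cof_P1_horner (oner_neq0 {poly K})) => _ /= [z [-> _ _ _]].
  by rewrite subr0 invrK.
have mzi c : mult (fun Q => (zc Q - c)^-1).
  have [->|c0] := eqVneq c 0.
    apply: multiplier_ext ms _.
    apply: filterS (cof_P1_horner (oner_neq0 {poly K})) => _ /= [z [-> _ _ _]].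
    by rewrite subr0.
  apply: multiplier_ext (multiplierM (multiplier_cst (- c^-1)) (multiplierM ms (mi c^-1))) _.
  have Xc0 : ('X - c%:P : {poly K}) != 0 by rewrite polyXsubC_eq0.
  apply: filterS (cof_P1_horner Xc0) => _ /= [z [-> z0 _]].
  rewrite hornerXsubC => zc0.
  have zi0 : z^-1 - c^-1 != 0 by rewrite subr_eq0 (inj_eq invr_inj) -subr_eq0.
  have -> : z^-1 - c^-1 = - (c^-1 * z^-1 * (z - c)) by field; rewrite z0 c0.
  by rewrite /zc /=; field; rewrite z0 c0 zc0.
have mpi p : mult (fun Q => p.[zc Q]^-1).
  have [->|p0] := eqVneq p 0.
    under eq_fun do rewrite horner0 invr0; exact: multiplier_cst.
  have [r ->] := closed_field_poly_normal p.
  under eq_fun do rewrite hornerZ invfM.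
  apply: multiplierM; first exact: multiplier_cst.
  elim: r => [|c r IH].
    by under eq_fun do rewrite big_nil hornerC invr1; exact: multiplier_cst.
  under eq_fun do rewrite big_cons hornerM invfM hornerXsubC.
  by apply: multiplierM => //; exact: mzi.
have [a ha] := form_P1 hF; have [b hb] := form_P1 hG.
apply: multiplier_ext (multiplierM (multiplier_horner a mz) (mpi b)) _.
have e' : cof [set Q | f Q = feval F Q / feval G Q] := e.
apply: filterS2 e' (cof_P1_horner (oner_neq0 {poly K})) => Q /= -> [z [-> _ _ _]].
by rewrite ha hb.
Qed.

Lemma ratmap_degree : has_degree ratmap m.
Proof.
apply: (degree_of_coordinate sA monA sB m0 cAB ratfun_inv_coord inv_coord_fibre).
- have hN : cof [set Q : P | Q <> None].
    by apply: filterS (cof_P1_horner (oner_neq0 {poly K})) => _ /= [z [-> _ _ _]].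
  have h0 := cof_above inv_coord cAB inv_coord_fibre hN.
  apply: filterS2 h0 (cof_P1_horner (oner_neq0 {poly K})) => Q /= hQ [w [QE w0 _ _]] r e.
  have r0 : r != 0 by apply/eqP => r0; apply: (hQ None) => //=; rewrite -r0.
  have Br : B.[r] != 0.
    by apply/eqP => Br; apply: (coprimep_no_common_root cAB _ Br); rewrite e Br mulr0.
  have Ar : A.[r] = w^-1 * B.[r] by rewrite e QE.
  exists (Some r^-1); rewrite /= ?invrK//.
  rewrite ratmap_inv ?invr_eq0 ?invrK//; last by rewrite Ar mulf_neq0 ?invr_eq0.
  by rewrite QE Ar; congr Some; field; rewrite w0 Br.
- move=> f rf; apply: spanned_ext (multiplier_P1_ratfun rf (spanned1 _ _ m0)) _.
  by apply: filterE => Q /=; rewrite mulr1.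
Qed.

End DegreeP1.

(** * Degree of the isogeny *)

Section DegreeE2.
Variable K : numClosedFieldType.
Local Notation E := (E2 K).
Local Notation O := (E2_zero K).
Local Notation i0 := (ord0 : 'I_3).
Local Notation i1 := (lift ord0 ord0 : 'I_3).
Local Notation i2 := (lift ord0 (lift ord0 ord0) : 'I_3).

Lemma ratfun_xc : ratfun (@xc K).
Proof.
apply: (@ratfun_ext _ E (fun P : E => hcoord P i0 / hcoord P i2)).
  apply: ratfun_coord; apply: filterS (cof_affine K) => P /hcoord_affine[_ _ e].
  by rewrite /mkset e oner_neq0.
by apply: filterS (cof_affine K) => P /hcoord_affine[e0 _ e2]; rewrite /mkset e0 e2 divr1.
Qed.

Lemma ratfun_yc : ratfun (@yc K).
Proof.
apply: (@ratfun_ext _ E (fun P : E => hcoord P i1 / hcoord P i2)).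
  apply: ratfun_coord; apply: filterS (cof_affine K) => P /hcoord_affine[_ _ e].
  by rewrite /mkset e oner_neq0.
by apply: filterS (cof_affine K) => P /hcoord_affine[_ e1 e2]; rewrite /mkset e1 e2 divr1.
Qed.

Definition xc3 (P : E) : K := xc P ^+ 3.

Lemma ratfun_xc3 : ratfun xc3.
Proof. exact: (ratfunX 3 ratfun_xc). Qed.

Lemma cof_xc3 (p : {poly K}) : p != 0 -> cof [set P : E | p.[xc3 P] != 0].
Proof.
move=> p0; have := @cof_root K (p \Po 'X^3); rewrite comp_poly_eq0 ?size_polyXn// => /(_ p0).
by apply: filterS => P /=; rewrite horner_comp hornerXn.
Qed.

Lemma xc3_fibre (c : K) : finite_set [set P | xc3 P = c].
Proof.
have := cof_xc3 (_ : 'X - c%:P != 0); rewrite polyXsubC_eq0 => /(_ isT).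
rewrite /cof /=; apply: sub_finite_set => P /= sP.
by apply/negP; rewrite negbK hornerXsubC sP subrr.
Qed.

(** X - c divides X^3 - c^3. *)
Lemma dvdp_comp_X3 (b : {poly K}) : b != 0 ->
  exists b' q : {poly K}, q != 0 /\ b * b' = q \Po 'X^3.
Proof.
move=> b0; have [r rE] := closed_field_poly_normal b.
have [b' [q [q0 e]]] : exists b' q : {poly K}, q != 0 /\
    (\prod_(z <- r) ('X - z%:P)) * b' = q \Po 'X^3.
  elim: r {rE} => [|c r [b' [q [q0 e]]]].
    by exists 1, 1; rewrite big_nil mulr1 comp_polyC oner_neq0.
  exists (b' * ('X^2 + c%:P * 'X + (c ^+ 2)%:P)), (q * ('X - (c ^+ 3)%:P)).
  rewrite mulf_neq0 ?polyXsubC_eq0//; split=> //.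
  rewrite big_cons comp_polyM -e comp_polyB comp_polyX comp_polyC !polyC_exp; ring.
exists b', (lead_coef b *: q); rewrite scaler_eq0 negb_or lead_coef_eq0 b0; split=> //.
by rewrite {1}rE -scalerAl e comp_polyZ.
Qed.

Variables (phi : E -> E) (P Q T n p q A B g : {poly K}) (m : nat).
Hypothesis isog : isogeny phi.
Hypothesis Q0 : Q != 0.
Hypothesis T0 : T != 0.
Hypothesis generic : cof [set a | [/\ a <> O, phi a <> O, xc (phi a) * Q.[xc a] = P.[xc a] &
    yc (phi a) * n.[xc a] = T.[xc a] * yc a]].
Hypothesis p0 : p != 0.
Hypothesis q0 : q != 0.
Hypothesis PQpq : P * (q \Po 'X^3) = Q * ('X * (p \Po 'X^3)).
Hypothesis g0 : g != 0.
Hypothesis AE : 'X * p ^+ 3 = A * g.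
Hypothesis BE : q ^+ 3 = B * g.
Hypothesis cAB : coprimep A B.
Hypothesis sA : size A = m.+1.
Hypothesis monA : A \is monic.
Hypothesis sB : (size B <= m)%N.
Hypothesis m0 : (0 < m)%N.

(** The relation A(s) = t B(s) with t = s o phi is the cube of x o phi = x mu(s). *)
Lemma generic_x : cof [set a | [/\ a <> O, phi a <> O, q.[xc3 a] != 0,
  xc (phi a) * q.[xc3 a] = xc a * p.[xc3 a] & A.[xc3 a] = xc3 (phi a) * B.[xc3 a]]].
Proof.
apply: filterS3 generic (cof_root Q0) (cofI (cof_xc3 q0) (cof_xc3 g0)) => a /= [aO pO ex _] Qa
  [qa ga].
have e : xc (phi a) * q.[xc3 a] = xc a * p.[xc3 a].
  apply: (mulfI Qa); have := congr1 (fun r : {poly K} => r.[xc a]) PQpq.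
  rewrite !hornerM !horner_comp !hornerXn hornerX -ex -/(xc3 a) => <-.
  by ring.
split=> //; apply: (mulIf ga).
by rewrite -mulrA -!hornerM -AE -BE hornerM hornerX !horner_exp /xc3 -!exprMn -/(xc3 a) e exprMn.
Qed.

Let rel : cof [set a | A.[xc3 a] = xc3 (phi a) * B.[xc3 a]].
Proof. by apply: filterS generic_x => a /= []. Qed.

Local Notation mult := (multiplier phi xc3 m).

(** x = (x o phi) / mu(s), a rational function of x has a denominator in K[s]
    by [dvdp_comp_X3], and y is (y o phi) times a rational function of x; a nonzero
    regular function is inverted with its norm. *)
Lemma multiplier_E2_ratfun (f : E -> K) : ratfun f -> mult f.
Proof.
move=> [k [F [G [hF hG nG e]]]].
have ms : mult xc3 by exact: multiplier_s sA monA sB m0 ratfun_xc3 rel.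
have mi (b : {poly K}) : b != 0 -> mult (fun a => b.[xc3 a]^-1).
  exact: (multiplier_inv_horner sA monA sB m0 cAB ratfun_xc3 rel xc3_fibre xc3_fibre).
have mpull h : ratfun h -> mult (fun a => h (phi a)).
  exact: multiplier_pullback.
have mx : mult (@xc K).
  apply: multiplier_ext (multiplierM (mpull _ ratfun_xc) (multiplierM (multiplier_horner q ms)
    (mi _ p0))) _.
  apply: filterS2 generic_x (cof_xc3 p0) => a /= [_ _ _ ex _] pa.
  by rewrite mulrA ex mulfK.
have mxi (b : {poly K}) : b != 0 -> mult (fun a => b.[xc a]^-1).
  move=> b0; have [b' [r [r0 br]]] := dvdp_comp_X3 b0.
  apply: multiplier_ext (multiplierM (multiplier_horner b' mx) (mi _ r0)) _.
  apply: filterS2 (cof_root b0) (cof_xc3 r0) => a /= ba ra.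
  have := congr1 (fun r : {poly K} => r.[xc a]) br.
  rewrite hornerM horner_comp hornerXn -/(xc3 a) => er.
  by apply: (mulfI ba); rewrite mulfV// mulrA er mulfV.
have my : mult (@yc K).
  apply: multiplier_ext (multiplierM (mpull _ ratfun_yc) (multiplierM (multiplier_horner n mx)
    (mxi _ T0))) _.
  apply: filterS2 generic (cof_root T0) => a /= [_ _ _ ey] Ta.
  by rewrite mulrA ey mulrAC mulfV// mul1r.
have mreg b0 b1 : mult (regval b0 b1).
  apply: multiplierD; first exact: multiplier_horner.
  by apply: multiplierM => //; exact: multiplier_horner.
have [a0 [a1 [_ ha]]] := form_regval hF; have [b0 [b1 [_ hb]]] := form_regval hG.
have nG' : cof [set a | feval G a != 0] := nG.
have bnz : (b0 != 0) || (b1 != 0).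
  have [a [/= aO]] := cof_nonempty (@infinite_E2 K) (cofI (cof_affine K) nG').
  rewrite hb// -negb_and; apply: contraNN => /andP[/eqP -> /eqP ->].
  by rewrite /regval !horner0 mul0r addr0.
have nn := regnorm_neq0 bnz.
have e' : cof [set a | f a = feval F a / feval G a] := e.
apply: multiplier_ext (multiplierM (mreg a0 a1) (multiplierM (mreg b0 (- b1)) (mxi _ nn))) _.
apply: filterS3 (cof_root nn) (cof_affine K) e' => a /= na aO ->.
rewrite ha// hb//; congr (_ * _); move: na; rewrite -regval_norm// => na.
have /andP[n1 n2] : (regval b0 b1 a != 0) && (regval b0 (- b1) a != 0).
  by rewrite -negb_or -mulf_eq0.
by field; rewrite n1 n2.
Qed.

(** Above a generic point there is, for each root r of A - t B, a point with s = r: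
    any point with s = r has an image with the right value of x^3, and it is moved
    to the right image by a cube root of unity on x and a sign on y. *)
Lemma fibre_above : cof [set b | forall r, A.[r] = xc3 b * B.[r] ->
  exists2 a, phi a = b & xc3 a = r].
Proof.
have good := cof_above xc3 cAB xc3_fibre generic_x.
have X0 : ('X : {poly K}) != 0 by rewrite polyX_eq0.
apply: filterS3 good (cof_affine K) (cof_root X0) => b /= hgood bO.
rewrite hornerX => xb r Ar.
have [x1 hx1] : exists x1 : K, x1 ^+ 3 = r by exists (3.-root r); rewrite rootCK.
have pt (x : K) : x ^+ 3 = r -> exists a : E, [/\ a <> O, xc a = x & xc3 a = r].
  move=> xr; have [a [aO ax ay]] := @E2_point_exists K x (sqrtC (x ^+ 3 - 1)) (sqrtCK _).
  by exists a; split=> //; rewrite /xc3 ax.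
have [a1 [a1O a1x a1s]] := pt _ hx1.
have goodr a : xc3 a = r -> [/\ a <> O, phi a <> O, q.[xc3 a] != 0,
    xc (phi a) * q.[xc3 a] = xc a * p.[xc3 a] & A.[xc3 a] = xc3 (phi a) * B.[xc3 a]].
  by move=> ar; apply: hgood; rewrite ar.
have [_ pa1 qr ex1 AB1] := goodr _ a1s.
have Br : B.[r] != 0.
  by apply/eqP => Br; apply: (coprimep_no_common_root cAB _ Br); rewrite Ar Br mulr0.
have e3 : xc (phi a1) ^+ 3 = xc b ^+ 3.
  by apply: (mulIf Br); rewrite -/(xc3 b) -Ar -a1s AB1.
have xa1 : xc (phi a1) != 0.
  by apply: contraNneq xb => xa1; move: e3; rewrite xa1 expr0n /= => /esym/eqP;
    rewrite expf_eq0 /= => /eqP ->.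
pose z := xc b / xc (phi a1).
have z3 : z ^+ 3 = 1 by rewrite /z expr_div_n -e3 divff// expf_neq0.
have [|a2 [a2O a2x a2s]] := pt (z * x1); first by rewrite exprMn z3 mul1r.
have [_ pa2 _ ex2 _] := goodr _ a2s.
have x2 : xc (phi a2) = xc b.
  apply: (mulIf qr); rewrite a1s -{1}a2s ex2 a2x a2s -mulrA -a1x.
  have := ex1; rewrite a1s => <-; rewrite /z; by field.
have y2 : yc (phi a2) ^+ 2 = yc b ^+ 2 by rewrite !E2_curve// x2.
move/eqP: y2; rewrite eqf_sqr => /orP[] /eqP y2.
  by exists a2 => //; apply: E2_ext.
have [nO nx ny] := E2_neg_affine a2O.
have [pnO pnx pny] := isogeny_neg isog pa2.
exists (E2_neg a2); last by rewrite /xc3 nx.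
by apply: E2_ext => //; rewrite ?pnx ?pny ?y2 ?opprK.
Qed.

Lemma isogeny_degree : has_degree phi m.
Proof.
apply: (degree_of_coordinate sA monA sB m0 cAB ratfun_xc3 xc3_fibre fibre_above).
move=> f rf; apply: spanned_ext (multiplier_E2_ratfun rf (spanned1 _ _ m0)) _.
by apply: filterE => a /=; rewrite mulr1.
Qed.

End DegreeE2.

Section DegreeMu.
Variable K : numClosedFieldType.
Variables (p q : {poly K}).
Hypothesis spq : size p = size q.
Hypothesis q0 : q != 0.

(** deg p = deg q makes deg A = deg B + 1 for the reduced form A / B of s mu(s)^3. *)
Lemma mu_cube_reduction : exists (A B g : {poly K}) (m : nat),
  [/\ g != 0, 'X * p ^+ 3 = A * g & q ^+ 3 = B * g] /\
  [/\ coprimep A B, size A = m.+1, A \is monic, (size B <= m)%N & (0 < m)%N].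
Proof.
have p0 : p != 0 by rewrite -size_poly_eq0 spq size_poly_eq0.
have q30 : q ^+ 3 != 0 by rewrite expf_neq0.
have [A [B [g [g0 cAB AE BE]]]] := coprime_reduction ('X * p ^+ 3) q30.
have Xp0 : 'X * p ^+ 3 != 0 by rewrite mulf_neq0 ?polyX_eq0 ?expf_neq0.
have A0 : A != 0 by apply: contraNneq Xp0 => A0; rewrite AE A0 mul0r.
have B0 : B != 0 by apply: contraNneq q30 => B0; rewrite BE B0 mul0r.
have lp : lead_coef p != 0 by rewrite lead_coef_eq0.
have lq : lead_coef q != 0 by rewrite lead_coef_eq0.
have sAB : size A = (size B).+1.
  have tA := leading_termM (leading_term_lead_coef A) (leading_term_lead_coef g).
  have tB := leading_termM (leading_term_lead_coef B) (leading_term_lead_coef g).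
  have tp := leading_termM (leading_termXn K 1) (leading_termX 3 (leading_term_lead_coef p));
    rewrite expr1 AE in tp.
  have tq := leading_termX 3 (leading_term_lead_coef q); rewrite BE in tq.
  have [||e1 _] := leading_term_uniq tp tA; rewrite ?mul1r ?mulf_neq0 ?expf_neq0 ?lead_coef_eq0//.
  have [||e2 _] := leading_term_uniq tq tB; rewrite ?mul1r ?mulf_neq0 ?expf_neq0 ?lead_coef_eq0//.
  have : (0 < size A)%N by rewrite size_poly_gt0.
  have : (0 < size B)%N by rewrite size_poly_gt0.
  by move: e1 e2; rewrite spq; move: (size A) (size B) (size g) (size q) => a b c d; clear; lia.
have lA : lead_coef A != 0 by rewrite lead_coef_eq0.
exists ((lead_coef A)^-1 *: A), ((lead_coef A)^-1 *: B), (lead_coef A *: g), (size B); split; split.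
- by rewrite scaler_eq0 negb_or lA.
- by rewrite -scalerAl -scalerAr scalerA mulVf// scale1r.
- by rewrite -scalerAl -scalerAr scalerA mulVf// scale1r.
- by rewrite coprimepZl ?invr_eq0// coprimepZr ?invr_eq0.
- by rewrite size_scale ?invr_eq0.
- by rewrite monicE lead_coefZ mulVf.
- by rewrite size_scale ?invr_eq0.
- by rewrite size_poly_gt0.
Qed.

Lemma ratfun_degree_mu (A B g : {poly K}) (m : nat) :
  g != 0 -> 'X * p ^+ 3 = A * g -> q ^+ 3 = B * g ->
  coprimep A B -> size A = m.+1 -> A \is monic -> (size B <= m)%N -> (0 < m)%N ->
  ratfun_degree (fun z => z / fracval p q z^-1 ^+ 3) m.
Proof.
move=> g0 AE BE cAB sA monA sB m0; exists (ratmap A B m); split.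
- exact: ratmap_morphism.
- have A0 : A != 0 by rewrite -size_poly_eq0 sA.
  have h := cof_P1_horner (mulf_neq0 A0 g0).
  rewrite /cof /= in h.
  have : finite_set ((fun Q : P1 K => if Q is Some z then z else 0) @` 
     (~` [set Q : P1 K | exists z, [/\ Q = Some z, z != 0,
       (A * g).[z^-1] != 0 & (A * g).[z] != 0]])).
    exact: finite_image.
  apply: sub_finite_set => z /= nz; exists (Some z) => //= -[w [[<-] z0 + _]].
  rewrite hornerM mulf_eq0 negb_or => /andP[a b]; apply: nz.
  rewrite ratmap_inv//; congr Some.
  have eA := congr1 (fun r : {poly K} => r.[z^-1]) AE.
  have eB := congr1 (fun r : {poly K} => r.[z^-1]) BE.
  rewrite !(horner_exp, hornerM, hornerX) in eA eB.
  have pz : p.[z^-1] != 0.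
    by apply/eqP => pz; move: eA; rewrite pz expr0n /= mulr0 => /esym/eqP;
      rewrite mulf_eq0 (negPf a) (negPf b).
  rewrite /fracval expr_div_n invf_div eB.
  have -> : p.[z^-1] ^+ 3 = z * (A.[z^-1] * g.[z^-1]) by rewrite -eA mulrA mulfV// mul1r.
  by field; rewrite z0 a b.
- exact: ratmap_degree.
Qed.

End DegreeMu.

(** * Complex derivatives *)

Section ComplexDerivative.
Variable K : numClosedFieldType.
Implicit Types (f g k : K -> K) (z w l m c : K).

Lemma cts_cst c z : {for z, continuous (fun _ : K => c)}.
Proof. exact: cst_continuous. Qed.

Lemma cts_id z : {for z, continuous (fun w : K => w)}.
Proof. exact: cvg_id. Qed.

Lemma ctsD f g z : {for z, continuous f} -> {for z, continuous g} ->
  {for z, continuous (fun w => f w + g w)}.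
Proof. exact: continuousD. Qed.

Lemma ctsM f g z : {for z, continuous f} -> {for z, continuous g} ->
  {for z, continuous (fun w => f w * g w)}.
Proof. exact: continuousM. Qed.

Lemma ctsN f z : {for z, continuous f} -> {for z, continuous (fun w => - f w)}.
Proof. exact: continuousN. Qed.

Lemma ctsB f g z : {for z, continuous f} -> {for z, continuous g} ->
  {for z, continuous (fun w => f w - g w)}.
Proof. by move=> hf /ctsN; apply: ctsD. Qed.

Lemma ctsV f z : f z != 0 -> {for z, continuous f} -> {for z, continuous (fun w => (f w)^-1)}.
Proof. exact: continuousV. Qed.

Lemma cts_comp f g z : {for z, continuous g} -> {for g z, continuous f} ->
  {for z, continuous (fun w => f (g w))}.
Proof. exact: continuous_comp. Qed.

(** Caratheodory's form of f'(z) = l.  The quotient k is defined on the whole of K, which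
    makes products and composites immediate. *)
Definition cderiv f z l := exists2 k : K -> K,
  (forall w, f w - f z = (w - z) * k w) & {for z, continuous k} /\ k z = l.

Lemma cderiv_near f z k : (\forall w \near z, f w - f z = (w - z) * k w) ->
  {for z, continuous k} -> cderiv f z (k z).
Proof.
move=> fk ck; pose k1 w := if w == z then k z else (f w - f z) / (w - z).
exists k1.
  move=> w; rewrite /k1; have [->|transf_arg] := eqVneq w z; first by rewrite !subrr mul0r.
  by rewrite mulrC divfK// subr_eq0.
have k1z : k1 z = k z by rewrite /k1 eqxx.
split=> //; change (k1 w @[w --> z] --> k1 z); rewrite k1z.
have e : {near nbhs z, k =1 k1}.
  apply: filterS fk => w e; rewrite /k1; have [->//|transf_arg] := eqVneq w z.
  by rewrite e mulrAC mulfV ?mul1r// subr_eq0.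
exact: cvg_trans (near_eq_cvg e) ck.
Qed.

Lemma cderiv_continuous f z l : cderiv f z l -> {for z, continuous f}.
Proof.
move=> [k fk [ck _]].
have -> : f = (fun w => f z + (w - z) * k w) by apply/funext => w; rewrite -fk addrC subrK.
by apply: ctsD; [exact: cts_cst|apply: ctsM => //; apply: ctsB; [exact: cts_id|exact: cts_cst]].
Qed.

Lemma cderiv_eq f z l l' : cderiv f z l -> l = l' -> cderiv f z l'.
Proof. by move=> h <-. Qed.

Lemma cderiv_cst c z : cderiv (fun=> c) z 0.
Proof.
exists (fun=> 0) => [w|]; first by rewrite subrr mulr0.
by split=> //; exact: cts_cst.
Qed.

Lemma cderiv_id z : cderiv id z 1.
Proof.
exists (fun=> 1) => [w|]; first by rewrite mulr1.
by split=> //; exact: cts_cst.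
Qed.

Lemma cderivD f g z l m : cderiv f z l -> cderiv g z m ->
  cderiv (fun w => f w + g w) z (l + m).
Proof.
move=> [k fk [ck <-]] [k' fk' [ck' <-]]; exists (fun w => k w + k' w) => [w|].
  by rewrite mulrDr -fk -fk'; ring.
by split=> //; apply: ctsD.
Qed.

Lemma cderivM f g z l m : cderiv f z l -> cderiv g z m ->
  cderiv (fun w => f w * g w) z (l * g z + f z * m).
Proof.
move=> hf hg; have cg := cderiv_continuous hg; move: hf hg cg.
move=> [k fk [ck <-]] [k' fk' [ck' <-]] cg.
exists (fun w => k w * g w + f z * k' w) => [w|].
  transitivity ((f w - f z) * g w + f z * (g w - g z)); first by ring.
  by rewrite fk fk'; ring.
by split=> //; apply: ctsD; apply: ctsM => //; exact: cts_cst.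
Qed.

Lemma cderivN f z l : cderiv f z l -> cderiv (fun w => - f w) z (- l).
Proof.
move=> [k fk [ck <-]]; exists (fun w => - k w) => [w|]; first by rewrite mulrN -fk; ring.
by split=> //; apply: ctsN.
Qed.

Lemma cderivB f g z l m : cderiv f z l -> cderiv g z m ->
  cderiv (fun w => f w - g w) z (l - m).
Proof. by move=> hf /cderivN; apply: cderivD. Qed.

Lemma near_neq0 f z : {for z, continuous f} -> f z != 0 -> \forall w \near z, f w != 0.
Proof.
move=> cf fz; have h : 0 < `|f z| by rewrite normr_gt0.
move/cvgrPdist_lt: cf => /(_ _ h); apply: filterS => w.
by apply: contraTneq => ->; rewrite subr0 ltxx.
Qed.

Lemma cderivV f z l : cderiv f z l -> f z != 0 ->
  cderiv (fun w => (f w)^-1) z (- l / f z ^+ 2).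
Proof.
move=> hf fz; have cf := cderiv_continuous hf; have [k fk [ck kz]] := hf.
pose k2 w := - k w / (f w * f z).
have -> : - l / f z ^+ 2 = k2 z by rewrite /k2 kz expr2.
apply: cderiv_near; rewrite /k2.
  apply: filterS (near_neq0 cf fz) => w fw.
  have -> : (w - z) * (- k w / (f w * f z)) = - (f w - f z) / (f w * f z).
    by rewrite fk; ring.
  by field; rewrite fw fz.
apply: ctsM; first exact: ctsN.
by apply: ctsV; [rewrite mulf_neq0|apply: ctsM => //; exact: cts_cst].
Qed.

Lemma cderiv_comp f g z l m : cderiv g z l -> cderiv f (g z) m ->
  cderiv (fun w => f (g w)) z (m * l).
Proof.
move=> hg; have cg := cderiv_continuous hg.
case: hg => k gk [ck <-] [k' fk [ck' <-]].
exists (fun w => k' (g w) * k w) => [w|]; first by rewrite fk gk; ring.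
split=> //; apply: ctsM => //.
exact: cts_comp.
Qed.

Lemma cderivX f z l (n : nat) : cderiv f z l -> cderiv (fun w => f w ^+ n) z (n%:R * l * f z ^+
  n.-1).
Proof.
move=> hf; elim: n => [|n IH].
  under eq_fun do rewrite expr0.
  by apply: cderiv_eq (cderiv_cst _ _) _; rewrite !mul0r.
under eq_fun do rewrite exprS; apply: cderiv_eq (cderivM hf IH) _.
case: n {IH} => [|n]; first by rewrite expr0 !mul0r mulr0 addr0 !mulr1 mul1r.
by rewrite -natr1 /= exprS; ring.
Qed.

Lemma cderiv_horner (p : {poly K}) z : cderiv (horner p) z p^`().[z].
Proof.
elim/poly_ind: p => [|p c IH].
  have -> : horner (0 : {poly K}) = fun=> 0 by apply/funext => w; rewrite horner0.
  by apply: cderiv_eq (cderiv_cst _ _) _; rewrite deriv0 horner0.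
have -> : horner (p * 'X + c%:P) = fun w => p.[w] * w + c.
  by apply/funext => w; rewrite hornerD hornerC hornerMX.
apply: cderiv_eq (cderivD (cderivM IH (cderiv_id z)) (cderiv_cst _ _)) _.
by rewrite derivMXaddC hornerD hornerMX mulr1 addr0 addrC.
Qed.

Lemma cderiv_derivable f z l : cderiv f z l -> derivable f z 1.
Proof.
move=> [k fk [ck _]]; apply/cvg_ex; exists (k z).
have h : (fun h : K => k (h + z)) @ 0^' --> k z.
  have h : {for 0, continuous (fun h : K => k (h + z))}.
    apply: cts_comp; last by rewrite add0r.
    by apply: ctsD; [exact: cts_id|exact: cts_cst].
  have {}h : k (h + z) @[h --> (0 : K)] --> k (0 + z) := h.
  rewrite add0r in h.
  by apply: cvg_trans h; apply: cvg_app; exact: cvg_within.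
apply: (cvg_trans _ h); apply: near_eq_cvg; near=> t.
have h0 : t != 0 by near: t; exact: nbhs_dnbhs_neq.
have -> : t%:A = t :> K by rewrite /GRing.scale /= mulr1.
by rewrite /= fk addrK /GRing.scale /= mulrA mulVf// mul1r.
Unshelve. all: by end_near.
Qed.

Lemma near_dist z (r : K) : 0 < r -> \forall w \near z, `|w - z| < r.
Proof. by move=> r0; move/cvgrPdistC_lt: (@cts_id z); apply. Qed.

Lemma near_norm_lt z (r : K) : `|z| < r -> \forall w \near z, `|w| < r.
Proof.
move=> zr; have r0 : 0 < r - `|z| by rewrite subr_gt0.
apply: filterS (near_dist z r0) => w transf_arg.
rewrite -[w](subrK z); apply: le_lt_trans (ler_normD _ _) _.
by rewrite -ltrBrDr.
Qed.

(** A second order estimate of the remainder suffices. *)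
Lemma cderiv_of_remainder f z l (r M : K) : `|z| < r -> 0 < M ->
  (forall w, `|w| <= r -> `|f w - f z - l * (w - z)| <= M * `|w - z| ^+ 2) ->
  cderiv f z l.
Proof.
move=> zr M0 hf; pose k w := if w == z then l else (f w - f z) / (w - z).
have kz : k z = l by rewrite /k eqxx.
rewrite -kz; apply: cderiv_near.
  apply: filterS (near_norm_lt zr) => w _; rewrite /k.
  have [->|transf_arg] := eqVneq w z; first by rewrite !subrr mul0r.
  by rewrite mulrC divfK// subr_eq0.
suff h : k w @[w --> z] --> l by move: h; rewrite -kz.
apply/(@cvgrPdistC_lt K K K (nbhs z)) => e e0.
have e1 : 0 < e / M by rewrite divr_gt0.
apply: filterS2 (near_norm_lt zr) (near_dist z e1) => w /ltW wd we; rewrite /k.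
have [_|transf_arg] := eqVneq w z; first by rewrite subrr normr0.
have wz0 : w - z != 0 by rewrite subr_eq0.
have -> : (f w - f z) / (w - z) - l = (f w - f z - l * (w - z)) / (w - z) by field.
rewrite normf_div; have nwz : 0 < `|w - z| by rewrite normr_gt0.
rewrite ltr_pdivrMr//; apply: le_lt_trans (hf _ wd) _.
by rewrite expr2 mulrA ltr_pM2r// mulrC -ltr_pdivlMr.
Qed.

End ComplexDerivative.

(** * Series of complex numbers *)

Lemma series_lincomb (K : numClosedFieldType) (u v : nat -> K) (a b x y : K) :
  series u @ \oo --> x -> series v @ \oo --> y ->
  series (fun n => a * u n + b * v n) @ \oo --> a * x + b * y.
Proof.
move=> hu hv; have -> : series (fun n => a * u n + b * v n) = (fun n => a * series u n + b *
  series v n).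
  by apply/funext => n; rewrite /series /= big_split -!mulr_sumr.
have ha : (fun n => a * series u n) @ \oo --> a * x.
  by apply: (@cvgM K nat \oo _ (fun=> a) (series u)) => //; exact: cvg_cst.
have hb : (fun n => b * series v n) @ \oo --> b * y.
  by apply: (@cvgM K nat \oo _ (fun=> b) (series v)) => //; exact: cvg_cst.
exact: (@cvgD K K nat \oo _ _ _ _ _ ha hb).
Qed.

Arguments series_lincomb {K u v} a b {x y}.

Section ComplexSeries.
Local Open Scope complex_scope.
Variable R : realType.
Local Notation C := (CC R).

Definition Rc (x : R) : C := x%:C.

Lemma Re_sub (x y : C) : complex.Re (x - y) = complex.Re x - complex.Re y.
Proof. by case: x y => [a b] [c d]. Qed.

Lemma Im_sub (x y : C) : complex.Im (x - y) = complex.Im x - complex.Im y.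
Proof. by case: x y => [a b] [c d]. Qed.

Lemma Re_sum (u : nat -> C) n : complex.Re (series u n) = series (fun k => complex.Re (u k)) n.
Proof.
rewrite /series /=; elim: n => [|n IH]; first by rewrite !big_geq.
rewrite !big_nat_recr //= -IH; by case: (\sum_(_ <= _ < _) _) (u n) => [a b] [c d].
Qed.

Lemma Im_sum (u : nat -> C) n : complex.Im (series u n) = series (fun k => complex.Im (u k)) n.
Proof.
rewrite /series /=; elim: n => [|n IH]; first by rewrite !big_geq.
rewrite !big_nat_recr //= -IH; by case: (\sum_(_ <= _ < _) _) (u n) => [a b] [c d].
Qed.

Lemma norm_Re (x : C) (r : R) : `|x| <= Rc r -> `|complex.Re x| <= r.
Proof. by move=> h; rewrite -lecR; apply: le_trans h; exact: normc_ge_Re. Qed.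

Lemma norm_Im (x : C) (r : R) : `|x| <= Rc r -> `|complex.Im x| <= r.
Proof.
move=> h; rewrite -lecR; apply: le_trans h; case: x => a b /=.
rewrite normc_def lecR /= -sqrtr_sqr ler_wsqrtr//.
by rewrite lerDr sqr_ge0.
Qed.

Lemma norm_le_ReIm (x : C) : `|x| <= Rc (`|complex.Re x| + `|complex.Im x|).
Proof.
case: x => a b; rewrite normc_def lecR /=.
rewrite -[leRHS]ger0_norm ?addr_ge0// -sqrtr_sqr ler_wsqrtr//.
rewrite sqrrD !real_normK ?num_real//.
by rewrite [leRHS]addrAC lerDl mulrn_wge0// mulr_ge0.
Qed.

Lemma Rc_pos (e : C) : 0 < e -> exists2 r : R, 0 < r & e = Rc r.
Proof.
case: e => a b; rewrite ltcE /= => /andP[/eqP -> a0]; exists a => //.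
Qed.

Lemma cvg_ReIm (u : nat -> C) (a b : R) :
  (fun n => complex.Re (u n)) @ \oo --> a -> (fun n => complex.Im (u n)) @ \oo --> b ->
  u @ \oo --> (a +i* b : C).
Proof.
move=> /cvgrPdist_lt ha /cvgrPdist_lt hb; apply/cvgrPdist_lt => e /Rc_pos[r r0 ->].
have r20 : 0 < r / 2 by rewrite divr_gt0.
near=> n; apply: le_lt_trans (norm_le_ReIm _) _; rewrite ltcR Re_sub Im_sub /=.
rewrite (splitr r); apply: ltrD; [near: n; exact: ha|near: n; exact: hb].
Unshelve. all: by end_near.
Qed.

(** The real series is compared with c / 4^n, of sum 4 c / 3. *)
Lemma geometric_dominated (x : nat -> R) (c : R) : (forall n, `|x n| <= c / 4 ^+ n) ->
  exists2 l, series x @ \oo --> l & `|l| <= c * 2.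
Proof.
move=> hx; have q1 : `|4^-1 : R| < 1 by rewrite ger0_norm// invf_lt1 ?ltr1n.
have hv := @cvg_geometric_series _ c (4^-1) q1.
have c0 : 0 <= c by have := hx 0%N; rewrite expr0 divr1; apply: le_trans.
have vE n : c / 4 ^+ n = geometric c 4^-1 n by rewrite /geometric /= exprVn.
have cn : cvgn [normed series x].
  apply: (@series_le_cvg _ _ (geometric c 4^-1)) => [n|n|n|].
  - exact: normr_ge0.
  - by rewrite -vE divr_ge0// exprn_ge0.
  - by have := hx n; rewrite vE.
  - by apply/cvg_ex; exists (c / (1 - 4^-1)).
exists (limn (series x)); first exact: normed_cvg.
apply: le_trans (lim_series_norm cn) _.
apply: (@le_trans _ _ (limn (series (geometric c 4^-1)))).
  apply: ler_lim => //; first by apply/cvg_ex; exists (c / (1 - 4^-1)).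
  by apply: nearW => n; apply: ler_sum => i _; have := hx i; rewrite vE.
rewrite (cvg_lim _ hv)//; have -> : c / (1 - 4^-1) = c * (4 / 3) by field.
by move: c0; lra.
Qed.

(** Real and imaginary parts are treated separately, each of sum at most 2 c. *)
Lemma series_dominated_cvg (u : nat -> C) (c : C) : (forall n, `|u n| <= c / 4 ^+ n) ->
  exists2 l : C, series u @ \oo --> l & `|l| <= c * 4.
Proof.
move=> hu; have c0 : 0 <= c by have := hu 0%N; rewrite expr0 divr1; apply: le_trans.
have cE : c = Rc (complex.Re c) by rewrite /Rc RRe_real// ger0_real.
set r := complex.Re c in cE.
have rE n : c / 4 ^+ n = Rc (r / 4 ^+ n).
  by rewrite cE /Rc [in RHS]rmorphM /= fmorphV /= rmorphXn /= rmorph_nat.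
have [|a ha la] := @geometric_dominated (fun n => complex.Re (u n)) r.
  by move=> n; apply: norm_Re; rewrite -rE.
have [|b hb lb] := @geometric_dominated (fun n => complex.Im (u n)) r.
  by move=> n; apply: norm_Im; rewrite -rE.
exists (a +i* b).
  apply: cvg_ReIm.
    by under eq_fun do rewrite Re_sum.
  by under eq_fun do rewrite Im_sum.
apply: le_trans (norm_le_ReIm _) _ => /=.
have -> : c * 4 = Rc (r * 4) by rewrite cE /Rc rmorphM /= rmorph_nat.
by rewrite lecR; move: la lb; lra.
Qed.

Lemma series_dominated_lim (u : nat -> C) (c : C) : (forall n, `|u n| <= c / 4 ^+ n) ->
  series u @ \oo --> limn (series u) /\ `|limn (series u)| <= c * 4.
Proof.
move=> /series_dominated_cvg[l hl nl]; suff -> : limn (series u) = l by [].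
by apply: cvg_lim => //; exact: norm_hausdorff.
Qed.

Lemma cvg_limC (u : nat -> C) (l : C) : u @ \oo --> l -> limn u = l.
Proof. by move=> h; apply: cvg_lim => //; exact: norm_hausdorff. Qed.

Lemma series_shift (u : nat -> C) (x : C) : u 0%N = 0 -> series u @ \oo --> x ->
  series (fun n => u n.+1) @ \oo --> x.
Proof.
move=> u0 hu; have -> : series (fun n => u n.+1) = [sequence series u n.+1]_n.
  by apply/funext => n; rewrite /series /= big_nat_recl// u0 add0r.
by rewrite cvg_shiftS.
Qed.

End ComplexSeries.

(** * The power series S and F *)

Section PowerSeries.
Variable R : realType.
Local Notation C := (CC R).
Implicit Types (a : nat -> C) (z w : C).

Definition powser a z : C := limn (series (fun n => a n * z ^+ n)).
(** The series differentiated term by term, without shifting the index. *)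
Definition dpowser a z : C := limn (series (fun n => a n * (n%:R * z ^+ n.-1))).

Let in_disk z := `|z| <= 8^-1.

Lemma norm_pow z n : in_disk z -> `|z ^+ n| <= 8^-1 ^+ n.
Proof. by move=> hz; rewrite normrX lerXn2r// ?nnegrE ?invr_ge0 ?ler0n. Qed.

Lemma exp8 n : 8^-1 ^+ n = (2 ^+ n)^-1 / 4 ^+ n :> C.
Proof. by rewrite exprVn -invfM -exprMn -natrM. Qed.

Lemma norm_pow4 z n : in_disk z -> `|z ^+ n| <= 1 / 4 ^+ n.
Proof.
move=> hz; apply: le_trans (norm_pow n hz) _; rewrite exp8.
by rewrite ler_wpM2r ?invr_ge0 ?exprn_ge0// invf_le1 ?exprn_gt0// exprn_ege1// ler1n.
Qed.

Lemma norm_dpow4 z n : in_disk z -> `|n%:R * z ^+ n.-1| <= 8 / 4 ^+ n.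
Proof.
move=> hz; case: n => [|n]; first by rewrite mul0r normr0 divr_ge0.
rewrite normrM ger0_norm// /=.
apply: (@le_trans _ _ (n.+1%:R * 8^-1 ^+ n)); first by rewrite ler_wpM2l ?norm_pow.
have -> : 8 / 4 ^+ n.+1 = 2 / 4 ^+ n :> C.
  by rewrite exprS; field; rewrite expf_neq0 ?pnatr_eq0.
rewrite exp8 mulrA ler_wpM2r ?invr_ge0 ?exprn_ge0// ler_pdivrMr ?exprn_gt0//.
by rewrite -exprS -natrX ler_nat ltnW// ltn_expl.
Qed.

(** The remainders satisfy D(n+1) = w D(n) + n z^(n-1) (w - z)^2.  The disk of radius
    1/8 leaves room for the factors 2^n that bound n, so that 1 / 4^n remains. *)
Lemma pow_remainder z w n : in_disk z -> in_disk w ->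
  `|w ^+ n - z ^+ n - n%:R * z ^+ n.-1 * (w - z)| <= 64 * `|w - z| ^+ 2 / 4 ^+ n.
Proof.
move=> hz hw; elim: n => [|n IH].
  by rewrite !expr0 !mul0r subr0 subrr normr0 divr1 mulr_ge0// exprn_ge0.
have -> : w ^+ n.+1 - z ^+ n.+1 - n.+1%:R * z ^+ n.+1.-1 * (w - z) =
  w * (w ^+ n - z ^+ n - n%:R * z ^+ n.-1 * (w - z)) + (n%:R * z ^+ n.-1) * (w - z) ^+ 2.
  by case: n {IH} => [|n]; rewrite -?natr1 /= ?exprS; ring.
apply: le_trans (ler_normD _ _) _; rewrite normrM [X in _ + X]normrM normrX.
have -> : 64 * `|w - z| ^+ 2 / 4 ^+ n.+1 =
  8^-1 * (64 * `|w - z| ^+ 2 / 4 ^+ n) + (8 / 4 ^+ n) * `|w - z| ^+ 2.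
  by rewrite [4 ^+ n.+1]exprS; field; rewrite expf_neq0 ?pnatr_eq0.
apply: lerD; first exact: ler_pM.
by rewrite ler_wpM2r ?exprn_ge0// norm_dpow4.
Qed.

Section BoundedCoefficients.
Variable a : nat -> C.
Hypothesis ha : forall n, `|a n| <= 1.

Lemma powser_converges z : in_disk z -> series (fun n => a n * z ^+ n) @ \oo --> powser a z.
Proof.
move=> hz; apply: (@series_dominated_lim R _ 1 _).1 => n.
by rewrite normrM -[leRHS]mul1r; apply: ler_pM => //; exact: norm_pow4.
Qed.

Lemma dpowser_converges z : in_disk z ->
  series (fun n => a n * (n%:R * z ^+ n.-1)) @ \oo --> dpowser a z.
Proof.
move=> hz; apply: (@series_dominated_lim R _ 8 _).1 => n.
by rewrite normrM -[leRHS]mul1r; apply: ler_pM => //; exact: norm_dpow4.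
Qed.

Lemma powser_remainder z w : in_disk z -> in_disk w ->
  `|powser a w - powser a z - dpowser a z * (w - z)| <= 64 * `|w - z| ^+ 2 * 4.
Proof.
move=> hz hw.
have h1 := series_lincomb 1 (-1) (powser_converges hw) (powser_converges hz).
have h2 := series_lincomb 1 (- (w - z)) h1 (dpowser_converges hz).
have [] := @series_dominated_lim R (fun n => 1 * (1 * (a n * w ^+ n) + -1 * (a n * z ^+ n)) +
    - (w - z) * (a n * (n%:R * z ^+ n.-1))) (64 * `|w - z| ^+ 2).
  move=> n; have -> : 1 * (1 * (a n * w ^+ n) + -1 * (a n * z ^+ n)) +
    - (w - z) * (a n * (n%:R * z ^+ n.-1)) =
    a n * (w ^+ n - z ^+ n - n%:R * z ^+ n.-1 * (w - z)) by ring.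
  by rewrite normrM -[leRHS]mul1r; apply: ler_pM => //; exact: pow_remainder.
rewrite (cvg_limC h2) => _; congr (`|_| <= _); ring.
Qed.

Lemma cderiv_powser z : `|z| < 8^-1 -> cderiv (powser a) z (dpowser a z).
Proof.
move=> hz; apply: (@cderiv_of_remainder C _ _ _ 8^-1 256) => // w hw.
apply: le_trans (powser_remainder (ltW hz) hw) _.
by rewrite le_eqVlt; apply/orP; left; apply/eqP; ring.
Qed.

End BoundedCoefficients.

Lemma powser0 a : powser a 0 = a 0%N.
Proof.
apply: cvg_limC; rewrite -cvg_shiftS.
have -> : [sequence series (fun n => a n * 0 ^+ n) n.+1]_n = (fun _ : nat => a 0%N).
  apply/funext => n; rewrite /series /= big_nat_recl// expr0 mulr1 big1 ?addr0// => i _.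
  by rewrite expr0n /= mulr0.
exact: cvg_cst.
Qed.

(** The coefficients of S = (1 - z)^(-1/2). *)
Definition coefS n : C := rising (1 / 2) n / n`!%:R.
(** The coefficients of 2F1(1/2, 1/6; 7/6), by (1/6)_n / (7/6)_n = 1 / (6 n + 1). *)
Definition coefF n : C := coefS n / (6 * n + 1)%:R.

Lemma coefS_rec n : n.+1%:R * coefS n.+1 = (n%:R + 1 / 2) * coefS n.
Proof.
rewrite /coefS /rising big_ord_recr /= factS natrM.
have n0 : n.+1%:R != 0 :> C by rewrite pnatr_eq0.
have f0 : n`!%:R != 0 :> C by rewrite pnatr_eq0 -lt0n fact_gt0.
move: (\prod_(i < n) _) (n.+1%:R : C) (n`!%:R : C) (n%:R : C) n0 f0 => x u v t u0 v0.
by field; rewrite v0 u0.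
Qed.

Lemma coefS_bound n : 0 <= coefS n <= 1.
Proof.
elim: n => [|n /andP[IH0 IH1]].
  by rewrite /coefS /rising big_ord0 divr1 ler01 lexx.
have n0 : 0 < n.+1%:R :> C by rewrite ltr0n.
have e : coefS n.+1 = (n%:R + 1 / 2) / n.+1%:R * coefS n.
  by apply: (mulfI (lt0r_neq0 n0)); rewrite coefS_rec;
    move: (n.+1%:R : C) (n%:R : C) (coefS n) n0 => u v s /lt0r_neq0 u0; field.
have h0 : 0 <= (n%:R + 1 / 2) / n.+1%:R :> C by rewrite divr_ge0 ?addr_ge0 ?divr_ge0.
rewrite e mulr_ge0//=; apply: mulr_ile1 => //; rewrite ler_pdivrMr// [leRHS]mul1r -[leRHS]natr1.
by apply: lerD => //; rewrite mul1r invf_le1// ler1n.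
Qed.

Lemma coefS_norm n : `|coefS n| <= 1.
Proof. by have /andP[h0 h1] := coefS_bound n; rewrite ger0_norm. Qed.

Lemma coefF_norm n : `|coefF n| <= 1.
Proof.
rewrite /coefF normf_div ger0_norm ?[`|_%:R|]ger0_norm//; last first.
  by have /andP[] := coefS_bound n.
have h : (1 : C) <= (6 * n + 1)%:R by rewrite ler1n addn1.
have /andP[_ h1] := coefS_bound n.
rewrite ler_pdivrMr ?mul1r; first exact: le_trans h1 h.
exact: lt_le_trans ltr01 h.
Qed.

Lemma hyp2F1_powser z : hyp2F1 (1 / 2) (1 / 6) (7 / 6) z = powser coefF z.
Proof.
rewrite /hyp2F1 /powser; congr (limn (series _)); apply/funext => n; congr (_ * _).
have pos (x : C) k : 0 < x -> rising x k != 0.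
  move=> x0; apply: lt0r_neq0; rewrite /rising; apply: prodr_gt0 => i _.
  by rewrite ltr_wpDr.
have h1 : rising (1 / 6 : C) n.+1 = rising (1 / 6) n * (1 / 6 + n%:R).
  by rewrite /rising big_ord_recr.
have h2 : rising (1 / 6 : C) n.+1 = 1 / 6 * rising (7 / 6) n.
  rewrite /rising big_ord_recl addr0; congr (_ * _); apply: eq_bigr => i _.
  by rewrite /= /bump /= natrD; field.
have h3 : rising (7 / 6 : C) n = (6 * n + 1)%:R * rising (1 / 6) n.
  have -> : rising (7 / 6 : C) n = 6 * (1 / 6 * rising (7 / 6) n) by field.
  by rewrite -h2 h1 natrD natrM; field.
have r0 : rising (1 / 6 : C) n != 0 by apply: pos; rewrite divr_gt0.
have f0 : n`!%:R != 0 :> C by rewrite pnatr_eq0 -lt0n fact_gt0.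
have n0 : (6 * n + 1)%:R != 0 :> C by rewrite pnatr_eq0 addn1.
rewrite h3 /coefF /coefS.
move: (rising (1 / 2) n) (rising (1 / 6) n) (n`!%:R : C) ((6 * n + 1)%:R : C) r0 f0 n0 => x u v t
  u0 v0 t0.
by field; rewrite u0 v0 t0.
Qed.

(** 6 n + 1 is the denominator of the n-th coefficient of F. *)
Lemma powserF_ode z : in_disk z -> 6 * z * dpowser coefF z + powser coefF z = powser coefS z.
Proof.
move=> hz.
have h := series_lincomb (6 * z) 1 (dpowser_converges coefF_norm hz) (powser_converges coefF_norm
  hz).
rewrite mul1r in h; rewrite -(cvg_limC h); congr (limn (series _)); apply/funext => n.
have n0 : (6 * n + 1)%:R != 0 :> C by rewrite pnatr_eq0 addn1.
rewrite /coefF; case: n n0 => [|n] n0; first by rewrite mul0r !mulr0 add0r mul1r divr1.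
transitivity (coefS n.+1 / (6 * n.+1 + 1)%:R * z ^+ n.+1 * (6 * n.+1 + 1)%:R).
  by rewrite natrD natrM /= exprS; ring.
by move: (coefS n.+1) (z ^+ n.+1) ((6 * n.+1 + 1)%:R : C) n0 => x u v v0; field.
Qed.

(** The recursion (n + 1) a(n+1) = (n + 1/2) a(n). *)
Lemma powserS_ode z : in_disk z -> 2 * (1 - z) * dpowser coefS z = powser coefS z.
Proof.
move=> hz; have h := dpowser_converges coefS_norm hz.
have h1 := series_shift _ h; rewrite mul0r mulr0 in h1.
have h2 := series_lincomb 2 (- (2 * z)) (h1 erefl) h.
have -> : 2 * (1 - z) * dpowser coefS z = 2 * dpowser coefS z + - (2 * z) * dpowser coefS z by ring.
rewrite -(cvg_limC h2); congr (limn (series _)); apply/funext => n /=.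
transitivity (2 * (n.+1%:R * coefS n.+1) * z ^+ n - 2 * n%:R * coefS n * z ^+ n).
  by case: n => [|n]; rewrite /= ?exprS; ring.
by rewrite coefS_rec; field.
Qed.

End PowerSeries.

(** * The hypergeometric transformation *)

Section ZeroDerivative.
Local Open Scope complex_scope.
Variable R : realType.
Local Notation C := (CC R).

Lemma ray_continuous (z : C) (t : R) : {for t, continuous (fun x : R => Rc x * z)}.
Proof.
have [->|z0] := eqVneq z 0.
  have -> : (fun x : R => Rc x * 0) = (fun=> 0 : C) by apply/funext => x; rewrite mulr0.
  exact: cst_continuous.
have nz : 0 < `|z| by rewrite normr_gt0.
suff h : (fun x : R => Rc x * z) @ t --> Rc t * z by exact: h.
apply/cvgrPdist_lt => e e0.
have [d d0 dE] : exists2 d : R, 0 < d & e / `|z| = Rc d by apply: Rc_pos; rewrite divr_gt0.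
have h : (fun x : R => x) @ t --> t by exact: cvg_id.
move/cvgrPdist_lt: h => /(_ d d0); apply: filterS => x xd.
rewrite -mulrBl normrM -ltr_pdivlMr// dE /Rc -rmorphB /= normc_def /= expr0n /= addr0 sqrtr_sqr.
by rewrite ltcR.
Qed.

(** The mean value theorem for the real function t |-> L (U (t z)) on [0, 1], where L is
    the real or the imaginary part. *)
Lemma zero_derivative_ray (L : C -> R) (U : C -> C) (z : C) :
  (forall x y, L (x - y) = L x - L y) -> (forall (t : R) x, L (Rc t * x) = t * L x) ->
  (forall x (r : R), `|x| <= Rc r -> `|L x| <= r) ->
  (forall t : R, 0 <= t <= 1 -> cderiv U (Rc t * z) 0) -> L (U z) = L (U 0).
Proof.
move=> LB LZ Lle hU; pose h (t : R) := L (U (Rc t * z)).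
have dh (t : R) : 0 <= t <= 1 -> is_derive t 1 h 0.
  move=> t01; have [k Uk [ck k0]] := hU t t01.
  apply/is_derive1_caratheodory; exists (fun x => L (z * k (Rc x * z))).
  have RcB (x : R) : Rc x * z - Rc t * z = Rc (x - t) * z by rewrite -mulrBl /Rc rmorphB.
  have L0 : L 0 = 0 by rewrite -(subrr (0 : C)) LB subrr.
  split.
  - by move=> x; rewrite /h -LB Uk RcB -mulrA LZ mulrC.
  - suff hk : (fun x => L (z * k (Rc x * z))) @ t --> L (z * k (Rc t * z)) by exact: hk.
    rewrite k0 mulr0 L0; apply/cvgrPdistC_lt => e e0.
    have e20 : 0 < Rc (e / 2) by rewrite ltcR divr_gt0.
    have czk : {for Rc t * z, continuous (fun w : C => z * k w)}.
      exact: (@ctsM (CC R) (fun=> z) k (Rc t * z) (@cts_cst (CC R) z _) ck).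
    have : {for t, continuous (fun x : R => z * k (Rc x * z))}.
      exact: (@continuous_comp _ _ _ (fun x : R => Rc x * z) (fun w : C => z * k w) t
        (@ray_continuous z t) czk).
    move/cvgrPdistC_lt => /(_ _ e20); apply: filterS => x.
    rewrite k0 mulr0 !subr0 => /ltW/Lle hx; apply: le_lt_trans hx _.
    by rewrite ltr_pdivrMr// mulr2n mulrDr mulr1 ltrDl.
  - by rewrite k0 mulr0.
have [||c _] := @MVT R h (fun=> 0) 0 1 ltr01.
- by move=> x /[!in_itv] /= /andP[x0 x1]; apply: dh; rewrite !ltW.
- apply: derivable_within_continuous => x; rewrite in_itv /= => x01.
  by case: (dh x x01).
rewrite mul0r /h /Rc rmorph0 rmorph1 mul0r mul1r => /eqP.
by rewrite subr_eq0 => /eqP.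
Qed.

Lemma cderiv0_cst (U : C -> C) (r : C) : (forall z, `|z| < r -> cderiv U z 0) ->
  forall z, `|z| < r -> U z = U 0.
Proof.
move=> hU z zr.
have ray (t : R) : 0 <= t <= 1 -> cderiv U (Rc t * z) 0.
  move=> /andP[t0 t1]; apply: hU; apply: le_lt_trans zr; rewrite normrM.
  rewrite -[leRHS]mul1r ler_wpM2r//.
  by rewrite /Rc normc_def /= expr0n /= addr0 sqrtr_sqr ger0_norm// lecR.
have eRe : complex.Re (U z) = complex.Re (U 0).
  apply: (@zero_derivative_ray (@complex.Re R)) => //.
  - exact: Re_sub.
  - by move=> t [a b]; rewrite /= mul0r subr0.
  - exact: norm_Re.
have eIm : complex.Im (U z) = complex.Im (U 0).
  apply: (@zero_derivative_ray (@complex.Im R)) => //.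
  - exact: Im_sub.
  - by move=> t [a b]; rewrite /= mul0r addr0.
  - exact: norm_Im.
by move: eRe eIm; case: (U z) (U 0) => [a b] [c d] /= -> ->.
Qed.

End ZeroDerivative.

Section Transformation.
Variable K : numClosedFieldType.
Variables (S F dS dF : K -> K) (r : K).
Hypothesis r0 : 0 < r.
Hypothesis r1 : r <= 1.
Hypothesis hS : forall z, `|z| < r -> cderiv S z (dS z).
Hypothesis hF : forall z, `|z| < r -> cderiv F z (dF z).
Hypothesis S0 : S 0 = 1.
Hypothesis odeS : forall z : K, `|z| < r -> 2 * (1 - z) * dS z = S z.
Hypothesis odeF : forall z : K, `|z| < r -> 6 * z * dF z + F z = S z.
Hypothesis cst_of_cderiv0 : forall (U : K -> K) (e : K), (forall z, `|z| < e -> cderiv U z 0) ->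
  forall z, `|z| < e -> U z = U 0.

(** S^2 (1 - z) has derivative S (2 (1 - z) S' - S) = 0. *)
Lemma S_square (z : K) : `|z| < r -> S z ^+ 2 * (1 - z) = 1.
Proof.
move=> zr; transitivity (S 0 ^+ 2 * (1 - 0)); last by rewrite S0 expr1n mul1r subr0.
apply: (cst_of_cderiv0 (U := fun z => S z ^+ 2 * (1 - z))) zr => {}z zr.
have d1 := cderivM (cderivX 2 (hS zr)) (cderivB (cderiv_cst 1 z) (cderiv_id z)).
apply: cderiv_eq d1 _; rewrite -(odeS zr); ring.
Qed.

Variables (p1 q1 : {poly K}) (mu0 : K).
Hypothesis p10 : p1.[0] != 0.
Hypothesis q10 : q1.[0] != 0.
Hypothesis mu0E : mu0 = p1.[0] / q1.[0].
Hypothesis ode : forall z : K, p1.[0] * ((1 - z) *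
    (p1.[z] * q1.[z] - 3 * z * (p1^`().[z] * q1.[z] - p1.[z] * q1^`().[z])) ^+ 2) =
  q1.[0] * (q1.[z] * (p1.[z] ^+ 3 - z * q1.[z] ^+ 3)).

(** M(z) = mu(1/z), for p1 and q1 the reversed numerator and denominator of mu. *)
Definition mu_inv z := p1.[z] / q1.[z].
Definition dmu_inv z := (p1^`().[z] * q1.[z] - p1.[z] * q1^`().[z]) / q1.[z] ^+ 2.
(** S(1 - M / mu0) = (M / mu0)^(-1/2): the series S itself provides the branch of the
    square root with value 1 at 0. *)
Definition sqrt_arg z := 1 - mu_inv z / mu0.
Definition inv_sqrt_mu z := S (sqrt_arg z).
(** If z = x^(-3), this is the same coordinate at phi(x, y), because
    x o phi = x mu(x^3). *)
Definition transf_arg z := z / mu_inv z ^+ 3.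
(** f' / mu in the variable z; it is also z w' / w for w = z / M^3. *)
Definition euler_factor z := 1 - 3 * z * dmu_inv z / mu_inv z.

Let good (z : K) := [/\ `|z| < r, p1.[z] != 0, q1.[z] != 0,
  `|sqrt_arg z| < r & `|transf_arg z| < r].

Let mu0_neq0 : mu0 != 0.
Proof. by rewrite mu0E mulf_neq0 ?invr_eq0. Qed.

Let M0 : mu_inv 0 = mu0.
Proof. by rewrite mu0E. Qed.

Let u0 : sqrt_arg 0 = 0.
Proof. by rewrite /sqrt_arg M0 divff// subrr. Qed.

Let w0 : transf_arg 0 = 0.
Proof. by rewrite /transf_arg mul0r. Qed.

Lemma cderiv_mu_inv z : q1.[z] != 0 -> cderiv mu_inv z (dmu_inv z).
Proof.
move=> qz; apply: cderiv_eq (cderivM (cderiv_horner p1 z) (cderivV (cderiv_horner q1 z) qz)) _.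
by rewrite /dmu_inv; field.
Qed.

Lemma cderiv_sqrt_arg z : q1.[z] != 0 -> cderiv sqrt_arg z (- dmu_inv z / mu0).
Proof.
move=> qz; apply: cderiv_eq (cderivB (cderiv_cst 1 z) (cderivM (cderiv_mu_inv qz) (cderiv_cst
  mu0^-1 z))) _.
by ring.
Qed.

Lemma mu_inv_neq0 z : p1.[z] != 0 -> q1.[z] != 0 -> mu_inv z != 0.
Proof. by move=> pz qz; rewrite mulf_neq0 ?invr_eq0. Qed.

Lemma cderiv_transf_arg z : p1.[z] != 0 -> q1.[z] != 0 ->
  cderiv transf_arg z (euler_factor z / mu_inv z ^+ 3).
Proof.
move=> pz qz; have Mn := mu_inv_neq0 pz qz.
have M3 : mu_inv z ^+ 3 != 0 by rewrite expf_neq0.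
apply: cderiv_eq (cderivM (cderiv_id z) (cderivV (cderivX 3 (cderiv_mu_inv qz)) M3)) _.
by rewrite /euler_factor; field.
Qed.

Lemma near_good : \forall z \near (0 : K), good z.
Proof.
have cp : {for 0, continuous (horner p1)} := cderiv_continuous (cderiv_horner p1 0).
have cq : {for 0, continuous (horner q1)} := cderiv_continuous (cderiv_horner q1 0).
have cu : {for 0, continuous sqrt_arg} := cderiv_continuous (cderiv_sqrt_arg q10).
have cw : {for 0, continuous transf_arg} := cderiv_continuous (cderiv_transf_arg p10 q10).
have near_small (f : K -> K) : {for 0, continuous f} -> f 0 = 0 ->
    \forall z \near (0 : K), `|f z| < r.
  move=> cf f0; move/cvgrPdistC_lt: cf => /(_ _ r0); apply: filterS => z.
  by rewrite f0 subr0.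
have h1 := near_small _ (@cts_id K 0) erefl.
have h2 := near_small _ cu u0; have h3 := near_small _ cw w0.
have h4 := near_neq0 cp p10; have h5 := near_neq0 cq q10.
have h6 : \forall z \near (0 : K), `|sqrt_arg z| < r /\ `|transf_arg z| < r by apply: filterS2 h2
  h3.
have h7 : \forall z \near (0 : K), p1.[z] != 0 /\ q1.[z] != 0 by apply: filterS2 h4 h5.
by apply: filterS3 h1 h6 h7 => z zr [ur wr] [pz qz]; split.
Qed.

Lemma inv_sqrt_mu_square z : good z -> inv_sqrt_mu z ^+ 2 * mu_inv z = mu0.
Proof.
move=> [_ _ _ ur _]; have := S_square ur; rewrite -/(inv_sqrt_mu z) => e.
transitivity (inv_sqrt_mu z ^+ 2 * (1 - sqrt_arg z) * mu0); last by rewrite e mul1r.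
by rewrite /sqrt_arg; field.
Qed.

(** From g^2 M = mu0. *)
Definition dinv_sqrt_mu z := - inv_sqrt_mu z * dmu_inv z / (2 * mu_inv z).

Lemma cderiv_inv_sqrt_mu z : good z -> cderiv inv_sqrt_mu z (dinv_sqrt_mu z).
Proof.
move=> [_ pz qz ur _]; have Mn := mu_inv_neq0 pz qz.
apply: cderiv_eq (cderiv_comp (cderiv_sqrt_arg qz) (hS ur)) _.
rewrite /dinv_sqrt_mu /inv_sqrt_mu -(odeS ur) {2}/sqrt_arg; by field; rewrite Mn mu0_neq0.
Qed.

Lemma inv_sqrt_mu0 : inv_sqrt_mu 0 = 1.
Proof. by rewrite /inv_sqrt_mu u0 S0. Qed.

(** The right-hand side of the equation 6 z G' + G = g rho S(w) satisfied by
    G = g F(w), where w = z / M^3 and rho = z w' / w. *)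
Definition transf_S z := inv_sqrt_mu z * euler_factor z * S (transf_arg z).

(** The differential equation of mu reads (1 - z) (g rho)^2 = 1 - w. *)
Lemma transf_S_square z : good z -> transf_S z ^+ 2 * (1 - z) = 1.
Proof.
move=> gd; have [_ pz qz _ wr] := gd; have Mn := mu_inv_neq0 pz qz.
have gM := inv_sqrt_mu_square gd; have Sw := S_square wr.
have M3 : mu_inv z ^+ 3 != 0 by rewrite expf_neq0.
have odeM : mu0 * ((1 - z) * (mu_inv z * euler_factor z) ^+ 2) = mu_inv z ^+ 3 - z.
  have -> : mu_inv z * euler_factor z = mu_inv z - 3 * z * dmu_inv z by rewrite /euler_factor;
    field.
  have := ode z; rewrite mu0E /mu_inv /dmu_inv => e.
  have -> : p1.[z] / q1.[z] - 3 * z * ((p1^`().[z] * q1.[z] - p1.[z] * q1^`().[z]) / q1.[z] ^+ 2) =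
     (p1.[z] * q1.[z] - 3 * z * (p1^`().[z] * q1.[z] - p1.[z] * q1^`().[z])) / q1.[z] ^+ 2 by field.
  move: (p1.[z] * q1.[z] - 3 * z * (p1^`().[z] * q1.[z] - p1.[z] * q1^`().[z])) e => L e.
  transitivity (p1.[0] * ((1 - z) * L ^+ 2) / (q1.[0] * q1.[z] ^+ 4)); first by field;
    rewrite qz q10.
  by rewrite e; field; rewrite qz q10.
have e1 : (inv_sqrt_mu z * euler_factor z) ^+ 2 * (1 - z) = 1 - transf_arg z.
  apply: (mulIf M3); rewrite /transf_arg mulrBl mul1r divfK// -odeM -gM; ring.
transitivity (S (transf_arg z) ^+ 2 * ((inv_sqrt_mu z * euler_factor z) ^+ 2 * (1 - z)));
  first by rewrite /transf_S; ring.
by rewrite e1.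
Qed.

(** Both sides have the same square and the value 1 at 0, and they are continuous. *)
Lemma near_transf_S : \forall z \near (0 : K), transf_S z = S z.
Proof.
have cq : {for 0, continuous (horner q1)} := cderiv_continuous (cderiv_horner q1 0).
have cM : {for 0, continuous mu_inv} := cderiv_continuous (cderiv_mu_inv q10).
have cpoly (p : {poly K}) : {for 0, continuous (horner p)} := cderiv_continuous (cderiv_horner p 0).
have cdM : {for 0, continuous dmu_inv}.
  apply: ctsM; first by apply: ctsB; apply: ctsM; exact: cpoly.
  apply: ctsV; first by rewrite expf_neq0.
  exact: cderiv_continuous (cderivX 2 (cderiv_horner q1 0)).
have cg : {for 0, continuous inv_sqrt_mu}.
  apply: cderiv_continuous (cderiv_inv_sqrt_mu _); exact: nbhs_singleton near_good.
have cS (z : K) : `|z| < r -> {for z, continuous S} by move=> zr; exact: cderiv_continuous (hS zr).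
have n0 : `|0 : K| < r by rewrite normr0.
have crho : {for 0, continuous euler_factor}.
  apply: ctsB; first exact: cts_cst.
  apply: ctsM; last by apply: ctsV => //; rewrite M0.
  by apply: ctsM => //; apply: ctsM; [exact: cts_cst|exact: cts_id].
have cw : {for 0, continuous transf_arg} := cderiv_continuous (cderiv_transf_arg p10 q10).
have cT : {for 0, continuous (fun z => transf_S z + S z)}.
  apply: ctsD; last exact: cS.
  apply: ctsM; first exact: ctsM.
  by apply: cts_comp => //; apply: cS; rewrite w0.
have T0 : transf_S 0 + S 0 != 0.
  rewrite /transf_S inv_sqrt_mu0 w0 S0 /euler_factor !(mulr0, mul0r) subr0 !mulr1.
  by rewrite -(natrD _ 1 1) pnatr_eq0.
apply: filterS2 near_good (near_neq0 cT T0) => z gd Tn.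
have [zr _ _ _ _] := gd.
have z1 : 1 - z != 0.
  rewrite subr_eq0; apply/eqP => z1; move: zr; rewrite -z1 normr1 => h.
  by have := lt_le_trans h r1; rewrite ltxx.
have : (transf_S z - S z) * (transf_S z + S z) = 0.
  apply: (mulIf z1); rewrite mul0r.
  transitivity (transf_S z ^+ 2 * (1 - z) - S z ^+ 2 * (1 - z)); first by ring.
  by rewrite transf_S_square// S_square// subrr.
by move/eqP; rewrite mulf_eq0 (negPf Tn) orbF subr_eq0 => /eqP.
Qed.

Lemma hypergeometric_transformation : \forall z \near (0 : K),
  F z = inv_sqrt_mu z * F (transf_arg z).
Proof.
have [e /= e0 he] : exists2 e : K, 0 < e & forall z, `|z| < e -> good z /\ transf_S z = S z.
  have : \forall z \near (0 : K), good z /\ transf_S z = S z by apply: filterS2 near_good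
    near_transf_S.
  move=> /nbhs_normP[e e0 he].
  by exists e => // z ze; apply: he; rewrite /= /ball_ /= sub0r normrN.
pose H z := inv_sqrt_mu z * F (transf_arg z) - F z.
have dH z : `|z| < e -> exists2 d, cderiv H z d & 6 * z * d + H z = 0.
  move=> /he[gd TS]; have [zr pz qz ur wr] := gd; have Mn := mu_inv_neq0 pz qz.
  have d1 := cderivM (cderiv_inv_sqrt_mu gd) (cderiv_comp (cderiv_transf_arg pz qz) (hF wr)).
  eexists; first exact: cderivB d1 (hF zr).
  have M3 : mu_inv z ^+ 3 != 0 by rewrite expf_neq0.
  rewrite /H; transitivity (transf_S z - S z); last by rewrite TS subrr.
  rewrite /transf_S -(odeF wr) -(odeF zr).
  move: (F (transf_arg z)) (dF (transf_arg z)) => a b;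
    rewrite /dinv_sqrt_mu /transf_arg /euler_factor; by field.
(* The sixth power avoids the multivalued z^(1/6) H. *)
have H0 z : `|z| < e -> z * H z ^+ 6 = 0.
  move=> ze; rewrite (cst_of_cderiv0 (U := fun z => z * H z ^+ 6) _ ze) ?mul0r// => {}z {}ze.
  have [d hd e6] := dH z ze.
  apply: cderiv_eq (cderivM (cderiv_id z) (cderivX 6 hd)) _.
  transitivity (H z ^+ 5 * (6 * z * d + H z)); first by rewrite /=; ring.
  by rewrite e6 mulr0.
have ne : `|0 : K| < e by rewrite normr0.
apply: filterS (near_norm_lt ne) => z ze.
have [->|z0] := eqVneq z 0; first by rewrite w0 inv_sqrt_mu0 mul1r.
have /eqP := H0 z ze; by rewrite mulf_eq0 (negPf z0) expf_eq0 /= subr_eq0 => /eqP.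
Qed.

End Transformation.

(** * Behaviour of mu at infinity *)

Section MuAtInfinity.
Variable K : numClosedFieldType.
Variables (p q : {poly K}) (n : nat).
Hypothesis sp : size p = n.+1.
Hypothesis sq : size q = n.+1.
Local Notation p1 := (revp n p).
Local Notation q1 := (revp n q).

Lemma revp0_neq0 (b : {poly K}) : size b = n.+1 -> (revp n b).[0] != 0.
Proof. by move=> sb; rewrite horner_revp0 -[n]/(n.+1.-1) -sb -lead_coefE lead_coef_eq0
  -size_poly_eq0 sb. Qed.

Lemma fracval_inv (z : K) : z != 0 -> fracval p q z^-1 = mu_inv p1 q1 z.
Proof.
move=> z0; rewrite /mu_inv !horner_revp ?sp ?sq// /fracval -mulf_div divff ?mul1r//.
by rewrite expf_neq0.
Qed.

Lemma mu_limit : fracval p q s @[s --> infty_nbhs K] --> p1.[0] / q1.[0].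
Proof.
have cM : {for 0, continuous (mu_inv p1 q1)} := cderiv_continuous (cderiv_mu_inv p1 (revp0_neq0
  sq)).
move=> A hA; have := cM A hA => /nbhs_normP[e /= e0 he].
exists e^-1; first by rewrite realV gtr0_real.
move=> s se; have s0 : s != 0.
  by rewrite -normr_gt0; apply: lt_trans se; rewrite invr_gt0.
have := he s^-1; rewrite /ball_ /= sub0r normrN normfV => h.
have : A (mu_inv p1 q1 s^-1).
  by apply: h; rewrite invf_plt// posrE normr_gt0.
by rewrite -fracval_inv ?invr_eq0// invrK.
Qed.

End MuAtInfinity.

Theorem theorem3p1 (R : realType) (phi : E2 (CC R) -> E2 (CC R)) (d : nat) :
  isogeny phi ->
  (exists P : E2 (CC R), phi P <> E2_zero (CC R)) ->
  has_degree phi d ->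
  exists (p q : {poly CC R}) (mu0 : CC R),
    let mu := fracval p q in
    [/\ q != 0 /\ coprimep p q,
        transforms_x phi p q,
        (mu s @[s --> infty_nbhs (CC R)] --> mu0) /\ mu0 != 0,
        exists g : CC R -> CC R,
          inv_sqrt_branch (fun z => mu z^-1 / mu0) g /\
          \forall z \near (0 : CC R),
            hyp2F1 (1 / 2) (1 / 6) (7 / 6) z =
            g z * hyp2F1 (1 / 2) (1 / 6) (7 / 6) (z / mu z^-1 ^+ 3)
      & ratfun_degree (fun z => z / mu z^-1 ^+ 3) d].
Proof.
move=> isog nz hd.
have [P [Q [T [n [[cPQ Q0 n0 sQP curve] generic]]]]] := isogeny_structure isog nz.
have P0 : P != 0 by rewrite -size_poly_gt0 (leq_trans _ sQP).
have [sP inv] := invdiff_of_curve cPQ n0 Q0 sQP curve.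
have [p [q [q0 cpq PQpq]]] := invdiff_cubic Q0 sP inv.
have [spq mueq] := mu_equation_of_invdiff P0 Q0 q0 sP inv PQpq.
have p0 : p != 0 by rewrite -size_poly_eq0 spq size_poly_eq0.
(* Otherwise P^3 = Q^3, while P has larger degree than Q. *)
have T0 : T != 0.
  apply: contraTneq sQP => T0; move/eqP: curve.
  rewrite T0 expr0n mulr0 mul0r eq_sym mulf_eq0 expf_eq0 /= (negPf n0) /= subr_eq0 => /eqP e.
  have := size_exp P 3; rewrite e size_exp => /eqP.
  rewrite eqn_pmul2r// => /eqP h.
  move: P0 Q0 h; rewrite -!size_poly_gt0; move: (size P) (size Q) => a b; clear; lia.
have [k sp] : exists k, size p = k.+1.
  by exists (size p).-1; rewrite prednK// size_poly_gt0.
have sq : size q = k.+1 by rewrite -spq.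
set p1 := revp k p; set q1 := revp k q.
have p10 : p1.[0] != 0 := revp0_neq0 sp.
have q10 : q1.[0] != 0 := revp0_neq0 sq.
have lp : lead_coef p = p1.[0] by rewrite lead_coefE sp horner_revp0.
have lq : lead_coef q = q1.[0] by rewrite lead_coefE sq horner_revp0.
pose mu0 := p1.[0] / q1.[0].
have mu00 : mu0 != 0 by rewrite mulf_neq0 ?invr_eq0.
have ode (z : CC R) : p1.[0] * ((1 - z) *
    (p1.[z] * q1.[z] - 3 * z * (p1^`().[z] * q1.[z] - p1.[z] * q1^`().[z])) ^+ 2) =
  q1.[0] * (q1.[z] * (p1.[z] ^+ 3 - z * q1.[z] ^+ 3)).
  by rewrite -lp -lq; exact: mu_equation_revp.
exists p, q, mu0 => mu; split => //.
- move=> a; case Ea: (val a) => [[x y]|//].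
  have aO : a <> E2_zero _ by move=> e; rewrite e in Ea.
  have xa : xc a = x by rewrite /xc Ea.
  have [h1 h2] := isogeny_exact isog cPQ generic aO.
  have poles := cubic_fraction_poles x cPQ cpq PQpq; rewrite xa in h1 h2.
  case Eb: (val (phi a)) => [[x' y']|]; last first.
    by apply/eqP; rewrite -poles h1//; exact: E2_eq_zero.
  have bO : phi a <> E2_zero _ by move=> e; rewrite e in Eb.
  have [Qx ex] := h2 bO; have qx : q.[x ^+ 3] != 0 by rewrite -poles.
  split=> //; rewrite (_ : xc (phi a) = x') in ex; last by rewrite /xc Eb.
  have := congr1 (fun r : {poly CC R} => r.[x]) PQpq.
  rewrite !hornerM !horner_comp !hornerXn hornerX -ex => e.
  apply: (mulIf qx); rewrite /fracval mulrA divfK//; apply: (mulfI Qx).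
  by rewrite -e; ring.
- by split=> //; exact: mu_limit.
- have r0 : 0 < 8^-1 :> CC R by rewrite invr_gt0 ltr0n.
  have r1 : 8^-1 <= 1 :> CC R by rewrite invf_le1 ?ltr0n// ler1n.
  have hS := @cderiv_powser R (@coefS R) (@coefS_norm R).
  have hF := @cderiv_powser R (@coefF R) (@coefF_norm R).
  have S0 : powser (@coefS R) 0 = 1.
    by rewrite powser0 /coefS /rising big_ord0 fact0 divr1.
  have oS z : `|z| < 8^-1 -> 2 * (1 - z) * dpowser (@coefS R) z = powser (@coefS R) z.
    by move=> /ltW; exact: powserS_ode.
  have oF z : `|z| < 8^-1 -> 6 * z * dpowser (@coefF R) z + powser (@coefF R) z = powser (@coefS R) z.
    by move=> /ltW; exact: powserF_ode.
  have good := near_good r0 p10 q10 (erefl mu0).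
  exists (inv_sqrt_mu (powser (@coefS R)) p1 q1 mu0); split.
    split.
    + apply: filterS good => z gd; apply: cderiv_derivable.
      exact: (cderiv_inv_sqrt_mu hS oS p10 q10 (erefl mu0) gd).
    + exact: inv_sqrt_mu0.
    + apply: filterS good => z gd z0; rewrite /mu (fracval_inv sp sq z0).
      have [_ pz qz _ _] := gd; have Mn := mu_inv_neq0 pz qz.
      have gM := inv_sqrt_mu_square hS S0 oS (@cderiv0_cst R) p10 q10 (erefl mu0) gd.
      by apply: (mulIf Mn); rewrite gM invf_div divfK.
  have trans := hypergeometric_transformation r0 r1 hS hF S0 oS oF (@cderiv0_cst R) p10 q10 (erefl mu0) ode.
  apply: filterS trans => z; rewrite !hyp2F1_powser => ->.
  have [->|z0] := eqVneq z 0; first by rewrite /transf_arg !mul0r.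
  by rewrite /mu (fracval_inv sp sq z0).
- have [A [B [g [m [[g0 AE BE] [cAB sA monA sB m0]]]]]] := mu_cube_reduction spq q0.
  have hm := isogeny_degree isog Q0 T0 generic p0 q0 PQpq g0 AE BE cAB sA monA sB m0.
  have inf := @infinite_E2 (CC R).
  have -> : d = m by apply/eqP; rewrite eqn_leq (has_degree_le inf hd hm) (has_degree_le inf hm hd).
  exact: (ratfun_degree_mu g0 AE BE cAB sA monA sB m0).
Qed.
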